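(* Let $r,k$ be positive integers and let $n\ge 2r$ be an integer. The set $\{\mathrm{MP}_{r,k}^\lambda:\lambda\in\Lambda^{\mathrm{MP}_{r,k}(n)}\}$ forms a complete set of irreducible representations for $\mathrm{MP}_{r,k}(n)$, and for each $\lambda\in\Lambda^{\mathrm{MP}_{r,k}(n)}$ the set $\{w_{\tilde T}:\tilde T\in\mathcal{SSMPT}_{\lambda,r,k}\}$ forms a basis of $\mathrm{MP}_{r,k}^\lambda$.
   Context: **Partition algebra.** $[r]=\{1,\dots,r\}$, $[\bar r]=\{\bar1,\dots,\bar r\}$; $\Pi_{2(r)}$ is the set of set partitions of $[r]\cup[\bar r]$, drawn as diagrams with top row $1,\dots,r$ and bottom row $\bar1,\dots,\bar r$. $P_r(n)$ is the $\mathbb{C}$-algebra with basis $\{\mathcal{L}_\pi:\pi\in\Pi_{2(r)}\}$ and product $\mathcal{L}_\pi\mathcal{L}_\nu=n^{c}\mathcal{L}_\gamma$: place $\pi$ above $\nu$, identify bottom vertex $\bar i$ of $\pi$ with top vertex $i$ of $\nu$; $\gamma$ is the resulting connectivity of the very top and very bottom, $c$ the number of components entirely in the middle. For $\sigma\in\mathfrak{S}_r$, $\mathcal{L}_\sigma$ is the basis element of $\{\{\sigma(1),\bar1\},\dots,\{\sigma(r),\bar r\}\}$. $W_{r,k}$ is the set of sequences of $k$ non-negative integers with sum $r$; $\mathfrak{S}_{\boldsymbol{a}}\subseteq\mathfrak{S}_r$ is the Young subgroup permuting separately the consecutive intervals of lengths $\boldsymbol{a}_1,\dots,\boldsymbol{a}_k$;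 $s_{\boldsymbol{a}}=\frac1{|\mathfrak{S}_{\boldsymbol{a}}|}\sum_{\sigma\in\mathfrak{S}_{\boldsymbol{a}}}\mathcal{L}_\sigma$. **Multiset partition algebra.** For $n\ge 2r$, $\mathrm{MP}_{r,k}(n)\cong\mathrm{End}_{\mathfrak{S}_n}(\mathcal{P}^r(V_{n,k}))$ (homogeneous degree-$r$ polynomial functions on $n\times k$ complex matrices, permutation matrices acting by $(M.f)(X)=f(M^{-1}X)$), and it is identified with the painted algebra $\tilde P_{r,k}(n)=\bigoplus_{\boldsymbol{a},\boldsymbol{b}\in W_{r,k}}s_{\boldsymbol{a}}P_r(n)s_{\boldsymbol{b}}$ (external direct sum) with product $(s_{\boldsymbol{a}}\varphi s_{\boldsymbol{b}})\cdot(s_{\boldsymbol{c}}\psi s_{\boldsymbol{d}})=\delta_{\boldsymbol{b},\boldsymbol{c}}s_{\boldsymbol{a}}\varphi s_{\boldsymbol{b}}\psi s_{\boldsymbol{d}}$. **Tableaux.** For a partition $\lambda\vdash n$, $\lambda^*=(\lambda_2,\lambda_3,\dots)$; Young diagrams are drawn with row $1$ (length $\lambda_1$) at the bottom. The last-letter order on multisets of integers: $\tilde S<\tilde R$ if $\tilde S$ is empty and $\tilde R$ is not, or $\max\tilde S<\max\tilde R$, or $\max\tilde S=\max\tilde R=m$ and $\tilde S\smallsetminus\{m\}<\tilde R\smallsetminus\{m\}$ (removing one copy of $m$); sets are compared the same way and empty boxes count as the empty multiset. For a set partition $\rho$ of $[r]$ with $|\lambda^*|\le\ell(\rho)$, $\ell(\rho)$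 being the number of blocks, a set partition tableau of shape $\lambda$ and content $\rho$ is a filling of the Young diagram of $\lambda$ by the blocks of $\rho$ (each used once) together with $n-\ell(\rho)$ empty boxes, all in the first row. $\mathcal{SPT}_{\lambda,r}$ is the set of these over all $\rho$; $\mathcal{SSPT}_{\lambda,r}$ is the subset of those whose rows increase left-to-right and columns increase bottom-to-top (standard; empty boxes come first in row 1). Replacing set partitions of $[r]$ by multiset partitions (multisets of nonempty multisets) with entries in $[k]$ and $r$ entries in total gives $\mathcal{MPT}_{\lambda,r,k}$; $\mathcal{SSMPT}_{\lambda,r,k}$ is the subset of those tableaux whose rows weakly increase left-to-right and whose columns strictly increase bottom-to-top (semistandard). $\Lambda^{\mathrm{MP}_{r,k}(n)}=\{\lambda\vdash n:\mathcal{SSMPT}_{\lambda,r,k}\ne\emptyset\}$ and $\Lambda^{P_r(n)}=\{\lambda\vdash n:\mathcal{SSPT}_{\lambda,r}\neq\emptyset\}$. **The $P_r(n)$-modules $P_r^\lambda$.** For $\lambda\in\Lambda^{P_r(n)}$, $P_r^\lambda$ has basis $\{v_T:T\in\mathcal{SSPT}_{\lambda,r}\}$. For arbitrary $T\in\mathcal{SPT}_{\lambda,r}$, $v_T$ is defined by the Specht-module straightening applied to the rows above the first row: $v_T$ depends on the first row only through its set $F$ of blocks, and for each fixed $F$ and fixed set $U$ of blocks occurring above the first row, the $v_T$ are the polytabloids of the Specht module of shape $\lambda^*$ on the set $U$ (so they satisfy the Garnir relations; in particular exchanging two boxes above the first row in the same column changes the sign of $v_T$). Action of $\mathcal{L}_\pi$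 on $v_T$: put the diagram of $\pi$ above the row of vertices $1,\dots,r$ connected according to the content of $T$, identifying $\bar i$ with $i$. If two blocks of $T$ lying above the first row become connected, or some block above the first row is not connected to the top of $\pi$, the result is $0$. Otherwise $\mathcal{L}_\pi v_T=n^{d}v_{T'}$, where each box of $T$ above the first row is refilled with the set of top vertices of $\pi$ it is connected to, every remaining component that meets the top contributes its set of top vertices as the content of a first-row box, all other first-row boxes are empty, and $d$ is the number of components not meeting the top row. **The modules $\mathrm{MP}_{r,k}^\lambda$.** $\mathrm{MP}_{r,k}^\lambda=\bigoplus_{\boldsymbol{a}\in W_{r,k}}s_{\boldsymbol{a}}P_r^\lambda$ (external direct sum), with $(s_{\boldsymbol{a}}\varphi s_{\boldsymbol{b}}).(s_{\boldsymbol{c}}m)=\delta_{\boldsymbol{b},\boldsymbol{c}}\,(s_{\boldsymbol{a}}\varphi s_{\boldsymbol{b}}).m\in s_{\boldsymbol{a}}P_r^\lambda$ for $m\in s_{\boldsymbol{c}}P_r^\lambda$. The coloring map $\kappa_{\boldsymbol{a}}:\mathcal{SPT}_{\lambda,r}\to\mathcal{MPT}_{\lambda,r,k}$ replaces each number in a tableau by the index $j\in[k]$ of the consecutive interval of $[r]$ (lengths $\boldsymbol{a}_1,\dots,\boldsymbol{a}_k$) containing it. For $\tilde T\in\mathcal{MPT}_{\lambda,r,k}$ whose entries have multiplicities $\boldsymbol{a}$, $w_{\tilde T}=s_{\boldsymbol{a}}v_T=\frac{1}{|\kappa_{\boldsymbol{a}}^{-1}(\tilde T)|}\sum_{S\in\kappa_{\boldsymbol{a}}^{-1}(\tilde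 T)}v_S\in s_{\boldsymbol{a}}P_r^\lambda$, for any $T$ with $\kappa_{\boldsymbol{a}}(T)=\tilde T$. *)

(* Defs.v *)
From HB Require Import structures.
From mathcomp Require Import all_boot all_order all_fingroup all_algebra.

Set Implicit Arguments.
Unset Strict Implicit.
Unset Printing Implicit Defensive.

Import GRing.Theory.
Local Open Scope ring_scope.

(* Algebras and modules are carried by subspaces of ambient vector spaces; the
   operations are only relevant on these subspaces. *)
Record algebra (F : fieldType) := MkAlgebra {
  alg_ambient : vectType F;
  alg_space : {vspace alg_ambient};
  alg_mul : alg_ambient -> alg_ambient -> alg_ambient;
  alg_one : alg_ambient }.

Record module (F : fieldType) (A : algebra F) := MkModule {
  mod_ambient : vectType F;
  mod_space : {vspace mod_ambient};
  mod_act : alg_ambient A -> mod_ambient -> mod_ambient }.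

Section Representations.
Variables (F : fieldType) (A : algebra F).
Local Notation a_space := (alg_space A).

Definition is_representation (M : module A) : Prop :=
  [/\ {in a_space & mod_space M, forall x u, mod_act x u \in mod_space M},
      forall c, {in a_space & a_space, forall x y, {in mod_space M, forall u,
        mod_act (c *: x + y) u = c *: mod_act x u + mod_act y u :> mod_ambient M}},
      forall c, {in a_space, forall x, {in mod_space M & mod_space M, forall u v,
        mod_act x (c *: u + v) = c *: mod_act x u + mod_act x v}},
      {in mod_space M, forall u, mod_act (alg_one A) u = u}
    & {in a_space & a_space, forall x y, {in mod_space M, forall u,
        mod_act (alg_mul x y) u = mod_act x (mod_act y u) :> mod_ambient M}}].

Definition is_submodule (M : module A) (U : {vspace mod_ambient M}) : Prop :=
  (U <= mod_space M)%VS /\ {in a_space & U, forall x u, mod_act x u \in U}.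

Definition irreducible_representation (M : module A) : Prop :=
  [/\ is_representation M, mod_space M <> 0%VS
    & forall U, is_submodule U -> U = 0%VS \/ U = mod_space M].

Definition isomorphic_modules (M N : module A) : Prop :=
  exists f : 'Hom(mod_ambient M, mod_ambient N),
    [/\ {in mod_space M &, injective f}, (f @: mod_space M)%VS = mod_space N
      & {in a_space & mod_space M,
          forall x u, f (mod_act x u) = mod_act x (f u)}].

Definition complete_set_of_irreps
    (I : Type) (D : I -> bool) (M : I -> module A) : Prop :=
  [/\ forall i, D i -> irreducible_representation (M i),
      forall i j, D i -> D j -> isomorphic_modules (M i) (M j) -> i = j
    & forall N, irreducible_representation N ->
        exists2 i, D i & isomorphic_modules N (M i)].

End Representations.

Section ExternalDirectSum.
Variables (F : fieldType) (I : finType) (V : vectType F).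

Definition ffun_eval (i : I) (f : {ffun I -> V}) : V := f i.

Fact ffun_eval_is_linear i : linear (ffun_eval i).
Proof. by move=> c f g; rewrite /ffun_eval !ffunE. Qed.
HB.instance Definition _ i := GRing.isLinear.Build F {ffun I -> V} V _
  (ffun_eval i) (ffun_eval_is_linear i).

Definition ext_dsum (U : I -> {vspace V}) : {vspace {ffun I -> V}} :=
  (\bigcap_i (linfun (ffun_eval i) @^-1: U i))%VS.

Lemma mem_ext_dsum (U : I -> {vspace V}) (f : {ffun I -> V}) :
  reflect (forall i, f i \in U i) (f \in ext_dsum U).
Proof.
rewrite /ext_dsum memvE; apply: (iffP subv_bigcapP) => fU i.
  by move: (fU i isT); rewrite -memvE -memv_preim lfunE.
by move=> _; rewrite -memvE -memv_preim lfunE; apply: fU.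
Qed.

End ExternalDirectSum.

(* The finest partition of [T] each of whose blocks is a union of sets of [E]
   and points: the connected components of the hypergraph [E]. *)
Definition components (T : finType) (E : {set {set T}}) : {set {set T}} :=
  equivalence_partition
    (connect [rel x y | [exists B in E, (x \in B) && (y \in B)]]) [set: T].

Section PartitionAlgebra.
Variable r : nat.

(* [inl i] is the top vertex i and [inr i] the bottom vertex i-bar; vertices
   are numbered from 0. *)
Local Notation vertex := ('I_r + 'I_r)%type.

Definition diagram := {P : {set {set vertex}} | partition P [set: vertex]}.

(* In a stack of two diagrams, [inl (inl i)], [inl (inr i)] and [inr i] are the
   top, middle and bottom vertices. *)
Local Notation stack_vertex := ('I_r + 'I_r + 'I_r)%type.

Definition upper : vertex -> stack_vertex := inl.

Definition lower (v : vertex) : stack_vertex :=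
  match v with inl i => inl (inr i) | inr i => inr i end.

Definition outer (v : vertex) : stack_vertex :=
  match v with inl i => inl (inl i) | inr i => inr i end.

Definition stack (p q : diagram) : {set {set stack_vertex}} :=
  components ([set upper @: B | B : {set vertex} in val p]
          :|: [set lower @: B | B : {set vertex} in val q]).

Definition stack_blocks (p q : diagram) : {set {set vertex}} :=
  [set outer @^-1: C | C : {set stack_vertex} in stack p q] :\ set0.

Definition stack_inner (p q : diagram) : nat :=
  #|[set C in stack p q | outer @^-1: C == set0]|.

Variables (F : fieldType) (n : nat).

Definition partalg : vectType F := {ffun diagram -> F^o} : Type.

Definition diag_elt (P : {set {set vertex}}) : partalg :=
  [ffun p : diagram => (val p == P)%:R].

Definition partalg_mul (x y : partalg) : partalg :=
  \sum_p \sum_q (x p * y q * n%:R ^+ stack_inner p q)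
    *: diag_elt (stack_blocks p q).

Definition perm_elt (s : 'S_r) : partalg :=
  diag_elt [set [set inl (s i); inr i] | i : 'I_r].

End PartitionAlgebra.

(* Multisets with entries in ['I_k], given by multiplicities; multiplicities
   at most [r] suffice since only multisets with at most [r] entries occur. *)
Notation multiset r k := {ffun 'I_k -> 'I_r.+1}.

Definition msize r k (m : multiset r k) : nat := (\sum_(j < k) m j)%N.

Definition weight (r k : nat) := {a : multiset r k | msize a == r}.

Section PaintedAlgebra.
Variables (F : fieldType) (r k n : nat).
Local Notation W := (weight r k).
Local Notation partalg := (partalg r F).
Local Notation "x ** y" := (partalg_mul n x y) (at level 40, left associativity).

Definition in_interval (a : W) (j : 'I_k) (i : 'I_r) : bool :=
  (\sum_(l < k | l < j) val a l <= i < \sum_(l < k | l <= j) val a l)%N.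

Definition young_subgroup (a : W) : {set 'S_r} :=
  [set s : 'S_r | [forall i, forall j, in_interval a j i ==> in_interval a j (s i)]].

Definition young_idem (a : W) : partalg :=
  #|young_subgroup a|%:R^-1 *: \sum_(s in young_subgroup a) perm_elt F s.

Definition sandwich (ab : W * W) (x : partalg) : partalg :=
  young_idem ab.1 ** x ** young_idem ab.2.

Fact sandwich_is_linear ab : linear (sandwich ab).
Proof.
have mulDl c x y z : (c *: x + y) ** z = c *: (x ** z) + y ** z.
  rewrite /partalg_mul scaler_sumr -big_split; apply: eq_bigr => p _.
  rewrite scaler_sumr -big_split; apply: eq_bigr => q _ /=.
  by rewrite !ffunE !mulrDl scalerDl -[c *: x p]/(c * x p) -!mulrA -scalerA.
have mulDr c x y z : z ** (c *: x + y) = c *: (z ** x) + z ** y.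
  rewrite /partalg_mul scaler_sumr -big_split; apply: eq_bigr => p _.
  rewrite scaler_sumr -big_split; apply: eq_bigr => q _ /=.
  rewrite !ffunE mulrDr mulrDl scalerDl -[c *: x q]/(c * x q).
  by rewrite [z p * (c * _)]mulrCA -!mulrA -scalerA.
by move=> c x y; rewrite /sandwich mulDr mulDl.
Qed.
HB.instance Definition _ ab := GRing.isLinear.Build F partalg partalg _
  (sandwich ab) (sandwich_is_linear ab).

Definition mp_mul (x y : {ffun W * W -> partalg}) : {ffun W * W -> partalg} :=
  [ffun ad => \sum_b x (ad.1, b) ** y (b, ad.2)].

Definition mp_one : {ffun W * W -> partalg} :=
  [ffun ab => if ab.1 == ab.2 then young_idem ab.1 else 0].

(* The component at [(a, b)] of an element lies in s_a P_r(n) s_b. *)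
Definition MP : algebra F :=
  MkAlgebra (ext_dsum (fun ab => limg (linfun (sandwich ab)))) mp_mul mp_one.

End PaintedAlgebra.

Definition partition_of (n : nat) (l : seq nat) : bool :=
  [&& sorted geq l, 0%N \notin l & sumn l == n].

(* Row 0 is the first (bottom) row. *)
Definition box (l : seq nat) : finType := {i : 'I_(size l) & 'I_(nth 0 l i)}.

Definition box_row l (b : box l) : 'I_(size l) := tag b.
Definition box_col l (b : box l) : nat := tagged b.

(* The last-letter order, on multisets written as weakly decreasing words: the
   head of such a word is the maximum. *)
Fixpoint last_letter_lt (s t : seq nat) : bool :=
  match s, t with
  | _, [::] => false
  | [::], _ :: _ => true
  | x :: s', y :: t' => (x < y)%N || (x == y) && last_letter_lt s' t'
  end.

Definition set_word r (A : {set 'I_r}) : seq nat :=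
  rev [seq val i | i <- enum A].

Definition multiset_word r k (m : multiset r k) : seq nat :=
  rev (flatten [seq nseq (m j) (val j) | j <- enum 'I_k]).

Definition semistandard l (w : box l -> seq nat) : bool :=
  [forall b, forall b',
     ((box_row b == box_row b') && (box_col b < box_col b')%N ==>
        (w b == w b') || last_letter_lt (w b) (w b'))
  && ((box_col b == box_col b') && (box_row b < box_row b')%N ==>
        last_letter_lt (w b) (w b'))].

Section Tableaux.
Variables (l : seq nat) (r k : nat).

Definition set_filling : finType := {ffun box l -> {set 'I_r}}.
Definition mset_filling : finType := {ffun box l -> multiset r k}.

Definition SPT : {set set_filling} :=
  [set T : set_filling |
    [&& partition ([set T b | b : box l] :\ set0) [set: 'I_r],
        [forall b, forall b', (T b == T b') && (T b != set0) ==> (b == b')]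
      & [forall b, (0 < box_row b)%N ==> (T b != set0)]]].

(* Distinct boxes of such a tableau can only have equal contents if both are
   empty, so weakly increasing rows are the required ones here too. *)
Definition SSPT : {set set_filling} :=
  [set T in SPT | semistandard (fun b => set_word (T b))].

Definition MPT : {set mset_filling} :=
  [set T : mset_filling |
    [forall b, (0 < box_row b)%N ==> (0 < msize (T b))%N]
    && (\sum_b msize (T b) == r)%N].

Definition SSMPT : {set mset_filling} :=
  [set T in MPT | semistandard (fun b => multiset_word (T b))].

Definition coloring (a : weight r k) (T : set_filling) : mset_filling :=
  [ffun b => [ffun j => inord #|[set i in T b | in_interval a j i]|]].

Definition has_weight (a : weight r k) (T : mset_filling) : bool :=
  [forall j, val a j == \sum_b T b j :> nat]%N.

End Tableaux.

Definition Lambda_MP (r k n : nat) (l : seq nat) : bool :=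
  partition_of n l && (SSMPT l r k != set0).

Section PartitionModule.
Variables (F : fieldType) (r n : nat) (l : seq nat).

(* A tabloid is a set partition tableau up to permutation of the boxes of each
   row, i.e. the set of (nonempty) blocks in each row. In particular the first
   row is only recorded through its set of blocks. *)
Definition tabloid : finType := {ffun 'I_(size l) -> {set {set 'I_r}}}.

Definition tabloid_of (T : set_filling l r) : tabloid :=
  [ffun i => [set T b | b : box l & box_row b == i] :\ set0].

Definition tabspace : vectType F := {ffun tabloid -> F^o} : Type.

Definition tabloid_elt (t : tabloid) : tabspace := [ffun t' => (t' == t)%:R].

Definition column_group : {set {perm box l}} :=
  [set s : {perm box l} | [forall b,
     (box_col (s b) == box_col b) && ((val (box_row b) == 0%N) ==> (s b == b))]].

(* The vector v_T: the column antisymmetrizer fixes the first row, so this is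
   the polytabloid of the part of T above the first row, tagged by the set of
   blocks of the first row. *)
Definition polytabloid (T : set_filling l r) : tabspace :=
  \sum_(s in column_group)
    (-1) ^+ s *: tabloid_elt (tabloid_of [ffun b => T (s b)]).

Definition Pmod : {vspace tabspace} := <<[seq polytabloid T | T in SSPT l r]>>%VS.

(* A diagram acts on tabloids by the rule prescribed for the vectors v_T; the
   induced rule on the v_T is [diagram_act_polytabloid] below. *)
Section DiagramAction.
Variables (p : diagram r) (t : tabloid).

Definition blocks : {set {set 'I_r}} := \bigcup_i t i.
Definition upper_blocks : {set {set 'I_r}} :=
  \bigcup_(i : 'I_(size l) | (0 < i)%N) t i.

Definition act_stack : {set {set 'I_r + 'I_r}} :=
  components (val p :|: [set inr @: B | B : {set 'I_r} in blocks]).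

Definition top_part (C : {set 'I_r + 'I_r}) : {set 'I_r} := inl @^-1: C.

Definition contains_block (C : {set 'I_r + 'I_r}) (B : {set 'I_r}) : bool :=
  inr @: B \subset C.

Definition image_block (B : {set 'I_r}) : {set 'I_r} :=
  \bigcup_(C in act_stack | contains_block C B) top_part C.

Definition act_nonzero : bool :=
  [forall B in upper_blocks, image_block B != set0]
  && [forall C in act_stack, forall B in upper_blocks, forall B' in upper_blocks,
        contains_block C B && contains_block C B' ==> (B == B')].

Definition image_first_row : {set {set 'I_r}} :=
  [set top_part C | C in act_stack &
     [forall B in upper_blocks, ~~ contains_block C B]] :\ set0.

Definition image_tabloid : tabloid :=
  [ffun i : 'I_(size l) => if val i == 0%N then image_first_row
                           else [set image_block B | B in t i]].

Definition act_exponent : nat := #|[set C in act_stack | top_part C == set0]|.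

Definition diagram_act : tabspace :=
  if act_nonzero then n%:R ^+ act_exponent *: tabloid_elt image_tabloid else 0.

End DiagramAction.

Definition partalg_act (x : partalg r F) (u : tabspace) : tabspace :=
  \sum_p \sum_t (x p * u t) *: diagram_act p t.

Fact partalg_act_is_linear x : linear (partalg_act x).
Proof.
move=> c u v; rewrite /partalg_act scaler_sumr -big_split; apply: eq_bigr => p _.
rewrite scaler_sumr -big_split; apply: eq_bigr => t _ /=.
by rewrite !ffunE mulrDr scalerDl -[c *: u t]/(c * u t) mulrCA scalerA.
Qed.
HB.instance Definition _ x := GRing.isLinear.Build F tabspace tabspace _
  (partalg_act x) (partalg_act_is_linear x).

Lemma partalg_act_basis p t :
  partalg_act (diag_elt F (val p)) (tabloid_elt t) = diagram_act p t.
Proof.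
rewrite /partalg_act (bigD1 p) //= [X in _ + X]big1 => [|q /negPf qp]; last first.
  by rewrite big1 // => t' _; rewrite !ffunE val_eqE qp mul0r scale0r.
rewrite (bigD1 t) //= big1 => [|t' /negPf tt']; last first.
  by rewrite !ffunE tt' mulr0 scale0r.
by rewrite !addr0 !ffunE !eqxx mul1r scale1r.
Qed.

Section ActionOnPolytabloids.
Variables (p : diagram r) (T : set_filling l r).

Let perm_filling (s : {perm box l}) (S : set_filling l r) : set_filling l r :=
  [ffun b => S (s b)].

Lemma column_group_first_row s b : s \in column_group ->
  (val (box_row (s b)) == 0%N) = (val (box_row b) == 0%N).
Proof.
rewrite inE => /forallP sP; apply/idP/idP => [sb0|b0].
  have /andP[_ /implyP/(_ sb0)/eqP/perm_inj ssb] := sP (s b).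
  by rewrite -{1}ssb.
by have /andP[_ /implyP/(_ b0)/eqP->] := sP b.
Qed.

Lemma blocks_tabloid (S : set_filling l r) :
  blocks (tabloid_of S) = [set S b | b : box l] :\ set0.
Proof.
apply/setP => B; apply/bigcupP/setD1P => [[i _]|[B0 /imsetP[b _ eB]]].
  by rewrite ffunE => /setD1P[B0 /imsetP[b _ eB]]; split; rewrite // eB imset_f.
exists (box_row b) => //; rewrite ffunE; apply/setD1P; split=> //.
by apply/imsetP; exists b; rewrite ?inE.
Qed.

Lemma upper_blocks_tabloid (S : set_filling l r) :
  upper_blocks (tabloid_of S) =
    [set S b | b : box l & (0 < box_row b)%N] :\ set0.
Proof.
apply/setP => B; apply/bigcupP/setD1P => [[i i0]|[B0 /imsetP[b b0 eB]]].
  rewrite ffunE => /setD1P[B0 /imsetP[b]]; rewrite inE => /eqP ib eB.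
  by split=> //; apply/imsetP; exists b; rewrite // inE ib.
exists (box_row b); first by rewrite inE in b0.
rewrite ffunE; apply/setD1P; split=> //; by apply/imsetP; exists b; rewrite ?inE.
Qed.

Lemma diagram_act_eq (t t' : tabloid) :
  blocks t' = blocks t -> upper_blocks t' = upper_blocks t ->
  [/\ act_nonzero p t' = act_nonzero p t, act_exponent p t' = act_exponent p t,
      image_block p t' =1 image_block p t
    & image_first_row p t' = image_first_row p t].
Proof.
by move=> eb eu; rewrite /act_nonzero /act_exponent /image_first_row
  /image_block /act_stack eb eu.
Qed.

Lemma column_group_blocks s :
  blocks (tabloid_of (perm_filling s T)) = blocks (tabloid_of T).
Proof.
rewrite !blocks_tabloid; congr (_ :\ _); apply/setP => B.
apply/imsetP/imsetP => [[b _ ->]|[b _ ->]].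
  by exists (s b); rewrite ?ffunE.
by exists ((s^-1)%g b); rewrite ?ffunE ?permKV.
Qed.

Lemma column_group_upper_blocks s : s \in column_group ->
  upper_blocks (tabloid_of (perm_filling s T)) = upper_blocks (tabloid_of T).
Proof.
move=> sG; rewrite !upper_blocks_tabloid; congr (_ :\ _); apply/setP => B.
have s0 := column_group_first_row _ sG.
apply/imsetP/imsetP => [[b b0 ->]|[b b0 ->]].
  by exists (s b); rewrite ?ffunE // inE lt0n s0 -lt0n; rewrite inE in b0.
exists ((s^-1)%g b); rewrite ?ffunE ?permKV //.
by rewrite inE lt0n -s0 permKV -lt0n; rewrite inE in b0.
Qed.

(* The defining rule for the action of a diagram on v_T, for an arbitrary set
   partition tableau T. *)
Lemma diagram_act_polytabloid_eq0 :
  ~~ act_nonzero p (tabloid_of T) ->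
  partalg_act (diag_elt F (val p)) (polytabloid T) = 0.
Proof.
move=> T0; rewrite /polytabloid linear_sum big1 // => s sG.
rewrite linearZ /= partalg_act_basis /diagram_act.
have [-> _ _ _] := diagram_act_eq (column_group_blocks s)
  (column_group_upper_blocks sG).
by rewrite (negPf T0) scaler0.
Qed.

Lemma diagram_act_polytabloid (T' : set_filling l r) :
  T \in SPT l r -> T' \in SPT l r -> act_nonzero p (tabloid_of T) ->
  (forall b, (0 < box_row b)%N -> T' b = image_block p (tabloid_of T) (T b)) ->
  [set T' b | b : box l & box_row b == 0%N :> nat] :\ set0
    = image_first_row p (tabloid_of T) ->
  partalg_act (diag_elt F (val p)) (polytabloid T)
    = n%:R ^+ act_exponent p (tabloid_of T) *: polytabloid T'.
Proof.
move=> TS T'S Tn0 T'up T'row0; rewrite /polytabloid linear_sum scaler_sumr.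
apply: eq_bigr => s sG; rewrite linearZ /= partalg_act_basis /diagram_act.
have [-> -> eim erow] := diagram_act_eq (column_group_blocks s)
  (column_group_upper_blocks sG).
rewrite Tn0 !scalerA mulrC; congr (_ *: tabloid_elt _).
apply/ffunP => i; rewrite !ffunE; have s0 := column_group_first_row _ sG.
case: ifP => [i0|/negbT]; last rewrite -lt0n => i0.
  rewrite erow -T'row0; congr (_ :\ _); apply/setP => B.
  have sid b : val (box_row b) == 0%N -> s b = b.
    by move: sG; rewrite inE => /forallP/(_ b)/andP[_ /implyP sb /sb/eqP].
  apply/imsetP/imsetP => -[b bi ->]; move: bi; rewrite inE => bi; exists b;
    rewrite ?inE ?ffunE ?sid // -?val_eqE /= ?(eqP i0) //.
    - by rewrite -(eqP i0).
    by rewrite (eqP bi) i0.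
have eS (b : box l) : box_row b = i ->
    [/\ T (s b) != set0, T' (s b) != set0
      & T' (s b) = image_block p (tabloid_of T) (T (s b))].
  move=> bi; have sb0 : (0 < box_row (s b))%N by rewrite lt0n s0 -lt0n bi.
  move: TS T'S; rewrite !inE => /and3P[_ _ /forallP/(_ (s b))].
  by rewrite sb0 /= => -> /and3P[_ _ /forallP/(_ (s b))]; rewrite sb0 /= T'up.
apply/setP => B; apply/imsetP/setD1P => [[C /setD1P[C0 /imsetP[b]]]|[B0 /imsetP[b]]].
  rewrite inE => /eqP bi ->; rewrite ffunE => ->; rewrite eim.
  have [_ T'0 <-] := eS b bi; split=> //.
  by apply/imsetP; exists b; rewrite ?inE ?bi ?ffunE.
rewrite inE => /eqP bi ->; rewrite ffunE; have [T0 _ ->] := eS b bi.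
exists (T (s b)); last by rewrite eim.
by rewrite !inE T0; apply/imsetP; exists b; rewrite ?inE ?bi ?ffunE.
Qed.

End ActionOnPolytabloids.

End PartitionModule.

Section MultisetPartitionModule.
Variables (F : fieldType) (r k n : nat) (l : seq nat).
Local Notation W := (weight r k).

Definition mp_act (x : {ffun W * W -> partalg r F})
    (u : {ffun W -> tabspace F r l}) : {ffun W -> tabspace F r l} :=
  [ffun a => \sum_b partalg_act n (x (a, b)) (u b)].

Definition MPmod : module (MP F r k n) :=
  @MkModule F (MP F r k n) {ffun W -> tabspace F r l}
    (ext_dsum (fun a =>
       (linfun (partalg_act n (young_idem F a)) @: Pmod F r l)%VS))
    mp_act.

Definition coloring_fiber (a : W) (T : mset_filling l r k)
    : {set set_filling l r} :=
  [set S in SPT l r | coloring a S == T].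

Definition w_vector (T : mset_filling l r k) : mod_ambient MPmod :=
  [ffun a : W => if has_weight a T then
     #|coloring_fiber a T|%:R^-1
       *: \sum_(S in coloring_fiber a T) polytabloid F S
   else 0].

End MultisetPartitionModule.

(* Main.v *)
(* Partition diagrams act faithfully on the r-th tensor power of an n-letter space
   (here 2r <= n is used), which gives associativity of P_r(n) and, after sending
   tabloids to tensors killed by contractions, the module axioms for P_r^lambda.

   Let z be the column antisymmetrizer of a tableau of shape lambda with as few
   blocks in the first row as possible, written with diagrams. It maps P_r^lambda
   to a line and kills P_r^mu for mu above lambda in a suitable order, by a
   rearrangement argument on column permutations; as diagrams have adjoints for the
   inner product of tensors, this yields irreducibility and separates the modules.
   Cutting down by the idempotents s_a transfers both to MP_{r,k}(n). Straightening
   in the colored tableaux shows that the w_T with T semistandard span; they are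
   independent because, among the rearrangements of T in its columns, the identity
   alone maximizes the sum over the boxes of row times rank.

   For completeness, let N be irreducible, let m be the least number of propagating
   blocks of a diagram not acting by zero on N, and let half-diagrams with m marked
   blocks act on a vector of N. Among the families of vectors so obtained, which are
   permuted by the symmetric group of the marks, choose one alternating on disjoint
   sets X of marks with the sum of the 3^|X| maximal. Maximality forces these sets to
   cover the marks and the Garnir sums to vanish, so the X are the columns of a shape
   lambda and straightening defines a nonzero morphism from MP_{r,k}^lambda to N. *)

From HB Require Import structures.
Require Import Defs.
From mathcomp Require Import all_boot all_order all_fingroup all_algebra.
From mathcomp Require Import reals complex zify ring.
From mathcomp Require boolp.

Set Implicit Arguments.
Unset Strict Implicit.
Unset Printing Implicit Defensive.

Import Order.TTheory GRing.Theory Num.Theory.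
Local Open Scope ring_scope.

(** * Connected components and partition algebras *)

(** Every rule in play (the product of P_r(n), the action on v_T, the products with half-diagrams)
    ends in one count: functions into an n-letter alphabet, constant on the components of a
    hypergraph and prescribed at some vertices. Over such an alphabet, associativity and the module
    axioms become exchanges of finite sums.

    The obstacle is the zero clause of the action, where blocks above the first row merge or lose
    contact with the top row. A tensor respects it only if it vanishes when two upper boxes carry
    equal letters and sums to zero over each upper letter; hence the signs attached to letters. The
    same two failures return when diagrams multiply half-diagrams: there they produce diagrams with
    fewer propagating blocks, which is why minimality of m is needed.

    Completeness avoids semisimplicity and any comparison of dimensions: for an arbitrary
    irreducible N a morphism has to be constructed. It can only be prescribed on the semistandard
    basis, and its value on all other tableaux is recovered by applying straightening to the
    difference of the two candidate formulas. *)

Section Connectivity.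
Variables (T : finType) (E : {set {set T}}).

Definition hconn : rel T :=
  connect [rel x y | [exists B in E, (x \in B) && (y \in B)]].

Lemma hconn_refl x : hconn x x. Proof. exact: connect0. Qed.

Lemma hconn_sym x y : hconn x y = hconn y x.
Proof.
apply: sym_connect_sym => a b /=.
by apply/exists_inP/exists_inP => -[B BE]; rewrite andbC => ?; exists B.
Qed.

Lemma hconn_trans : transitive hconn. Proof. exact: connect_trans. Qed.

Lemma hconn_edge B x y : B \in E -> x \in B -> y \in B -> hconn x y.
Proof.
by move=> BE xB yB; apply: connect1; apply/exists_inP; exists B; rewrite ?xB.
Qed.

Lemma hconn_equiv : {in [set: T] & &, equivalence_rel hconn}.
Proof.
move=> x y z _ _ _; split; first exact: hconn_refl.
move=> xy; apply/idP/idP => [xz|]; last exact: hconn_trans.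
by apply: hconn_trans xz; rewrite hconn_sym.
Qed.

Lemma components_partition : partition (components E) [set: T].
Proof. exact: equivalence_partitionP hconn_equiv. Qed.

Lemma mem_components x : [set y | hconn x y] \in components E.
Proof. by apply/imsetP; exists x => //; apply/setP => y; rewrite !inE. Qed.

Lemma componentsP (C : {set T}) :
  reflect (exists x, C = [set y | hconn x y]) (C \in components E).
Proof.
apply: (iffP imsetP) => [[x _ ->]|[x ->]]; exists x => //;
  by apply/setP => y; rewrite !inE.
Qed.

Definition compat (Om : eqType) (h : T -> Om) : bool :=
  [forall B in E, forall x in B, forall y in B, h x == h y].

Lemma compatP (Om : eqType) (h : T -> Om) :
  reflect (forall x y, hconn x y -> h x = h y) (compat h).
Proof.
apply: (iffP forall_inP) => [hE x y /connectP[p]|hE B BE].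
  elim: p x => /= [x _ -> //|z p IHp x /andP[/exists_inP[B BE /andP[xB zB]] zp]].
  move=> /(IHp z zp) <-.
  by have /forall_inP/(_ x xB)/forall_inP/(_ z zB)/eqP := hE B BE.
apply/forall_inP => x xB; apply/forall_inP => y yB.
by apply/eqP/hE; apply: hconn_edge BE xB yB.
Qed.

End Connectivity.

Lemma compat_eq (T : finType) (E : {set {set T}}) (Om : eqType) (h h' : T -> Om) :
  h =1 h' -> compat E h = compat E h'.
Proof. by move=> hh; apply/compatP/compatP => H x y /H; rewrite !hh. Qed.

Lemma compatU (T : finType) (E E' : {set {set T}}) (Om : eqType) (h : T -> Om) :
  compat (E :|: E') h = compat E h && compat E' h.
Proof.
apply/forall_inP/andP => [H|[/forall_inP H /forall_inP H'] B].
  by split; apply/forall_inP => B BE; apply: H; rewrite inE BE ?orbT.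
by rewrite inE => /orP[/H|/H'].
Qed.

Lemma hconn_compat (T : finType) (E : {set {set T}}) (Om : eqType) (h : T -> Om) x y :
  compat E h -> hconn E x y -> h x = h y.
Proof. by move=> /compatP; apply. Qed.

(** The indicator function of such a set is constant on every edge, hence on components. *)
Lemma pblock_compat (T : finType) (E : {set {set T}}) x y :
  hconn E x y -> forall (A : {set T}), (forall B, B \in E -> [disjoint A & B] || (B \subset A)) ->
  (x \in A) = (y \in A).
Proof.
move=> xy A HA; apply: (@hconn_compat _ E _ (fun x => x \in A)) xy.
apply/forall_inP => B BE; apply/forall_inP => u uB; apply/forall_inP => v vB.
have /orP[dAB|/subsetP sAB] := HA B BE; last by rewrite !sAB.
by rewrite !(disjointFl dAB).
Qed.

Lemma hconn_partition (T : finType) (P : {set {set T}}) x y :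
  partition P [set: T] -> hconn P x y = (y \in pblock P x).
Proof.
move=> PP; have [/eqP cP tP _] := and3P PP.
have inP z : z \in cover P by rewrite cP.
apply/idP/idP => [xy|yx].
  rewrite -(pblock_compat xy) ?mem_pblock // => B BP.
  have [->|nB] := eqVneq (pblock P x) B; first by rewrite subxx orbT.
  by have /trivIsetP/(_ _ _ (pblock_mem (inP x)) BP nB)-> := tP.
by apply: hconn_edge (pblock_mem (inP x)) _ yx; rewrite mem_pblock.
Qed.

(** * Counting functions constant on components with prescribed values *)

Section Extensions.
Variables (X Y Om : finType) (o : Y -> X) (E : {set {set X}}) (phi : {ffun Y -> Om}).
Variable (w0 : Om).

(** Such a function is free exactly on the components that [o] does not reach. This is the common
    source of the powers of n in the product of diagrams and in their action on tableaux. *)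
Lemma card_extensions :
  #|[set h : {ffun X -> Om} | compat E h && [forall y, h (o y) == phi y]]| =
  if [forall y, forall z, hconn E (o y) (o z) ==> (phi y == phi z)]
  then (#|Om| ^ #|[set C in components E | o @^-1: C == set0]|)%N else 0%N.
Proof.
case: ifP => [/forallP phiE|/negP phiE]; last first.
  apply: eq_card0 => h; rewrite inE; apply/negP => /andP[/compatP hE /forallP ho].
  apply: phiE; apply/forallP => y; apply/forallP => z; apply/implyP => yz.
  by rewrite -(eqP (ho y)) -(eqP (ho z)) (hE _ _ yz).
have {phiE} phiE y z : hconn E (o y) (o z) -> phi y = phi z.
  by move=> yz; have /forallP/(_ z)/implyP/(_ yz)/eqP := phiE y.
set D := [set C in _ | _].
pose cls x := [set y | hconn E x y].
have clsE x y : hconn E x y -> cls x = cls y.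
  move=> xy; apply/setP => z; rewrite !inE.
  by apply/idP/idP; apply: hconn_trans => //; rewrite hconn_sym.
pose ext (G : {ffun {set X} -> Om}) : {ffun X -> Om} :=
  [ffun x => if [pick y | o y \in cls x] is Some y then phi y else G (cls x)].
have extE G x : cls x \in D -> ext G x = G (cls x).
  rewrite inE ffunE => /andP[_ /eqP/setP x0]; case: pickP => // y.
  by move: (x0 y); rewrite !inE => ->.
(* [G] supplies the values on the components in [D]; requiring the value [w0] elsewhere makes [G]
   recoverable from [ext G]. *)
transitivity #|[set ext G | G in pffun_on w0 (mem D) (mem Om)]|.
  apply: eq_card => h; rewrite inE; apply/andP/imsetP => [[/compatP hE /forallP ho]|].
    exists [ffun C : {set X} => if [pick x in C] is Some x then
                                  if C \in D then h x else w0 else w0].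
      apply/pffun_onP; split=> [|_ _] //.
      apply/supportP => C CD; rewrite ffunE (negPf CD).
      by case: pickP.
    apply/ffunP => x; rewrite ffunE; case: pickP => [y|y0].
      by rewrite inE => /hE ->; rewrite (eqP (ho y)).
    rewrite ffunE; case: pickP => [z|/(_ x)]; rewrite !inE ?hconn_refl // => xz.
    rewrite mem_components; case: eqP => [_|]; first exact: hE.
    by case; apply/setP => y; move: (y0 y); rewrite !inE.
  move=> [G _ ->]; split.
    apply/compatP => x y xy; rewrite !ffunE (clsE _ _ xy).
    by [].
  apply/forallP => y; rewrite ffunE; case: pickP => [z|/(_ y)].
    by rewrite inE => /phiE->.
  by rewrite inE hconn_refl.
rewrite card_in_imset ?card_pffun_on // => G G' /pffun_onP[/supportP GD _] /pffun_onP[/supportP GD' _] eG.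
apply/ffunP => C; have [CD|nCD] := boolP (C \in D); last by rewrite GD ?GD'.
have /componentsP[x Cx] : C \in components E by move: CD; rewrite inE => /andP[].
by rewrite Cx -!extE -?eG // -/(cls x) /cls -Cx.
Qed.

End Extensions.

Lemma compat_imset (X Y : finType) (e : X -> Y) (E : {set {set X}}) (Om : eqType)
    (h : Y -> Om) :
  compat [set e @: B | B : {set X} in E] h = compat E (h \o e).
Proof.
apply/forall_inP/forall_inP => H B.
  move=> BE; apply/forall_inP => x xB; apply/forall_inP => y yB.
  have /forall_inP/(_ _ (imset_f e xB))/forall_inP := H _ (imset_f _ BE).
  by apply; apply: imset_f.
case/imsetP=> C /H /forall_inP HC ->; apply/forall_inP => _ /imsetP[x xC ->].
by apply/forall_inP => _ /imsetP[y yC ->]; have /forall_inP := HC x xC; apply.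
Qed.

Lemma preim_components_partition (X Y : finType) (o : Y -> X) (E : {set {set X}}) :
  partition ([set o @^-1: C | C : {set X} in components E] :\ set0) [set: Y].
Proof.
apply/and3P; split; last by rewrite !inE eqxx.
  apply/eqP/setP => y; rewrite inE; apply/bigcupP.
  exists (o @^-1: [set x | hconn E (o y) x]); last by rewrite !inE hconn_refl.
  rewrite !inE imset_f ?mem_components // andbT.
  by apply/set0Pn; exists y; rewrite !inE hconn_refl.
apply/trivIsetP => A B /setD1P[_ /imsetP[C /componentsP[x ->] ->]].
move=> /setD1P[_ /imsetP[D /componentsP[y ->] ->]] nAB.
apply/pred0P => z /=; rewrite !inE; apply/negP => /andP[xz yz].
case/eqP: nAB; apply/setP => t; rewrite !inE.
have xy : hconn E x y by apply: hconn_trans xz _; rewrite hconn_sym.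
by apply/idP/idP; apply: hconn_trans => //; rewrite hconn_sym.
Qed.

(** Sending a block of [Q] to the block of [P] around it is surjective; if [Q] has no more blocks
    than [P], it is bijective and each block equals its image. The number of blocks thus serves as a
    rank in triangularity arguments. *)
Lemma partition_refine (T : finType) (P Q : {set {set T}}) :
  partition P [set: T] -> partition Q [set: T] ->
  (forall x y, hconn Q x y -> hconn P x y) -> Q = P \/ (#|P| < #|Q|)%N.
Proof.
move=> PP QQ QP; have [/eqP cP tP P0] := and3P PP; have [/eqP cQ tQ Q0] := and3P QQ.
have inP z : z \in cover P by rewrite cP.
have inQ z : z \in cover Q by rewrite cQ.
pose f (B : {set T}) := [set y | [exists x in B, hconn P x y]].
have fE B x : B \in Q -> x \in B -> f B = pblock P x.
  move=> BQ xB; apply/setP => y; rewrite inE -hconn_partition //.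
  apply/exists_inP/idP => [[z zB zy]|]; last by exists x.
  by apply: hconn_trans zy; apply: QP; apply: hconn_edge BQ _ _.
have fQ : f @: Q = P.
  apply/setP => B; apply/imsetP/idP => [[C CQ ->]|BP].
    have /set0Pn[x xC] : C != set0 by apply: contraNneq Q0 => <-.
    by rewrite (fE C x) // pblock_mem.
  have /set0Pn[x xB] : B != set0 by apply: contraNneq P0 => <-.
  exists (pblock Q x); first exact: pblock_mem.
  by rewrite (fE _ x) ?pblock_mem ?mem_pblock // (def_pblock tP BP xB).
have [|le] := ltnP #|P| #|Q|; [by right | left].
have /imset_injP fI : #|f @: Q| == #|Q| by rewrite eqn_leq leq_imset_card fQ.
rewrite -fQ -[LHS]imset_id; apply: eq_in_imset => B BQ; apply/setP => y.
have /set0Pn[x xB] : B != set0 by apply: contraNneq Q0 => <-.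
rewrite (fE B x) // -hconn_partition //; apply/idP/idP => [yB|xy].
  by apply: QP; apply: hconn_edge BQ _ _.
suff <- : pblock Q y = B by rewrite mem_pblock.
apply: fI => //; first exact: pblock_mem.
rewrite (fE _ y) ?pblock_mem ?mem_pblock // (fE B x) //.
by apply/eqP; rewrite eq_sym eq_pblock // -hconn_partition.
Qed.

(** Evaluate the relation at the point of an index of maximal rank among those with nonzero
    coefficient: only this index contributes. Used for diagrams, for tabloids and for the vectors
    w_T. *)
Lemma triangular_free (F : fieldType) (I : finType) (Y : Type) (D : pred I)
    (phi : I -> Y -> F) (pt : I -> Y) (rk : I -> nat) (c : I -> F) :
  (forall i, D i -> phi i (pt i) != 0) ->
  (forall i j, D i -> D j -> phi j (pt i) != 0 -> j = i \/ (rk i < rk j)%N) ->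
  (forall y, \sum_(i | D i) c i * phi i y = 0) -> forall i, D i -> c i = 0.
Proof.
move=> phi0 phirk sum0 i0 Di0; apply/eqP/negP => /negP ci0.
have P0 : D i0 && (c i0 != 0) by rewrite Di0.
case: (@arg_maxnP _ i0 (fun i => D i && (c i != 0)) rk P0) => i /andP[Di ci] imax.
have /eqP := sum0 (pt i); rewrite (bigD1 i) //= big1 ?addr0.
  by rewrite mulf_eq0 (negPf ci) (negPf (phi0 i Di)).
move=> j /andP[Dj ji]; apply/eqP; rewrite mulf_eq0.
case: eqP => //= /eqP cj; apply/negP => /negP /(phirk i j Di Dj)[|rkij].
  by move/eqP: ji.
by have := imax j; rewrite Dj cj => /(_ isT); rewrite /geq /= leqNgt rkij.
Qed.

(** * Diagrams as operators on words over a finite alphabet *)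

Section Matrices.
Variables (F : fieldType) (r : nat) (Om : finType).
Local Notation vertex := ('I_r + 'I_r)%type.
Implicit Types (f g h : {ffun 'I_r -> Om}) (p q : diagram r).

Definition vjoin f g (v : vertex) : Om := match v with inl i => f i | inr i => g i end.

Definition rho (P : {set {set vertex}}) f g : bool := compat P (vjoin f g).

(* Entry (f, g) of the operator of [x] on the r-th tensor power of the space with
   basis [Om]; this representation is faithful when 2r <= #|Om|. *)
Definition rhoM f g (x : partalg r F) : F^o := \sum_p x p * (rho (val p) f g)%:R.

Lemma rhoM_is_linear f g : linear (rhoM f g).
Proof.
move=> c x y; rewrite /rhoM scaler_sumr -big_split; apply: eq_bigr => p _.
by rewrite !ffunE mulrDl -mulrA.
Qed.

HB.instance Definition _ f g := GRing.isLinear.Build F (partalg r F) F^o _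
  (rhoM f g) (rhoM_is_linear f g).

Lemma rhoM_diag (P : {set {set vertex}}) f g : partition P [set: vertex] ->
  rhoM f g (diag_elt F P) = (rho P f g)%:R.
Proof.
move=> PP; rewrite /rhoM (bigD1 (exist _ P PP)) //= ffunE eqxx mul1r big1 ?addr0 //.
move=> q /negPf qP; rewrite ffunE -[P]/(val (exist (fun P => is_true (partition P _)) P PP)).
by rewrite val_eqE qP mul0r.
Qed.

Lemma stack_blocks_partition p q : partition (stack_blocks p q) [set: vertex].
Proof. exact: preim_components_partition. Qed.

(** The words on the middle row that fit between [f] and [h] are the extensions of the outer word to
    the whole stack, so the components staying in the middle account for the power of the alphabet
    size. *)
Lemma card_stack (w0 : Om) p q f h :
  #|[set g | rho (val p) f g && rho (val q) g h]| =
  (rho (stack_blocks p q) f h * #|Om| ^ stack_inner p q)%N.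
Proof.
pose E := [set @upper r @: B | B : {set vertex} in val p]
      :|: [set @lower r @: B | B : {set vertex} in val q].
pose phi := [ffun v => vjoin f h v].
pose j3 g : {ffun 'I_r + 'I_r + 'I_r -> Om} := [ffun v => match v with
  | inl (inl i) => f i | inl (inr i) => g i | inr i => h i end].
transitivity #|[set G : {ffun _ -> Om} | compat E G &&
    [forall y, G (@outer r y) == phi y]]|.
  rewrite -(@card_imset _ _ j3); last first.
    move=> g g' /ffunP gg; apply/ffunP => i.
    by have := gg (inl (inr i)); rewrite !ffunE.
  have cE g : compat E (j3 g) = rho (val p) f g && rho (val q) g h.
    by rewrite compatU !compat_imset; congr (_ && _);
      apply: compat_eq => -[i|i]; rewrite /= ffunE.
  apply: eq_card => G; rewrite inE; apply/imsetP/andP => [[g]|[GE /forallP Go]].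
    rewrite inE -cE => gg ->; split=> //; apply/forallP => -[i|i];
    by rewrite !ffunE.
  have eG : G = j3 [ffun i => G (inl (inr i))].
    apply/ffunP => -[[i|i]|i]; rewrite !ffunE //.
      by have /eqP := Go (inl i); rewrite ffunE.
    by have /eqP := Go (inr i); rewrite ffunE.
  by exists [ffun i => G (inl (inr i))]; rewrite // inE -cE -eG.
rewrite (card_extensions _ _ _ w0); case: ifP => [|/negP] H.
  suff -> : rho (stack_blocks p q) f h by rewrite mul1n.
  apply/forall_inP => _ /setD1P[_ /imsetP[C /componentsP[x ->] ->]].
  apply/forall_inP => u; rewrite !inE => xu; apply/forall_inP => v; rewrite !inE => xv.
  have /forallP/(_ u)/forallP/(_ v)/implyP := H; rewrite !ffunE; apply.
  by apply: hconn_trans xv; rewrite hconn_sym.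
case: (boolP (rho _ f h)); rewrite ?mul0n // => /forall_inP R; case: H.
apply/forallP => u; apply/forallP => v; apply/implyP => uv; rewrite !ffunE.
have uC : u \in @outer r @^-1: [set y | hconn E (outer u) y].
  by rewrite !inE hconn_refl.
have CS : @outer r @^-1: [set y | hconn E (outer u) y] \in stack_blocks p q.
  by rewrite !inE imset_f ?mem_components // andbT; apply/set0Pn; exists u.
by have /forall_inP/(_ u uC)/forall_inP := R _ CS; apply; rewrite !inE.
Qed.

Lemma rhoM_mul (n : nat) (w0 : Om) x y f h : #|Om| = n ->
  rhoM f h (partalg_mul n x y) = \sum_g rhoM f g x * rhoM g h y.
Proof.
move=> Omn; rewrite /partalg_mul linear_sum /=.
transitivity (\sum_p \sum_q x p * y q *
   #|[set g | rho (val p) f g && rho (val q) g h]|%:R).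
  apply: eq_bigr => p _; rewrite linear_sum /=; apply: eq_bigr => q _.
  rewrite linearZ /= rhoM_diag ?stack_blocks_partition // (card_stack w0) Omn.
  rewrite natrM natrX [_%:R * _]mulrC mulrA; exact: erefl.
rewrite exchange_big /= [RHS](eq_bigr (fun g => \sum_p \sum_q
  x q * (rho (val q) f g)%:R * (y p * (rho (val p) g h)%:R))); last first.
  move=> g _; rewrite mulrC /rhoM big_distrl /=; apply: eq_bigr => q _.
  by rewrite big_distrr /=; apply: eq_bigr => p _; rewrite mulrC.
rewrite [RHS]exchange_big /=; apply: eq_bigr => q _.
rewrite exchange_big /=; apply: eq_bigr => p _.
rewrite cardsE -sum1_card natr_sum mulr_sumr big_mkcond /=.
apply: eq_bigr => g _ /=; rewrite unfold_in mulrACA -natrM mulnb.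
by case: ifP => //; rewrite mulr0.
Qed.

Hypothesis card_Om : (2 * r <= #|Om|)%N.

(** Put distinct letters on distinct blocks of [p]: a diagram compatible with this word refines [p].
    There are 2r vertices, whence the bound on the alphabet. *)
Lemma rho_generic p : exists f g, rho (val p) f g /\ forall q,
  rho (val q) f g -> q = p \/ (#|val p| < #|val q|)%N.
Proof.
have le : (#|{: vertex}| <= #|Om|)%N by rewrite card_sum card_ord addnn -mul2n.
pose inj (v : vertex) : Om := enum_val (widen_ord le (enum_rank v)).
have injI : injective inj.
  by move=> u v /enum_val_inj/(congr1 val)/= /val_inj/enum_rank_inj.
(* The letter of a vertex is that of a representative of its block; the choice made by [pick]
   depends on the block only. *)
pose b v := inj (odflt v [pick x in pblock (val p) v]).
have pP := valP p; have [/eqP cp tp _] := and3P pP.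
have mem z : z \in pblock (val p) z by rewrite mem_pblock cp.
have bb v : exists2 x, b v = inj x & x \in pblock (val p) v.
  by rewrite /b; case: pickP => [x|/(_ v)]; [exists x | rewrite mem].
have bE u v : (b u = b v) <-> hconn (val p) u v.
  rewrite hconn_partition // -eq_pblock ?cp //; split=> [|/eqP uv].
    have [[x -> xu] [y -> yv]] := (bb u, bb v) => /injI xy.
    by rewrite xy in xu; rewrite -(same_pblock tp xu) -(same_pblock tp yv).
  by rewrite /b -uv; case: pickP => // /(_ u); rewrite mem.
have vE v : vjoin [ffun i => b (inl i)] [ffun i => b (inr i)] v = b v.
  by case: v => i; rewrite /= ffunE.
exists [ffun i => b (inl i)], [ffun i => b (inr i)]; split.
  by apply/compatP => u v /bE; rewrite !vE.
move=> q /compatP qb; have [|/val_inj|] := partition_refine pP (valP q).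
- by move=> u v /qb; rewrite !vE => /bE.
- by left.
by right.
Qed.

Lemma rhoM_inj x : (forall f g, rhoM f g x = 0) -> x = 0.
Proof.
move=> x0; have wit p : {fg | rho (val p) fg.1 fg.2 /\ forall q,
    rho (val q) fg.1 fg.2 -> q = p \/ (#|val p| < #|val q|)%N}.
  (* The generic word is needed as a function of the diagram; a boolean form of its property lets
     [xchoose] select it. *)
  have H : exists fg : {ffun 'I_r -> Om} * {ffun 'I_r -> Om},
      rho (val p) fg.1 fg.2 && [forall q : diagram r, rho (val q) fg.1 fg.2 ==>
         ((q == p) || (#|val p| < #|val q|)%N)].
    have [f [g [fg H]]] := rho_generic p; exists (f, g); rewrite fg /=.
    by apply/forallP => q; apply/implyP => /H[->|->]; rewrite ?eqxx ?orbT.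
  exists (xchoose H); have /andP[-> /forallP Hq] := xchooseP H; split=> // q.
  by move=> /(implyP (Hq q))/orP[/eqP|]; [left|right].
apply/ffunP => p; rewrite ffunE.
apply: (@triangular_free F _ _ predT (fun p fg => (rho (val p) fg.1 fg.2)%:R)
   (fun p => sval (wit p)) (fun p => #|val p|) x) => //.
- by move=> q _; have [-> _] := svalP (wit q); rewrite oner_neq0.
- move=> q q' _ _; have [_ H] := svalP (wit q).
  by case: (boolP (rho _ _ _)) => [/H //|]; rewrite eqxx.
by move=> fg; exact: (x0 fg.1 fg.2).
Qed.

End Matrices.

(** * Associativity of the partition algebra and the Young idempotents *)

Section PartitionAlgebraTheory.
Variables (F : fieldType) (r n : nat).
Hypotheses (r_gt0 : (0 < r)%N) (le2rn : (2 * r <= n)%N).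
Local Notation partalg := (partalg r F).
Local Notation "x ** y" := (partalg_mul n x y) (at level 40, left associativity).
Implicit Types (x y z : partalg) (f g h : {ffun 'I_r -> 'I_n}).

Lemma partalg_ext x y :
  (forall f g, rhoM f g x = rhoM f g y) -> x = y.
Proof.
move=> xy; apply/eqP; rewrite -subr_eq0; apply/eqP.
apply: (@rhoM_inj F r 'I_n) => [|f g]; first by rewrite card_ord.
by rewrite linearB /= xy subrr.
Qed.

Lemma rhoM_ord_mul x y f h :
  rhoM f h (x ** y) = \sum_g rhoM f g x * rhoM g h y.
Proof.
have n0 : (0 < n)%N by apply: leq_trans le2rn; rewrite muln_gt0.
by apply: rhoM_mul; [exact: Ordinal n0 | rewrite card_ord].
Qed.

Lemma pmulA x y z : x ** (y ** z) = x ** y ** z.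
Proof.
apply: partalg_ext => f h; rewrite !rhoM_ord_mul.
under eq_bigr => g _ do rewrite rhoM_ord_mul mulr_sumr.
rewrite exchange_big /=; apply: eq_bigr => g _; rewrite rhoM_ord_mul mulr_suml.
by apply: eq_bigr => g' _; rewrite mulrA.
Qed.

Lemma pmulDl c x y z : (c *: x + y) ** z = c *: (x ** z) + y ** z.
Proof.
apply: partalg_ext => f h; rewrite linearP /= !rhoM_ord_mul.
rewrite scaler_sumr -big_split; apply: eq_bigr => g _ /=.
by rewrite linearP /= mulrDl -scalerAl.
Qed.

Lemma pmulDr c x y z : z ** (c *: x + y) = c *: (z ** x) + z ** y.
Proof.
apply: partalg_ext => f h; rewrite linearP /= !rhoM_ord_mul.
rewrite scaler_sumr -big_split; apply: eq_bigr => g _ /=.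
by rewrite linearP /= mulrDr -scalerAr.
Qed.

Lemma pmul0l x : 0 ** x = 0.
Proof. by have := pmulDl (-1) x x x; rewrite !scaleN1r !addNr. Qed.

Lemma pmul0r x : x ** 0 = 0.
Proof. by have := pmulDr (-1) x x x; rewrite !scaleN1r !addNr. Qed.

Lemma pmulZl c x y : (c *: x) ** y = c *: (x ** y).
Proof. by have := pmulDl c x 0 y; rewrite pmul0l !addr0. Qed.

Lemma pmulZr c x y : x ** (c *: y) = c *: (x ** y).
Proof. by have := pmulDr c y 0 x; rewrite pmul0r !addr0. Qed.

Lemma pmul_suml (I : Type) (s : seq I) (P : pred I) (G : I -> partalg) y :
  (\sum_(i <- s | P i) G i) ** y = \sum_(i <- s | P i) G i ** y.
Proof.
apply: (big_morph (fun x => x ** y)) => [u v|]; last exact: pmul0l.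
by have := pmulDl 1 u v y; rewrite !scale1r.
Qed.

Lemma pmul_sumr (I : Type) (s : seq I) (P : pred I) (G : I -> partalg) y :
  y ** (\sum_(i <- s | P i) G i) = \sum_(i <- s | P i) y ** G i.
Proof.
apply: (big_morph (fun x => y ** x)) => [u v|]; last exact: pmul0r.
by have := pmulDr 1 u v y; rewrite !scale1r.
Qed.

Lemma diag_decomposition x : x = \sum_p x p *: diag_elt F (val p).
Proof.
apply/ffunP => q; rewrite sum_ffunE (bigD1 q) //= big1 => [|p /negPf pq].
  by rewrite !ffunE eqxx addr0 -[RHS]/(_ * _) mulr1.
by rewrite !ffunE val_eqE eq_sym pq scaler0.
Qed.

Definition perm_diag (s : 'S_r) : {set {set 'I_r + 'I_r}} :=
  [set [set inl (s i); inr i] | i : 'I_r].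

Lemma perm_diag_partition s : partition (perm_diag s) [set: 'I_r + 'I_r].
Proof.
apply/and3P; split.
- apply/eqP/setP => -[i|i]; rewrite inE; apply/bigcupP.
    exists [set inl (s (s^-1 i)%g); inr (s^-1 i)%g]; first exact: imset_f.
    by rewrite permKV !inE eqxx.
  by exists [set inl (s i); inr i]; [exact: imset_f | rewrite !inE eqxx orbT].
- apply/trivIsetP => _ _ /imsetP[i _ ->] /imsetP[j _ ->] ij.
  have {}ij : i != j by apply: contraNneq ij => ->.
  apply/pred0P => -[t|t]; rewrite /= !inE /eq_op /= ?orbF; apply/negP => /andP[/eqP-> /eqP].
    by move/perm_inj/eqP; rewrite (negPf ij).
  by move/eqP; rewrite (negPf ij).
by apply/negP => /imsetP[i _ /setP/(_ (inr i))]; rewrite !inE eqxx orbT.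
Qed.

Lemma rho_perm (Om : finType) s (f g : {ffun 'I_r -> Om}) :
  rho (perm_diag s) f g = [forall i, f (s i) == g i].
Proof.
apply/forall_inP/forallP => [H i|H _ /imsetP[i _ ->]].
  have /forall_inP/(_ (inl (s i))) := H _ (imset_f _ (isT : i \in 'I_r)).
  by rewrite !inE eqxx => /(_ isT)/forall_inP/(_ (inr i)); rewrite !inE eqxx orbT; apply.
apply/forall_inP => u; rewrite !inE => /orP[]/eqP->; apply/forall_inP => v;
  rewrite !inE => /orP[]/eqP->; by rewrite //= ?(eqP (H i)) // eq_sym.
Qed.

Lemma rhoM_perm (Om : finType) s (f g : {ffun 'I_r -> Om}) :
  rhoM f g (perm_elt F s) = (g == [ffun i => f (s i)])%:R.
Proof.
rewrite rhoM_diag ?perm_diag_partition // rho_perm; congr (_%:R : F); congr nat_of_bool.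
apply/forallP/eqP => [H|-> i]; last by rewrite ffunE.
by apply/ffunP => i; rewrite ffunE (eqP (H i)).
Qed.

Lemma rhoM_perm_mul s x f h : rhoM f h (perm_elt F s ** x) = rhoM [ffun i => f (s i)] h x.
Proof.
rewrite rhoM_ord_mul (bigD1 [ffun i => f (s i)]) //= rhoM_perm eqxx mul1r big1 ?addr0 //.
by move=> g /negPf gs; rewrite rhoM_perm gs mul0r.
Qed.

(** Left multiplication by [perm_elt F s] precomposes words with [s], and [(t * s)%g] applies [t]
    first; hence the reversed order. *)
Lemma perm_eltM s t : perm_elt F s ** perm_elt F t = @perm_elt r F (t * s).
Proof.
apply: partalg_ext => f h; rewrite rhoM_perm_mul !rhoM_perm.
by congr (_ == _)%:R; apply/ffunP => i; rewrite !ffunE permM.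
Qed.

Lemma perm_elt1_mul x : @perm_elt r F 1%g ** x = x.
Proof.
apply: partalg_ext => f h; rewrite rhoM_perm_mul; congr (rhoM _ h x).
by apply/ffunP => i; rewrite ffunE perm1.
Qed.

Lemma perm_elt1_mulr x : x ** @perm_elt r F 1%g = x.
Proof.
apply: partalg_ext => f h; rewrite rhoM_ord_mul (bigD1 h) //= rhoM_perm.
rewrite (_ : [ffun i => _] = h); last by apply/ffunP => i; rewrite ffunE perm1.
rewrite eqxx mulr1 big1 ?addr0 // => g gh; rewrite rhoM_perm.
rewrite (_ : [ffun i => _] = g); last by apply/ffunP => i; rewrite ffunE perm1.
by rewrite eq_sym (negPf gh) mulr0.
Qed.

Variable k : nat.
Implicit Types (a : weight r k).

Lemma young_group_set a : group_set (young_subgroup a).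
Proof.
apply/group_setP; split.
  by rewrite inE; apply/forallP => i; apply/forallP => j; rewrite perm1; apply/implyP.
move=> s t; rewrite !inE => /forallP sa /forallP ta.
apply/forallP => i; apply/forallP => j; apply/implyP => ij; rewrite permM.
have /forallP/(_ j)/implyP := ta (s i); apply.
by have /forallP/(_ j)/implyP := sa i; apply.
Qed.

Definition young_group a : {group 'S_r} := Group (young_group_set a).

Lemma young_idem_perm a s : s \in young_subgroup a ->
  young_idem F a ** perm_elt F s = young_idem F a.
Proof.
move=> sa; rewrite /young_idem pmulZl; congr (_ *: _); rewrite pmul_suml.
rewrite [RHS](reindex_inj (mulgI s)) /=; apply: eq_big => [t|t _].
  by rewrite (@groupMl _ (young_group a)).
by rewrite perm_eltM.
Qed.

Lemma young_card_gt0 a : (0 < #|young_subgroup a|)%N.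
Proof. exact: (cardG_gt0 (young_group a)). Qed.

Hypothesis char0 : forall m : nat, m.+1%:R != 0 :> F.

Lemma young_card_neq0 a : #|young_subgroup a|%:R != 0 :> F.
Proof. by have := young_card_gt0 a; case: #|_| => // m _. Qed.

Lemma young_idemK a : young_idem F a ** young_idem F a = young_idem F a.
Proof.
rewrite {2}/young_idem pmulZr pmul_sumr (eq_bigr (fun=> young_idem F a)).
  by rewrite sumr_const -scaler_nat scalerA mulVf ?scale1r // young_card_neq0.
by move=> s sa; rewrite young_idem_perm.
Qed.

End PartitionAlgebraTheory.

(** * Tableaux as labellings and the action of diagrams *)

Section Fillings.
Variables (l : seq nat) (r : nat).
Implicit Types (b c : box l) (beta gamma : {ffun 'I_r -> box l}).

Definition up b : bool := (0 < box_row b)%N.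

Lemma box_eq b b' : box_row b = box_row b' -> box_col b = box_col b' -> b = b'.
Proof.
case: b b' => i j [i' j'] /=; rewrite /box_row /box_col /= => ii jj.
by case: i' / ii j' jj => j' /val_inj->.
Qed.

(** Boxes of the first row may be missed: these are the empty boxes of the tableau. *)
Definition onto beta : bool := [forall b, up b ==> [exists x, beta x == b]].

Lemma ontoP beta : reflect (forall b, up b -> exists x, beta x = b) (onto beta).
Proof.
apply: (iffP forall_inP) => H b /H; first by case/existsP => x /eqP; exists x.
by case=> x <-; apply/existsP; exists x.
Qed.

(** Tableaux are handled through the function giving the box of each vertex. Disjointness and
    exhaustiveness of the blocks are then automatic, and by [SPT_fib] no tableau is lost. *)
Definition fib beta : set_filling l r := [ffun b => [set x | beta x == b]].

Lemma fibE beta b x : (x \in fib beta b) = (beta x == b).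
Proof. by rewrite ffunE inE. Qed.

Lemma fib_SPT beta : onto beta -> fib beta \in SPT l r.
Proof.
move=> /ontoP ob; rewrite inE; apply/and3P; split.
- apply/and3P; split; last by rewrite !inE eqxx.
    apply/eqP/setP => x; rewrite inE; apply/bigcupP; exists (fib beta (beta x)).
      by rewrite !inE imset_f // andbT; apply/set0Pn; exists x; rewrite fibE.
    by rewrite fibE.
  apply/trivIsetP => _ _ /setD1P[_ /imsetP[b _ ->]] /setD1P[_ /imsetP[c _ ->]] bc.
  apply/pred0P => x /=; rewrite !fibE; apply/negP => /andP[/eqP xb /eqP xc].
  by rewrite -xb -xc eqxx in bc.
- apply/forallP => b; apply/forallP => c; apply/implyP => /andP[/eqP bc /set0Pn[x xb]].
  move: (xb); rewrite bc => xc; move: xb xc; rewrite !fibE => /eqP <- /eqP <-; exact: eqxx.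
apply/forall_inP => b /ob[x xb]; apply/set0Pn; exists x; by rewrite fibE xb.
Qed.

Lemma SPT_fib T : T \in SPT l r -> exists2 beta, onto beta & T = fib beta.
Proof.
rewrite inE => /and3P[/and3P[/eqP cT /trivIsetP tT _] /forallP injT /forallP upT].
have bx x : exists b, x \in T b.
  have : x \in [set: 'I_r] by [].
  by rewrite -cT => /bigcupP[_ /setD1P[_ /imsetP[b _ ->]]]; exists b.
have injx x b c : x \in T b -> x \in T c -> b = c.
  move=> xb xc; have nb : T b != set0 by apply/set0Pn; exists x.
  have nc : T c != set0 by apply/set0Pn; exists x.
  have Tbc : T b = T c.
    apply/eqP; apply: contraT => bc.
    have := tT (T b) (T c); rewrite !inE nb nc !imset_f // => /(_ isT isT bc).
    by move/pred0P/(_ x); rewrite /= xb xc.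
  by have /forallP/(_ c) := injT b; rewrite Tbc eqxx nc => /eqP.
pose beta := [ffun x => xchoose (bx x)].
have TE : T = fib beta.
  apply/ffunP => b; apply/setP => x; rewrite fibE ffunE.
  by apply/idP/eqP => [xb|<-]; [exact: injx (xchooseP (bx x)) xb | exact: (xchooseP (bx x))].
exists beta => //; apply/ontoP => b ub.
have /implyP/(_ ub)/set0Pn[x] := upT b; rewrite TE fibE => /eqP; by exists x.
Qed.

Lemma fib_perm beta (s : {perm box l}) :
  [ffun b => fib beta (s b)] = fib [ffun x => (s^-1)%g (beta x)].
Proof.
apply/ffunP => b; apply/setP => x; rewrite ffunE !fibE ffunE.
by rewrite (can2_eq (permKV s) (permK s)).
Qed.

Definition tab beta := tabloid_of (fib beta).

Lemma mem_blocks beta B :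
  reflect (exists x, B = fib beta (beta x)) (B \in blocks (tab beta)).
Proof.
rewrite blocks_tabloid; apply: (iffP setD1P) => [[/set0Pn[x xB] /imsetP[b _ eB]]|[x ->]].
  by exists x; move: xB; rewrite eB fibE => /eqP->.
by rewrite imset_f //; split=> //; apply/set0Pn; exists x; rewrite fibE.
Qed.

Lemma mem_upper_blocks beta B :
  reflect (exists2 x, up (beta x) & B = fib beta (beta x))
          (B \in upper_blocks (tab beta)).
Proof.
rewrite upper_blocks_tabloid; apply: (iffP setD1P) => [[/set0Pn[x xB] /imsetP[b ub eB]]|[x ux ->]].
  by exists x; move: xB ub; rewrite eB fibE inE => /eqP->.
by rewrite imset_f ?inE //; split=> //; apply/set0Pn; exists x; rewrite fibE.
Qed.

Definition aconn (p : diagram r) beta : rel ('I_r + 'I_r) :=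
  hconn (val p :|: [set inr @: B | B : {set 'I_r} in blocks (tab beta)]).

Variable p : diagram r.

Lemma acompatP (Om : eqType) beta (h : 'I_r + 'I_r -> Om) :
  reflect (compat (val p) h /\ forall x y, beta x = beta y -> h (inr x) = h (inr y))
   (compat (val p :|: [set inr @: B | B : {set 'I_r} in blocks (tab beta)]) h).
Proof.
rewrite compatU compat_imset; apply: (iffP andP) => -[-> H]; split=> //.
  move=> x y xy.
  have /forall_inP/(_ (fib beta (beta x))) := H.
  case/(_ _)/wrap; first by apply/mem_blocks; exists x.
  by move/forall_inP/(_ x); rewrite fibE => /(_ (eqxx _))/forall_inP/(_ y);
    rewrite fibE xy eqxx => /(_ isT)/eqP.
apply/forall_inP => _ /mem_blocks[z ->]; apply/forall_inP => x; rewrite fibE => /eqP xz.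
by apply/forall_inP => y; rewrite fibE => /eqP yz; apply/eqP/H; rewrite xz yz.
Qed.
End Fillings.

(** * The action of a diagram in terms of labellings of the vertices *)

Section DiagramActionOnFillings.
Variables (l : seq nat) (r : nat) (p : diagram r).
Implicit Types (b c : box l) (beta gamma : {ffun 'I_r -> box l}).

Lemma aconn_refl beta u : aconn p beta u u. Proof. exact: hconn_refl. Qed.
Lemma aconn_sym beta u v : aconn p beta u v = aconn p beta v u.
Proof. exact: hconn_sym. Qed.
Lemma aconn_trans beta : transitive (aconn p beta). Proof. exact: hconn_trans. Qed.

Lemma aconn_eqr beta u v w : aconn p beta u v -> aconn p beta w u = aconn p beta w v.
Proof.
move=> uv; apply/idP/idP => wu; first exact: aconn_trans wu uv.
by apply: aconn_trans wu _; rewrite aconn_sym.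
Qed.

Lemma aconn_fib beta x y : beta x = beta y -> aconn p beta (inr x) (inr y).
Proof.
move=> xy; apply: (@hconn_edge _ _ [set inr z | z in fib beta (beta x)]).
- by rewrite inE imset_f ?orbT //; apply/mem_blocks; exists x.
- by rewrite imset_f ?fibE.
by rewrite imset_f ?fibE ?xy.
Qed.

Lemma contains_blockE beta v y :
  contains_block [set w | aconn p beta v w] (fib beta (beta y)) = aconn p beta v (inr y).
Proof.
apply/subsetP/idP => [/(_ (inr y))|vy _ /imsetP[x + ->]].
  by rewrite imset_f ?fibE // inE => /(_ isT).
by rewrite fibE => /eqP xy; rewrite inE (aconn_eqr _ (aconn_fib xy)).
Qed.

Lemma image_blockE beta y :
  image_block p (tab beta) (fib beta (beta y)) = [set x | aconn p beta (inl x) (inr y)].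
Proof.
apply/setP => x; rewrite inE; apply/bigcupP/idP => [[_ /andP[/componentsP[v ->]]]|xy].
  rewrite contains_blockE => vy; rewrite !inE => vx.
  by apply: aconn_trans vy; rewrite aconn_sym.
exists [set w | aconn p beta (inr y) w].
  by rewrite contains_blockE aconn_refl andbT; exact: mem_components.
by rewrite !inE aconn_sym.
Qed.

Lemma act_nonzeroP beta :
  reflect ((forall y, up (beta y) -> exists x, aconn p beta (inl x) (inr y)) /\
    forall y z, up (beta y) -> up (beta z) -> aconn p beta (inr y) (inr z) ->
      beta y = beta z)
  (act_nonzero p (tab beta)).
Proof.
have fib_inj y z : fib beta (beta y) = fib beta (beta z) -> beta y = beta z.
  by move/setP/(_ y); rewrite !fibE eqxx => /esym/eqP.
apply: (iffP andP) => -[H1 H2]; split.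
- move=> y uy; have /forall_inP/(_ (fib beta (beta y))) := H1.
  by case/(_ _)/wrap; [apply/mem_upper_blocks; exists y | rewrite image_blockE
    => /set0Pn[x]; rewrite inE; exists x].
- move=> y z uy uz yz; apply: fib_inj.
  have /forall_inP/(_ [set w | aconn p beta (inr y) w]) := H2.
  case/(_ _)/wrap; first exact: mem_components.
  move=> /forall_inP/(_ (fib beta (beta y))).
  case/(_ _)/wrap; first by apply/mem_upper_blocks; exists y.
  move=> /forall_inP/(_ (fib beta (beta z))).
  case/(_ _)/wrap; first by apply/mem_upper_blocks; exists z.
  by rewrite !contains_blockE aconn_refl yz => /eqP.
- apply/forall_inP => _ /mem_upper_blocks[y uy ->]; rewrite image_blockE.
  by have [x xy] := H1 y uy; apply/set0Pn; exists x; rewrite inE.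
apply/forall_inP => _ /componentsP[v ->]; apply/forall_inP => _ /mem_upper_blocks[y uy ->].
apply/forall_inP => _ /mem_upper_blocks[z uz ->]; rewrite !contains_blockE.
apply/implyP => /andP[vy vz]; apply/eqP; congr (fib _ _); apply: H2 => //.
by apply: aconn_trans vz; rewrite aconn_sym.
Qed.

(** The result of the action without a choice of positions in the first row: there only the kernel
    of [beta'] is constrained, which is all that a tabloid records. *)
Definition act_spec beta beta' : Prop :=
  (forall x y, beta' x = beta' y <-> aconn p beta (inl x) (inl y)) /\
  (forall x y, up (beta y) -> beta' x = beta y <-> aconn p beta (inl x) (inr y)).

Lemma act_spec_nonzero beta beta' :
  onto beta' -> act_spec beta beta' -> act_nonzero p (tab beta).
Proof.
move=> /ontoP ob' [sA sB]; apply/act_nonzeroP; split=> [y uy|y z uy uz yz].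
  by have [x xy] := ob' _ uy; exists x; apply/sB.
have [x xy] := ob' _ uy; rewrite -xy; apply/sB => //.
by rewrite -(aconn_eqr _ yz); apply/sB.
Qed.

Lemma act_spec_image beta beta' : onto beta -> act_spec beta beta' ->
  forall b, up b -> fib beta' b = image_block p (tab beta) (fib beta b).
Proof.
move=> /ontoP ob [sA sB] b ub; have [y yb] := ob b ub.
rewrite -yb image_blockE; apply/setP => x; rewrite fibE inE.
by apply/eqP/idP => /sB; rewrite ?yb //; apply.
Qed.

Lemma act_spec_first beta beta' : onto beta -> act_spec beta beta' ->
  [set fib beta' b | b : box l & box_row b == 0%N :> nat] :\ set0
    = image_first_row p (tab beta).
Proof.
move=> /ontoP ob [sA sB].
have fibcls x : fib beta' (beta' x) = top_part [set w | aconn p beta (inl x) w].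
  apply/setP => y; rewrite fibE !inE aconn_sym.
  by apply/eqP/idP => /sA.
have rowcls x : (box_row (beta' x) == 0%N :> nat) =
   [forall B in upper_blocks (tab beta), ~~ contains_block [set w | aconn p beta (inl x) w] B].
  rewrite eqn0Ngt; apply/negP/forall_inP => [ux _ /mem_upper_blocks[y uy ->]|H ux].
    by rewrite contains_blockE; apply/negP => /sB xy; apply: ux; rewrite xy.
  have [y yx] := ob _ ux; have uy : up (beta y) by rewrite yx.
  have := H (fib beta (beta y)); case/(_ _)/wrap; first by apply/mem_upper_blocks; exists y.
  by rewrite contains_blockE => /negP; apply; apply/sB.
apply/setP => B; apply/setD1P/setD1P => -[B0 BI]; split=> //.
  case/imsetP: BI B0 => b; rewrite inE => b0 -> /set0Pn[x]; rewrite fibE => /eqP xb.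
  apply/imsetP; exists [set w | aconn p beta (inl x) w]; last by rewrite -xb fibcls.
  by rewrite inE mem_components -rowcls xb b0.
case/imsetP: BI B0 => C; rewrite inE => /andP[/componentsP[v ->]] + -> /set0Pn[x].
rewrite !inE => + vx.
have -> : [set w | aconn p beta v w] = [set w | aconn p beta (inl x) w].
  by apply/setP => w; rewrite !inE ![aconn p beta _ w]aconn_sym (aconn_eqr _ vx).
by rewrite -rowcls => b0; apply/imsetP; exists (beta' x); rewrite ?inE ?fibcls.
Qed.

Lemma act_specE (F : fieldType) n beta beta' :
  onto beta -> onto beta' -> act_spec beta beta' ->
  partalg_act n (diag_elt F (val p)) (polytabloid F (fib beta))
    = n%:R ^+ act_exponent p (tab beta) *: polytabloid F (fib beta').
Proof.
move=> ob ob' s; apply: diagram_act_polytabloid; try exact: fib_SPT.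
- exact: act_spec_nonzero s.
- exact: act_spec_image.
exact: act_spec_first.
Qed.

Lemma act_eq0 (F : fieldType) n beta : ~~ act_nonzero p (tab beta) ->
  partalg_act n (diag_elt F (val p)) (polytabloid F (fib beta)) = 0.
Proof. exact: diagram_act_polytabloid_eq0. Qed.

(** Components that meet the top but no block above the first row need separate boxes in the first
    row. There are at most r of them and at least r boxes, so each takes the box numbered by a
    representative vertex. *)
Lemma act_spec_exists beta : (0 < size l)%N -> (r <= nth 0 l 0)%N -> onto beta ->
  act_nonzero p (tab beta) -> exists2 beta', onto beta' & act_spec beta beta'.
Proof.
move=> l0 rl /ontoP ob /act_nonzeroP[nz1 nz2].
pose lab x : 'I_(nth 0 l (Ordinal l0)) :=
  widen_ord rl (odflt x [pick y | aconn p beta (inl x) (inl y)]).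
pose beta' : {ffun 'I_r -> box l} := [ffun x : 'I_r =>
  if [pick y | up (beta y) && aconn p beta (inl x) (inr y)] is Some y then beta y
  else @Tagged _ (Ordinal l0) (fun i : 'I_(size l) => 'I_(nth 0 l i)) (lab x)].
have b'P x : (exists y, [/\ up (beta y), aconn p beta (inl x) (inr y) & beta' x = beta y])
   \/ (forall y, up (beta y) -> ~~ aconn p beta (inl x) (inr y)) /\
      beta' x = @Tagged _ (Ordinal l0) (fun i : 'I_(size l) => 'I_(nth 0 l i)) (lab x).
  rewrite /beta' ffunE; case: pickP => [y /andP[uy xy]|xN]; [left|right].
    by exists y.
  by split=> // y uy; have := xN y; rewrite uy /= => ->.
have sB x y : up (beta y) -> beta' x = beta y <-> aconn p beta (inl x) (inr y).
  move=> uy; have [[z [uz xz ->]]|[xN ->]] := b'P x; split.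
  - by move=> zy; rewrite -(aconn_eqr _ (aconn_fib zy)).
  - by move=> xy; apply: nz2 => //; apply: aconn_trans xy; rewrite aconn_sym.
  - by move=> E; move: uy; rewrite -E.
  by rewrite (negPf (xN _ uy)).
have labE x y : lab x = lab y <-> aconn p beta (inl x) (inl y).
  have lp z : exists2 t, lab z = widen_ord rl t & aconn p beta (inl z) (inl t).
    by rewrite /lab; case: pickP => [t|/(_ z)]; [exists t | rewrite aconn_refl].
  split=> [|xy].
    have [[t -> xt] [s -> ys]] := (lp x, lp y) => /(congr1 val)/= /val_inj ts.
    by rewrite (aconn_eqr _ ys) -ts.
  congr (widen_ord rl _); have E : [pick t | aconn p beta (inl x) (inl t)] =
     [pick t | aconn p beta (inl y) (inl t)].
    by apply: eq_pick => t; rewrite ![aconn p beta _ (inl t)]aconn_sym (aconn_eqr _ xy).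
  by rewrite E; case: pickP => // /(_ y); rewrite aconn_refl.
exists beta'; last split=> [x y|]; last exact: sB.
  apply/ontoP => b ub; have [y yb] := ob b ub; rewrite -yb in ub *.
  by have [x xy] := nz1 y ub; exists x; apply/sB.
split=> [bxy|xy].
  have [[z [uz xz xzE]]|[xN xE]] := b'P x.
    rewrite (aconn_eqr _ (_ : aconn p beta (inl y) (inr z))) //.
    by apply/sB; rewrite // -xzE.
  have [[z [uz yz yzE]]|[yN yE]] := b'P y.
    by have := xN z uz => /negP; case; apply/sB; rewrite // bxy.
  by apply/labE; move: bxy; rewrite xE yE => /eqP; rewrite eq_Tagged => /eqP.
have [[z [uz xz xzE]]|[xN xE]] := b'P x.
  by rewrite xzE; apply/esym/sB => //; rewrite aconn_sym -(aconn_eqr _ xy) aconn_sym.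
have [[z [uz yz yzE]]|[yN yE]] := b'P y.
  by have := xN z uz => /negP; case; apply: aconn_trans xy yz.
by rewrite xE yE; congr Tagged; apply/labE.
Qed.

End DiagramActionOnFillings.

(** * Applying a diagram to a tensor that depends on the letters above the first row *)

Section ValueSums.
Variables (l : seq nat) (r : nat) (Om : finType) (w0 : Om).
Implicit Types (b c : box l) (beta : {ffun 'I_r -> box l}) (f g : {ffun 'I_r -> Om}).
Implicit Types (p : diagram r).

Definition bcompat beta g : bool := [forall x, forall y, (beta x == beta y) ==> (g x == g y)].

Lemma bcompatP beta g :
  reflect (forall x y, beta x = beta y -> g x = g y) (bcompat beta g).
Proof.
apply: (iffP forallP) => [H x y /eqP xy|H x].
  by have /forallP/(_ y)/implyP/(_ xy)/eqP := H x.
by apply/forallP => y; apply/implyP => /eqP/H->.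
Qed.

(** The default [w0] off the upper boxes makes the result depend on the upper letters alone. *)
Definition upval beta g : {ffun box l -> Om} :=
  [ffun b => if [pick x | (beta x == b) && up b] is Some x then g x else w0].

Lemma upvalE beta g x : bcompat beta g -> up (beta x) -> upval beta g (beta x) = g x.
Proof.
move=> /bcompatP gb ux; rewrite ffunE; case: pickP => [y /andP[/eqP yx _]|/(_ x)].
  exact: gb.
by rewrite eqxx ux.
Qed.

Lemma upval_row0 beta g b : ~~ up b -> upval beta g b = w0.
Proof. by move=> /negPf ub; rewrite ffunE; case: pickP => // x; rewrite ub andbF. Qed.

Lemma acompatE p beta f g :
  compat (val p :|: [set inr @: B | B : {set 'I_r} in blocks (tab beta)]) (vjoin f g)
  = rho (val p) f g && bcompat beta g.
Proof.
apply/acompatP/andP => -[pg H]; split=> //; first by apply/bcompatP.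
by move=> x y; apply: (bcompatP _ _ H).
Qed.

Lemma acompat_eq p beta f g u v : rho (val p) f g -> bcompat beta g ->
  aconn p beta u v -> vjoin f g u = vjoin f g v.
Proof. by move=> R b; apply: hconn_compat; rewrite acompatE R. Qed.

Variable F : fieldType.
Implicit Type Z : {ffun box l -> Om} -> F.

(** The entry at [f] of the operator of [p] applied to the tensor that is supported on words
    constant on the blocks of [beta] and is there the function [Z] of the upper letters. *)
Definition vsum p beta f Z : F :=
  \sum_g (rho (val p) f g && bcompat beta g)%:R * Z (upval beta g).

(** The upper letters of a compatible [g] are forced by [f], so [Z] leaves the sum, and the number
    of the remaining [g] is given by [card_extensions]. *)
Lemma vsum_spec p beta beta' f Z : onto beta -> onto beta' -> act_spec p beta beta' ->
  vsum p beta f Z =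
    #|Om|%:R ^+ act_exponent p (tab beta) * (bcompat beta' f)%:R * Z (upval beta' f).
Proof.
move=> ob ob' [sA sB].
pose E := val p :|: [set inr @: B | B : {set 'I_r} in blocks (tab beta)].
have bcE : bcompat beta' f = [forall y, forall z, hconn E (inl y) (inl z) ==> (f y == f z)].
  apply/bcompatP/forallP => [H x|H x y /sA xy].
    by apply/forallP => y; apply/implyP => /sA/H->.
  by have /forallP/(_ y)/implyP/(_ xy)/eqP := H x.
have upvalEq g : rho (val p) f g -> bcompat beta g -> bcompat beta' f ->
    upval beta g = upval beta' f.
  move=> R bg bf; apply/ffunP => b; have [ub|nub] := boolP (up b); last first.
    by rewrite !upval_row0.
  have [[y yb] [x xb]] := ((ontoP _ ob) b ub, (ontoP _ ob') b ub).
  rewrite -{1}yb -xb !upvalE ?xb ?yb //.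
  suff xy : aconn p beta (inl x) (inr y) by have := acompat_eq R bg xy.
  by apply/sB; rewrite yb.
have fb g : rho (val p) f g -> bcompat beta g -> bcompat beta' f.
  by move=> R bg; apply/bcompatP => x y /sA xy; have := acompat_eq R bg xy.
transitivity (\sum_(g | rho (val p) f g && bcompat beta g) Z (upval beta' f)).
  rewrite [RHS]big_mkcond /=; apply: eq_bigr => g _; case: ifP => [/andP[R bg]|_].
    by rewrite mul1r (upvalEq g) // (fb g).
  by rewrite mul0r.
rewrite sumr_const -[LHS]mulr_natl; congr (_ * _).
pose jj g : {ffun 'I_r + 'I_r -> Om} := [ffun v => vjoin f g v].
transitivity (#|[set G : {ffun 'I_r + 'I_r -> Om} | compat E G && [forall y, G (inl y) == f y]]|%:R : F).
  congr (_%:R); rewrite -cardsE -(@card_imset _ _ jj); last first.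
    by move=> g g' /ffunP gg; apply/ffunP => i; have := gg (inr i); rewrite !ffunE.
  have cE g : compat E (jj g) = rho (val p) f g && bcompat beta g.
    by rewrite -acompatE; apply: compat_eq => v; rewrite ffunE.
  apply: eq_card => G; rewrite [RHS]inE; apply/imsetP/andP => [[g]|[GE /forallP Go]].
    by rewrite inE unfold_in -cE => gg ->; split=> //; apply/forallP => y; rewrite ffunE.
  have eG : G = jj [ffun i => G (inr i)].
    by apply/ffunP => -[i|i]; rewrite !ffunE /= ?ffunE //; exact: (eqP (Go i)).
  by exists [ffun i => G (inr i)]; rewrite // inE unfold_in -cE -eG.
rewrite (card_extensions _ _ _ w0) -bcE; case: ifP => _; last by rewrite mulr0.
by rewrite mulr1 natrX.
Qed.

Definition updv b (s : {perm Om}) (phi : {ffun box l -> Om}) : {ffun box l -> Om} :=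
  [ffun c => if c == b then s (phi c) else phi c].

(** The action vanishes for one of two reasons: two upper blocks are joined, or an upper block loses
    contact with the top. In the second case its letter is free and can be permuted at will under
    the sum. *)
Lemma vsum_zero p beta : ~~ act_nonzero p (tab beta) ->
  (exists x y, [/\ up (beta x), up (beta y), beta x != beta y &
     aconn p beta (inr x) (inr y)])
  \/ exists x, up (beta x) /\ forall s f Z,
       vsum p beta f Z = vsum p beta f (Z \o updv (beta x) s).
Proof.
move=> nz.
have [/existsP[x /existsP[y /and4P[? ? ? ?]]]|N1] :=
  boolP [exists x, exists y, [&& up (beta x), up (beta y), beta x != beta y
     & aconn p beta (inr x) (inr y)]]; first by left; exists x, y.
right; have inj x y : up (beta x) -> up (beta y) -> aconn p beta (inr x) (inr y) ->
    beta x = beta y.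
  move=> ux uy xy; apply/eqP; apply: contraNT N1 => nxy.
  by apply/existsP; exists x; apply/existsP; exists y; apply/and4P.
have [y uy yN] : exists2 y, up (beta y) & forall x, ~~ aconn p beta (inl x) (inr y).
  have [/exists_inP[y uy /forallP yN]|N2] :=
    boolP [exists y in [pred y | up (beta y)], [forall x, ~~ aconn p beta (inl x) (inr y)]].
    by exists y.
  case/negP: nz; apply/act_nonzeroP; split=> // y uy.
  apply/existsP; apply: contraNT N2 => /existsPn yN.
  by apply/exists_inP; exists y => //; apply/forallP.
exists y; split=> // s f Z.
(* Apply [s] on the whole component of [y]. It contains no top vertex, so compatibility with [f] is
   not disturbed. *)
pose mv (s : {perm Om}) g : {ffun 'I_r -> Om} :=
  [ffun z => if aconn p beta (inr z) (inr y) then s (g z) else g z].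
have mvK (t : {perm Om}) g : mv t^-1%g (mv t g) = g.
  by apply/ffunP => z; rewrite !ffunE; case E: (aconn _ _ _ _); rewrite ?permK.
have mvC (t : {perm Om}) g : rho (val p) f g && bcompat beta g ->
    rho (val p) f (mv t g) && bcompat beta (mv t g).
  rewrite -!acompatE => /compatP H; apply/compatP => u v uv.
  have uvy : aconn p beta u (inr y) = aconn p beta v (inr y).
    by rewrite ![aconn p beta _ (inr y)]aconn_sym (aconn_eqr _ uv).
  case: u v uv uvy => [x|z] [x'|z'] uv /=; rewrite ?(negPf (yN _)) ?ffunE => E.
  - exact: H uv.
  - by rewrite -E; exact: H uv.
  - by rewrite E; exact: H uv.
  by have /= := H _ _ uv; rewrite E => ->.
have mvE (t : {perm Om}) g : rho (val p) f (mv t g) && bcompat beta (mv t g) =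
    rho (val p) f g && bcompat beta g.
  by apply/idP/idP => [/(mvC t^-1%g)|/mvC//]; rewrite mvK.
rewrite /vsum (reindex_inj (can_inj (mvK s))) /=; apply: eq_bigr => g _.
rewrite mvE; case: (boolP (_ && _)) => [/andP[R bg]|_]; last by rewrite !mul0r.
congr (_ * Z _); have bg' : bcompat beta (mv s g).
  by have /andP[] : rho (val p) f (mv s g) && bcompat beta (mv s g) by rewrite mvE R.
apply/ffunP => c; rewrite [RHS]ffunE; have [ub|nub] := boolP (up c); last first.
  by rewrite !upval_row0 //; case: eqP nub => // ->; rewrite uy.
have [/existsP[z /eqP zc]|/existsPn cN] := boolP [exists z, beta z == c].
  rewrite -zc !upvalE ?zc // ffunE; have -> // : aconn p beta (inr z) (inr y) = (c == beta y).
  by rewrite -zc; apply/idP/eqP => [|/aconn_fib//]; apply: inj; rewrite // zc.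
have -> : (c == beta y) = false by rewrite eq_sym (negPf (cN y)).
by rewrite !ffunE; case: pickP => // z; rewrite (negPf (cN z)).
Qed.

End ValueSums.

(** * Comparing labellings that define the same tabloid *)

Section Tabloids.
Variables (l : seq nat) (r : nat).
Implicit Types (b c : box l) (beta gamma : {ffun 'I_r -> box l}).

Lemma mem_tab beta i B : reflect (exists2 x, box_row (beta x) = i & B = fib beta (beta x))
  (B \in tab beta i).
Proof.
rewrite ffunE; apply: (iffP setD1P) => [[/set0Pn[x xB] /imsetP[b ib eB]]|[x <- ->]].
  by exists x; move: xB ib; rewrite eB fibE inE => /eqP-> // /eqP.
by rewrite imset_f ?inE //; split=> //; apply/set0Pn; exists x; rewrite fibE.
Qed.

Lemma tabP beta gamma : tab beta = tab gamma <->
  (forall x, box_row (beta x) = box_row (gamma x)) /\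
  (forall x y, beta x = beta y <-> gamma x = gamma y).
Proof.
split=> [E|[Er Ek]].
  have H x : box_row (beta x) = box_row (gamma x) /\ fib beta (beta x) = fib gamma (gamma x).
    have : fib beta (beta x) \in tab beta (box_row (beta x)) by apply/mem_tab; exists x.
    rewrite E => /mem_tab[y yx exy].
    have : x \in fib gamma (gamma y) by rewrite -exy fibE.
    by rewrite fibE => /eqP xy; rewrite xy.
  split=> x; first by have [] := H x.
  move=> y; have [_ /setP/(_ y)] := H x; rewrite !fibE => Hxy.
  by split=> xy; apply/esym/eqP; [rewrite -Hxy | rewrite Hxy]; rewrite xy.
have Ef x : fib beta (beta x) = fib gamma (gamma x).
  by apply/setP => y; rewrite !fibE; apply/eqP/eqP => /Ek.
apply/ffunP => i; apply/setP => B; apply/mem_tab/mem_tab => -[x xi ->]; exists x;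
  by rewrite ?Ef // -xi Er.
Qed.

Lemma image_tabloidE p beta beta' : onto beta -> onto beta' -> act_spec p beta beta' ->
  image_tabloid p (tab beta) = tab beta'.
Proof.
move=> ob ob' s; apply/ffunP => i; rewrite ffunE; case: ifP => [/eqP i0|/negbT]; last rewrite -lt0n => i0.
  rewrite -(act_spec_first ob s) ffunE; congr (_ :\ _); apply/setP => B.
  apply/imsetP/imsetP => -[b]; rewrite inE => /eqP b0 ->; exists b; rewrite // inE;
    [by apply/eqP/val_inj; rewrite /= b0 i0 | by rewrite b0 i0].
apply/setP => B; apply/imsetP/mem_tab => [[_ /mem_tab[y yi ->] ->]|[x xi ->]].
  have uy : up (beta y) by rewrite /up yi.
  have [x xy] := (ontoP _ ob') _ uy; exists x; rewrite ?xy //.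
  by rewrite (act_spec_image ob s).
have ux : up (beta' x) by rewrite /up xi.
have [y yx] := (ontoP _ ob) _ ux; exists (fib beta (beta' x)).
  by apply/mem_tab; exists y; rewrite yx.
exact: (act_spec_image ob s).
Qed.

Lemma blocks_partition beta : partition (blocks (tab beta)) [set: 'I_r].
Proof.
apply/and3P; split.
- apply/eqP/setP => x; rewrite inE; apply/bigcupP; exists (fib beta (beta x)).
    by apply/mem_blocks; exists x.
  by rewrite fibE.
- apply/trivIsetP => _ _ /mem_blocks[x ->] /mem_blocks[y ->] xy.
  apply/pred0P => z /=; rewrite !fibE; apply/negP => /andP[/eqP zx /eqP zy].
  by rewrite -zx -zy eqxx in xy.
by apply/mem_blocks => -[x /setP/(_ x)]; rewrite fibE eqxx inE.
Qed.

Lemma hconn_blocks beta x y : hconn (blocks (tab beta)) x y <-> beta x = beta y.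
Proof.
split=> [|xy]; last first.
  apply: (@hconn_edge _ _ (fib beta (beta x))); rewrite ?fibE ?xy //.
  by apply/mem_blocks; exists y.
apply: hconn_compat; apply/forall_inP => _ /mem_blocks[t ->].
by apply/forall_inP => u; rewrite fibE => /eqP->; apply/forall_inP => v; rewrite fibE eq_sym.
Qed.

End Tabloids.

Lemma compat_components (T : finType) (E : {set {set T}}) (Om : eqType) (h : T -> Om) :
  compat (components E) h = compat E h.
Proof.
apply/forall_inP/compatP => [H x y xy|H _ /componentsP[z ->]].
  have /forall_inP/(_ x) := H _ (mem_components E x).
  rewrite inE hconn_refl => /(_ isT)/forall_inP/(_ y); rewrite inE => /(_ xy)/eqP//.
apply/forall_inP => x; rewrite inE => /H<-; apply/forall_inP => y.
by rewrite inE => /H<-.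
Qed.

Definition diagram_of (r : nat) (E : {set {set 'I_r + 'I_r}}) : diagram r :=
  exist _ (components E) (components_partition E).

(** * Tabloids as tensors *)

Section FunctionModel.
Variables (F : numClosedFieldType) (l : seq nat) (r n : nat).
Hypotheses (r_gt0 : (0 < r)%N) (le2rn : (2 * r <= n)%N).
Implicit Types (b c : box l) (beta gamma : {ffun 'I_r -> box l}) (p : diagram r).
Local Notation m := #|[pred b : box l | up b]|.
Hypothesis le_mr : (m <= r)%N.
Hypotheses (l_gt0 : (0 < size l)%N) (le_r_l0 : (r <= nth 0 l 0)%N).

(* Two letters of opposite sign for each box above the first row, so that the
   signs of all letters sum to zero. *)
Definition letter : finType := ({b : box l | up b} * bool + 'I_(n - 2 * m))%type.

Lemma card_letter : #|letter| = n.
Proof.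
rewrite card_sum card_prod card_bool card_ord card_sig mulnC subnKC //.
by apply: leq_trans le2rn; rewrite leq_mul2l.
Qed.

Lemma letter0 : letter.
Proof.
have n0 : (0 < n)%N by apply: leq_trans le2rn; rewrite muln_gt0.
by apply: (enum_val (A := letter) (Ordinal (_ : 0 < _)%N)); rewrite card_letter.
Qed.

Definition letter_box (w : letter) : option (box l) :=
  match w with inl (b, _) => Some (val b) | inr _ => None end.

Definition letter_sign (w : letter) : F :=
  match w with inl (_, true) => -1 | _ => 1 end.

Definition flip (w : letter) : letter :=
  match w with inl (b, e) => inl (b, ~~ e) | inr i => inr i end.

Lemma flipK : involutive flip.
Proof. by case=> [[b []]|i]. Qed.

Definition flip_perm : {perm letter} := perm (inv_inj flipK).

(** Letters are matched with the rows of boxes, not with the boxes themselves; this gives the tensor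
    the row symmetry of a tabloid. *)
Definition row_labelled (phi : {ffun box l -> letter}) : bool :=
  [forall b, up b ==> (omap (@box_row l) (letter_box (phi b)) == Some (box_row b))] &&
  [forall b, forall c, [&& up b, up c & letter_box (phi b) == letter_box (phi c)] ==> (b == c)].

(* A tensor killed by the contractions of any two factors, and by summation
   over any factor; it is symmetric under permutations of each row. *)
Definition row_tensor (phi : {ffun box l -> letter}) : F :=
  (row_labelled phi)%:R * \prod_(b | up b) letter_sign (phi b).

Lemma row_tensor_perm (w : {perm box l}) (phi psi : {ffun box l -> letter}) :
  (forall b, box_row (w b) = box_row b) -> (forall b, up b -> phi b = psi (w b)) ->
  row_tensor phi = row_tensor psi.
Proof.
move=> wr phiE; have wu b : up (w b) = up b by rewrite /up wr.
rewrite /row_tensor; congr (_%:R * _); last first.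
  by rewrite [RHS](reindex_inj (@perm_inj _ w)); apply: eq_big => b; rewrite ?wu // => /phiE->.
congr nat_of_bool; apply/andP/andP => -[/forall_inP H1 /forallP H2]; split.
- apply/forall_inP => b; rewrite -(permKV w b) wu => ub.
  by rewrite -phiE // wr; apply: H1.
- apply/forallP => b; apply/forallP => c; apply/implyP => /and3P[ub uc].
  rewrite -(permKV w b) -(permKV w c) !wu in ub uc *.
  rewrite -!phiE // => bc; have /forallP/(_ (w^-1 c)%g)/implyP := H2 (w^-1 b)%g.
  by rewrite ub uc bc => /(_ isT)/eqP->.
- by apply/forall_inP => b ub; rewrite phiE // -wr; apply: H1; rewrite wu.
apply/forallP => b; apply/forallP => c; apply/implyP => /and3P[ub uc].
rewrite !phiE // => bc; have /forallP/(_ (w c))/implyP := H2 (w b).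
by rewrite !wu ub uc bc => /(_ isT)/eqP/perm_inj->.
Qed.

Lemma row_tensor_flip b phi : up b -> row_tensor (updv b flip_perm phi) = - row_tensor phi.
Proof.
move=> ub; have lb c : letter_box (updv b flip_perm phi c) = letter_box (phi c).
  by rewrite ffunE; case: eqP => // _; rewrite permE; case: (phi c) => [[? ?]|].
rewrite /row_tensor; have -> : row_labelled (updv b flip_perm phi) = row_labelled phi.
  rewrite /row_labelled; congr (_ && _); apply: eq_forallb => c; first by rewrite lb.
  by apply: eq_forallb => d; rewrite !lb.
have [lab|] := boolP (row_labelled phi); last by rewrite !mul0r oppr0.
rewrite !mul1r (bigD1 b) //= [in RHS](bigD1 b) //= -mulNr; congr (_ * _).
  rewrite ffunE eqxx permE; have /andP[/forall_inP/(_ b ub)] := lab.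
  by case: (phi b) => [[? []]|] //; rewrite /= ?opprK.
by apply: eq_bigr => c /andP[_ /negPf cb]; rewrite ffunE cb.
Qed.

Lemma row_tensor_inj (phi : {ffun box l -> letter}) b c : up b -> up c -> b != c -> phi b = phi c -> row_tensor phi = 0.
Proof.
move=> ub uc bc E; rewrite /row_tensor [row_labelled _](_ : _ = false) ?mul0r //.
apply/negP => /andP[_ /forallP/(_ b)/forallP/(_ c)]; rewrite ub uc E eqxx /=.
by rewrite (negPf bc).
Qed.

Definition th beta (g : {ffun 'I_r -> letter}) : F :=
  (bcompat beta g)%:R * row_tensor (upval letter0 beta g).

Lemma vsum_th p beta f : \sum_g (rho (val p) f g)%:R * th beta g =
  vsum letter0 p beta f row_tensor.
Proof. by apply: eq_bigr => g _; rewrite mulrA -natrM mulnb. Qed.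

(** Joined upper blocks carry equal letters, where the tensor vanishes; for an upper block cut off
    from the top, flipping the sign of its letter shows that the sum equals its own negative. *)
Lemma vsum_th0 p beta f : ~~ act_nonzero p (tab beta) ->
  vsum letter0 p beta f row_tensor = 0.
Proof.
case/(vsum_zero letter0 F) => [[x [y [ux uy nxy xy]]]|[x [ux H]]].
  rewrite /vsum big1 // => g _; case: (boolP (_ && _)) => [/andP[R bg]|]; last by rewrite mul0r.
  rewrite (row_tensor_inj ux uy nxy) ?mulr0 // !upvalE //.
  by have := acompat_eq R bg xy.
have : vsum letter0 p beta f row_tensor = - vsum letter0 p beta f row_tensor.
  rewrite {1}(H flip_perm) /vsum -sumrN; apply: eq_bigr => g _ /=.
  by rewrite row_tensor_flip // mulrN.
move/eqP; rewrite -subr_eq0 opprK -mulr2n -mulr_natl mulf_eq0 pnatr_eq0 /=.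
by move/eqP.
Qed.

Lemma tab_perm beta gamma : onto beta -> onto gamma -> tab beta = tab gamma ->
  exists w : {perm box l}, (forall b, box_row (w b) = box_row b) /\
    forall x, up (beta x) -> gamma x = w (beta x).
Proof.
move=> ob og /tabP[Er Ek].
pose w b := if [pick x | (beta x == b) && up b] is Some x then gamma x else b.
have wE x : up (beta x) -> w (beta x) = gamma x.
  move=> ux; rewrite /w; case: pickP => [y /andP[/eqP/Ek ->//]|/(_ x)].
  by rewrite eqxx ux.
have wN b : ~~ up b -> w b = b.
  by move=> /negPf ub; rewrite /w; case: pickP => // x; rewrite ub andbF.
have wr b : box_row (w b) = box_row b.
  have [ub|/wN->//] := boolP (up b).
  by have [x <-] := (ontoP _ ob) b ub; have := ub; rewrite /w;
     case: pickP => // y /andP[/eqP<-] _ _; rewrite Er.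
have wI : injective w.
  move=> b c bc; have := wr b; rewrite bc wr => rbc.
  have [ub|ub] := boolP (up b); last first.
    by move: bc; rewrite !wN // /up rbc.
  have uc : up c by rewrite /up rbc.
  have [[x xb] [y yc]] := ((ontoP _ ob) b ub, (ontoP _ ob) c uc).
  by move: bc; rewrite -xb -yc !wE ?xb ?yc // => /Ek; rewrite xb yc.
exists (perm wI); split=> [b|x ux]; rewrite permE //; exact/esym/wE.
Qed.

Lemma th_tab beta gamma g : onto beta -> onto gamma -> tab beta = tab gamma ->
  th beta g = th gamma g.
Proof.
move=> ob og E; have [w [wr wE]] := tab_perm ob og E; have /tabP[_ Ek] := E.
have bE : bcompat beta g = bcompat gamma g.
  by apply/bcompatP/bcompatP => H x y /Ek/H.
rewrite /th -bE; case: (boolP (bcompat beta g)) => bg; last by rewrite !mul0r.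
congr (_ * _); apply: (row_tensor_perm wr) => b ub.
have [x xb] := (ontoP _ ob) b ub; rewrite -{1}xb upvalE ?xb //.
by rewrite -xb -wE ?xb // upvalE -?bE // wE ?xb // /up wr -/(up _).
Qed.

(** Give each upper box its own letter of sign plus, and each block of the first row a private
    letter among the n - 2m others. These suffice: each of the m upper boxes uses up a vertex, so at
    most r - m vertices lie in the first row, and r - m <= n - 2m. A labelling whose tensor is
    nonzero at this word has its blocks inside those of [beta]. *)
Lemma th_generic beta : onto beta -> exists g, th beta g != 0 /\
  forall gamma, onto gamma -> th gamma g != 0 ->
    tab gamma = tab beta \/ (#|blocks (tab beta)| < #|blocks (tab gamma)|)%N.
Proof.
move=> ob; pose L := [pred x | ~~ up (beta x)].
have cL : (#|L| <= n - 2 * m)%N.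
  have : (m <= #|[pred x | up (beta x)]|)%N.
    have pk b : exists x, up b ==> (beta x == b).
      have [ub|nub] := boolP (up b); last by exists (Ordinal r_gt0).
      by have [x xb] := (ontoP _ ob) b ub; exists x; rewrite xb eqxx.
    pose f b := xchoose (pk b).
    have fE b : up b -> beta (f b) = b by move=> ub; have /implyP/(_ ub)/eqP := xchooseP (pk b).
    rewrite -(@card_in_imset _ _ f) => [|b c ub uc]; last first.
      by move=> /(congr1 beta); rewrite !fE.
    by apply/subset_leq_card/subsetP => _ /imsetP[b ub ->]; rewrite inE fE.
  have : (#|[pred x | up (beta x)]| + #|L| = r)%N.
    by rewrite -[RHS](card_ord r) -(cardC [pred x | up (beta x)]).
  move: le2rn le_mr; lia.
pose h x := odflt x [pick y | beta x == beta y].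
have hb z : beta (h z) = beta z.
  by rewrite /h; case: pickP => [t /eqP<-//|/(_ z)]; rewrite eqxx.
have hE x y : h x = h y <-> beta x = beta y.
  split=> [/(congr1 beta)|xy]; first by rewrite !hb.
  by rewrite /h xy; case: pickP => // /(_ y); rewrite eqxx.
have hL x : ~~ up (beta x) -> (index (h x) (enum L) < n - 2 * m)%N.
  by move=> nux; apply: leq_trans cL; rewrite cardE index_mem mem_enum inE hb.
pose g : {ffun 'I_r -> letter} := [ffun x =>
  if insub (beta x) is Some u then inl (u : {b : box l | up b}, false)
  else if insub (index (h x) (enum L)) is Some i then inr i else letter0].
have gup x (ux : up (beta x)) : g x = inl (exist _ (beta x) ux, false).
  by rewrite ffunE insubT.
have glow x (nux : ~~ up (beta x)) : g x = inr (Ordinal (hL x nux)).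
  by rewrite ffunE insubN // (@insubT _ _ 'I_(n - 2 * m) _ (hL x nux)).
have gE x y : g x = g y <-> beta x = beta y.
  have [ux|nux] := boolP (up (beta x)); have [uy|nuy] := boolP (up (beta y)).
  - by rewrite (gup x ux) (gup y uy); split=> [[->]//|xy]; congr (inl (_, _)); apply: val_inj.
  - by rewrite (gup x ux) (glow y nuy); split=> // xy; exfalso; move: (nuy); rewrite -xy ux.
  - by rewrite (glow x nux) (gup y uy); split=> // xy; exfalso; move: (nux); rewrite xy uy.
  rewrite (glow x nux) (glow y nuy); split=> [[]|xy].
    by move/(congr1 (nth (h x) (enum L))); rewrite !nth_index ?mem_enum ?inE ?hb // => /hE.
  by congr inr; apply: val_inj; rewrite /= (_ : h x = h y) //; apply/hE.
have upvg x : up (beta x) -> upval letter0 beta g (beta x) = g x.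
  by apply: upvalE; apply/bcompatP => ? ? /gE.
exists g; split.
  rewrite /th (_ : bcompat beta g); last by apply/bcompatP => x y /gE.
  have lb b : up b -> exists ub : up b, upval letter0 beta g b = inl (exist _ b ub, false).
    move=> ub; have [x xb] := (ontoP _ ob) b ub; rewrite -xb in ub *.
    by exists ub; rewrite upvg // gup.
  rewrite mul1r /row_tensor [row_labelled _](_ : _ = true).
    rewrite mul1r big1 ?oner_neq0 // => b /lb[ub ->] //.
  apply/andP; split.
    by apply/forall_inP => b /lb[ub ->].
  apply/forallP => b; apply/forallP => c; apply/implyP => /and3P[/lb[ub ->] /lb[uc ->]].
  by [].
move=> gamma og; rewrite /th mulf_eq0 negb_or pnatr_eq0 eqb0 negbK => /andP[/bcompatP bg].
rewrite mulf_eq0 negb_or pnatr_eq0 eqb0 negbK => /andP[/andP[/forall_inP lab1 /forallP lab2] _].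
have Ek x y : gamma x = gamma y -> beta x = beta y by move=> /bg/gE.
have bgg : bcompat gamma g by apply/bcompatP.
have [|nle] := ltnP #|blocks (tab beta)| #|blocks (tab gamma)|; [by right | left].
have Ek' x y : beta x = beta y -> gamma x = gamma y.
  have [|E|] := partition_refine (blocks_partition beta) (blocks_partition gamma).
  - by move=> u v /hconn_blocks/Ek/hconn_blocks.
  - by move/hconn_blocks; rewrite -E => /hconn_blocks.
  by rewrite ltnNge nle.
apply/tabP; split=> [x|x y]; last by split=> [/Ek|/Ek'].
have upg y : up (gamma y) -> up (beta y) /\ box_row (beta y) = box_row (gamma y).
  move=> uy; have := lab1 _ uy; rewrite upvalE //.
  have [ub|nub] := boolP (up (beta y)); last by rewrite glow.
  by rewrite gup /= => /eqP[].
have [ux|nux] := boolP (up (gamma x)); first by have [] := upg x ux.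
have [ux|nux'] := boolP (up (beta x)); last first.
  by apply: val_inj => /=; move: nux nux'; rewrite /up -!eqn0Ngt => /eqP-> /eqP->.
case/negP: nux.
(* It remains to exclude a block that is upper for [beta] but in the first row for [gamma]. Reading
   letters embeds the upper boxes of [gamma] into those of [beta], so by counting it hits all of
   them, in particular [beta x]. *)
pose w b : box l := odflt b (letter_box (upval letter0 gamma g b)).
have wE y : up (gamma y) -> w (gamma y) = beta y.
  by move=> uy; rewrite /w upvalE // gup //; have [] := upg y uy.
have wsub : w @: [set b | up b] \subset [set b | up b].
  apply/subsetP => _ /imsetP[b + ->]; rewrite !inE => ub.
  by have [y yb] := (ontoP _ og) b ub; rewrite -yb wE ?yb //; have [] := upg y; rewrite ?yb.
have wfull : w @: [set b | up b] = [set b | up b].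
  apply/eqP; rewrite eqEcard wsub card_in_imset ?leqnn // => b c; rewrite !inE => ub uc.
  have [[y yb] [z zc]] := ((ontoP _ og) b ub, (ontoP _ og) c uc).
  move=> E; have /Ek' : beta y = beta z by rewrite -(wE y) -?(wE z) ?yb ?zc.
  by rewrite yb zc.
have : beta x \in w @: [set b | up b] by rewrite wfull inE.
case/imsetP => b; rewrite inE => ub; have [y yb] := (ontoP _ og) b ub.
by rewrite -yb wE ?yb // => /Ek'->; rewrite yb.
Qed.

Local Notation tabspace := (tabspace F r l).
Local Notation elt := (@tabloid_elt F r l).
Local Notation act := (@partalg_act F r n l).
Implicit Types (t : tabloid r l) (u v : tabspace) (x y : partalg r F).

(** The basis of the ambient space consists of arbitrary families of sets of blocks, most of which
    come from no tableau. The module axioms are established on the span of those that do. *)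
Definition legit_tabloid t : bool := [exists beta, onto beta && (tab beta == t)].

Lemma legit_tabloidP t : reflect (exists2 beta, onto beta & t = tab beta) (legit_tabloid t).
Proof.
apply: (iffP existsP) => [[beta /andP[ob /eqP]]|[beta ob ->]]; exists beta => //.
by rewrite ob eqxx.
Qed.

Definition legit u : bool := [forall t, (u t != 0) ==> legit_tabloid t].

Lemma legitP u : reflect (forall t, u t != 0 -> legit_tabloid t) (legit u).
Proof. exact: forall_inP. Qed.

Lemma legit_lin (c : F) u v : legit u -> legit v -> legit (c *: u + v).
Proof.
move=> /legitP lu /legitP lv; apply/legitP => t; rewrite !ffunE.
have [/lu//|/negPn/eqP->] := boolP (u t != 0).
by rewrite scaler0 add0r => /lv.
Qed.

Lemma legit0 : legit 0.
Proof. by apply/legitP => t; rewrite ffunE eqxx. Qed.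

Lemma legit_sum (I : Type) (s : seq I) (P : pred I) (G : I -> tabspace) :
  (forall i, P i -> legit (G i)) -> legit (\sum_(i <- s | P i) G i).
Proof.
move=> H; elim/big_rec: _ => [|i w /H lG lw]; first exact: legit0.
by rewrite -[G i]scale1r; apply: legit_lin.
Qed.

Lemma legitZ (c : F) u : legit u -> legit (c *: u).
Proof. by move=> lu; rewrite -[_ *: _]addr0; apply: legit_lin => //; apply: legit0. Qed.

Lemma legit_elt beta : onto beta -> legit (elt (tab beta)).
Proof.
move=> ob; apply/legitP => t; rewrite ffunE; case: (t =P tab beta) => [-> _|]; last by rewrite eqxx.
by apply/legit_tabloidP; exists beta.
Qed.

Definition tabloid_fun t g : F :=
  if [pick beta | onto beta && (tab beta == t)] is Some beta then th beta g else 0.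

Lemma tabloid_funE beta g : onto beta -> tabloid_fun (tab beta) g = th beta g.
Proof.
rewrite /tabloid_fun => ob; case: pickP => [gamma /andP[og /eqP E]|/(_ beta)].
  exact: th_tab.
by rewrite ob eqxx.
Qed.

Definition Theta g u : F^o := \sum_t u t * tabloid_fun t g.

Lemma Theta_is_linear g : linear (Theta g).
Proof.
move=> a u v; rewrite /Theta scaler_sumr -big_split; apply: eq_bigr => t _.
by rewrite !ffunE mulrDl -mulrA.
Qed.

HB.instance Definition _ g := GRing.isLinear.Build F tabspace F^o _
  (Theta g) (Theta_is_linear g).

Lemma Theta_elt beta g : onto beta -> Theta g (elt (tab beta)) = th beta g.
Proof.
move=> ob; rewrite /Theta (bigD1 (tab beta)) //= ffunE eqxx mul1r tabloid_funE //.
by rewrite big1 ?addr0 // => t /negPf tb; rewrite ffunE tb mul0r.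
Qed.

Lemma Theta_inj u : legit u -> (forall g, Theta g u = 0) -> u = 0.
Proof.
move=> /legitP lu u0.
have wit t : {g | legit_tabloid t -> tabloid_fun t g != 0 /\ forall s, legit_tabloid s ->
    tabloid_fun s g != 0 -> s = t \/ (#|blocks t| < #|blocks s|)%N}.
  have H : exists g, legit_tabloid t ==> (tabloid_fun t g != 0) &&
     [forall s, legit_tabloid s && (tabloid_fun s g != 0) ==>
       ((s == t) || (#|blocks t| < #|blocks s|)%N)].
    have [/legit_tabloidP[beta ob ->]|_] := boolP (legit_tabloid t); last by exists [ffun=> letter0].
    have [g [g0 H]] := th_generic ob; exists g; rewrite /= tabloid_funE // g0 /=.
    apply/forallP => s; apply/implyP => /andP[/legit_tabloidP[gamma og ->]].
    by rewrite tabloid_funE // => /(H _ og)[->|->]; rewrite ?eqxx ?orbT.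
  exists (xchoose H) => lt; have /implyP/(_ lt)/andP[-> /forallP Hs] := xchooseP H.
  split=> // s ls s0; have /implyP := Hs s; rewrite ls s0 => /(_ isT)/orP[/eqP|]; by [left|right].
have u1 : forall t, legit_tabloid t -> u t = 0.
  apply: (@triangular_free F _ _ legit_tabloid tabloid_fun
    (fun t => sval (wit t)) (fun t => #|blocks t|) u).
  - by move=> t lt; have [] := svalP (wit t) lt.
  - by move=> t s lt ls s0; have [_ H] := svalP (wit t) lt; apply: H.
  move=> g; rewrite -[RHS](u0 g) /Theta [RHS](bigID legit_tabloid) /=.
  rewrite [X in _ = _ + X]big1 ?addr0 // => t nlt.
  by have [/lu|/negPn/eqP->] := boolP (u t != 0); rewrite ?(negPf nlt) ?mul0r.
apply/ffunP => t; rewrite [RHS]ffunE; have [/lu/u1//|/negPn/eqP//] := boolP (u t != 0).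
Qed.

Lemma legit_diagram_act p beta : onto beta -> legit (diagram_act F n p (tab beta)).
Proof.
move=> ob; rewrite /diagram_act; case: ifP => [nz|_]; last exact: legit0.
have [beta' ob' s] := act_spec_exists l_gt0 le_r_l0 ob nz.
by rewrite (image_tabloidE ob ob' s); apply/legitZ/legit_elt.
Qed.

Lemma Theta_diagram_act p beta g : onto beta ->
  Theta g (diagram_act F n p (tab beta)) = \sum_h (rho (val p) g h)%:R * th beta h.
Proof.
move=> ob; rewrite vsum_th /diagram_act; case: (boolP (act_nonzero _ _)) => [nz|nz].
  have [beta' ob' s] := act_spec_exists l_gt0 le_r_l0 ob nz.
  rewrite (image_tabloidE ob ob' s) linearZ /= Theta_elt //.
  by rewrite (vsum_spec letter0 g row_tensor ob ob' s) card_letter -mulrA.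
by rewrite linear0 vsum_th0.
Qed.

Lemma legit_act x u : legit u -> legit (act x u).
Proof.
move=> /legitP lu; apply: legit_sum => p _; apply: legit_sum => t _.
have [/lu/legit_tabloidP[beta ob ->]|/negPn/eqP->] := boolP (u t != 0).
  by apply: legitZ; apply: legit_diagram_act.
by rewrite mulr0 scale0r legit0.
Qed.

Lemma Theta_act x u g : legit u ->
  Theta g (act x u) = \sum_h rhoM g h x * Theta h u.
Proof.
move=> /legitP lu; rewrite /partalg_act linear_sum /=.
transitivity (\sum_p \sum_t x p * u t * \sum_h (rho (val p) g h)%:R * tabloid_fun t h).
  apply: eq_bigr => p _; rewrite linear_sum; apply: eq_bigr => t _; rewrite linearZ /=.
  have [/lu/legit_tabloidP[beta ob ->]|/negPn/eqP->] := boolP (u t != 0); last first.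
    by rewrite mulr0 mul0r scale0r.
  rewrite Theta_diagram_act // -[LHS]/(_ * _); congr (_ * _).
  by apply: eq_bigr => h _; rewrite tabloid_funE.
rewrite [RHS](eq_bigr (fun h => \sum_p \sum_t x p * u t * ((rho (val p) g h)%:R * tabloid_fun t h))).
  rewrite [RHS]exchange_big; apply: eq_bigr => p _; rewrite [RHS]exchange_big.
  by apply: eq_bigr => t _; rewrite mulr_sumr.
move=> h _; rewrite /rhoM /Theta mulr_suml; apply: eq_bigr => p _.
by rewrite mulr_sumr; apply: eq_bigr => t _; rewrite mulrACA.
Qed.

Lemma Theta_ext u v : legit u -> legit v -> (forall g, Theta g u = Theta g v) -> u = v.
Proof.
move=> lu lv uv; apply/eqP; rewrite -subr_eq0; apply/eqP/Theta_inj.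
  by rewrite addrC -scaleN1r; apply: legit_lin.
by move=> g; rewrite linearB /= uv subrr.
Qed.

Lemma act_mul x y u : legit u -> act (partalg_mul n x y) u = act x (act y u).
Proof.
move=> lu; apply: Theta_ext => [||g]; rewrite ?legit_act //.
rewrite !Theta_act ?legit_act //.
under [RHS]eq_bigr => h _ do rewrite Theta_act // mulr_sumr.
rewrite exchange_big /=; apply: eq_bigr => h _.
rewrite (rhoM_mul letter0) ?card_letter // mulr_suml.
by apply: eq_bigr => g' _; rewrite mulrA.
Qed.

Lemma act_perm_elt (s : 'S_r) beta : onto beta ->
  act (perm_elt F s) (elt (tab beta)) = elt (tab [ffun i => beta (s^-1 i)%g]).
Proof.
move=> ob; have os : onto [ffun i => beta (s^-1 i)%g].
  apply/ontoP => b ub; have [i ib] := (ontoP _ ob) b ub.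
  by exists (s i); rewrite ffunE permK.
apply: Theta_ext => [||g]; rewrite ?legit_act ?legit_elt //.
rewrite Theta_act ?legit_elt // (bigD1 [ffun i => g (s i)]) //= rhoM_perm eqxx mul1r.
rewrite !Theta_elt // big1 ?addr0 => [|h /negPf hs]; last by rewrite rhoM_perm hs mul0r.
rewrite /th; have -> : bcompat [ffun i => beta (s^-1 i)%g] g = bcompat beta [ffun i => g (s i)].
  apply/bcompatP/bcompatP => H i j; rewrite ?ffunE => ij.
    by apply: H; rewrite !ffunE !permK.
  by have := H _ _ ij; rewrite !ffunE !permKV.
case: (boolP (bcompat _ _)) => bg; last by rewrite !mul0r.
congr (_ * row_tensor _); apply/ffunP => b.
have [ub|nub] := boolP (up b); last by rewrite !upval_row0.
have [i ib] := (ontoP _ ob) b ub.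
rewrite -{1}ib upvalE ?ib // ffunE.
have := @upvalE l r letter letter0 [ffun i => beta (s^-1 i)%g] g (s i).
rewrite ffunE permK ib => -> //; apply/bcompatP => j j'; rewrite !ffunE => jj.
by have /bcompatP/(_ _ _ jj) := bg; rewrite !ffunE !permKV.
Qed.

(** The standard Hermitian product of tensors pulled back along [Theta]; definite on legitimate
    vectors by [Theta_inj]. *)
Definition form u v : F := \sum_g Theta g u * (Theta g v)^*.

Lemma form_linl (c : F) u u' v : form (c *: u + u') v = c * form u v + form u' v.
Proof.
rewrite /form mulr_sumr -big_split; apply: eq_bigr => g _ /=.
by rewrite linearP /= mulrDl -mulrA.
Qed.

Lemma form_eq0 u : legit u -> form u u = 0 -> u = 0.
Proof.
move=> lu /eqP; rewrite psumr_eq0 => [/allP H|g _]; last exact: mul_conjC_ge0.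
apply: Theta_inj => // g; have := H g (mem_index_enum _) => /implyP/(_ isT).
by rewrite mul_conjC_eq0 => /eqP.
Qed.

(** Turning a diagram upside down transposes its operator, and the entries are 0 or 1, hence fixed
    by conjugation. *)
Lemma form_adjoint p (q : diagram r) u v : legit u -> legit v ->
  (forall f g : {ffun 'I_r -> letter}, rho (val q) f g = rho (val p) g f) ->
  form (act (diag_elt F (val p)) u) v = form u (act (diag_elt F (val q)) v).
Proof.
move=> lu lv pq; rewrite /form.
under eq_bigr => g _ do rewrite Theta_act // mulr_suml.
rewrite exchange_big /=; apply: eq_bigr => h _.
rewrite Theta_act // rmorph_sum mulr_sumr; apply: eq_bigr => g _.
rewrite !rhoM_diag ?(valP p) ?(valP q) // pq rmorphM /= conjC_nat.
by rewrite mulrCA mulrA.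
Qed.

End FunctionModel.

(** * Straightening *)

(** The rearrangement inequality for a single exchange. It drives the straightening, the sorting of
    columns and the independence of the w_T. *)
Lemma sum_tperm_lt (I : finType) (w f : I -> nat) (b b' : I) :
  (w b < w b')%N -> (f b' < f b)%N ->
  (\sum_c w c * f c < \sum_c w c * f (tperm b b' c))%N.
Proof.
move=> wb rb; have nbb : b' != b by apply: contraTneq wb => ->; rewrite ltnn.
rewrite (bigD1 b) //= (bigD1 b') //= [in ltnRHS](bigD1 b) //= [in ltnRHS](bigD1 b') //=.
rewrite tpermL tpermR [X in (_ < _ + (_ + X))%N](eq_bigr (fun c => w c * f c)%N).
  rewrite !addnA ltn_add2r; move: wb rb.
  move: (w b) (w b') (f b) (f b') => u u' x y /subnKC <- /subnKC <-.
  by rewrite !mulnDl !mulnDr; nia.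
by move=> c /andP[cb cb']; rewrite tpermD // eq_sym.
Qed.

Section Straightening.
Variables (l : seq nat).
Hypothesis l_sorted : sorted geq l.
Implicit Types (b c : box l).

Lemma nth_sorted_geq i j : (i <= j)%N -> (nth 0 l j <= nth 0 l i)%N.
Proof.
move=> ij; have [jl|lj] := ltnP j (size l); last by rewrite [X in (X <= _)%N]nth_default.
have geq_trans : transitive geq by move=> x y z /= yx xz; apply: leq_trans xz yx.
apply: (sorted_leq_nth geq_trans (fun x => leqnn x) 0%N l_sorted) => //.
by rewrite inE; apply: leq_ltn_trans jl.
Qed.

Lemma box_at b (i : nat) (j : nat) : (i <= box_row b)%N -> (j <= box_col b)%N ->
  exists c, box_row c = i :> nat /\ box_col c = j.
Proof.
case: b => i0 j0 /=; rewrite /box_row /box_col /= => ii jj.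
have il : (i < size l)%N by apply: leq_ltn_trans ii (ltn_ord i0).
have jl : (j < nth 0 l (Ordinal il))%N.
  by apply: leq_ltn_trans jj _; apply: leq_trans (ltn_ord j0) _; apply: nth_sorted_geq.
by exists (Tagged (fun i : 'I_(size l) => 'I_(nth 0 l i)) (Ordinal jl)).
Qed.

Lemma column_group_tperm b b' : up b -> up b' -> box_col b = box_col b' ->
  tperm b b' \in column_group l.
Proof.
move=> ub ub' bb; rewrite inE; apply/forallP => c; case: tpermP => [->|->|] //.
- by rewrite bb eqxx /= eqn0Ngt -/(up b) ub.
- by rewrite bb eqxx /= eqn0Ngt -/(up b') ub'.
by rewrite !eqxx implybT.
Qed.

Variables (F : fieldType) (X : finType) (V : vectType F) (rk : X -> nat).
Hypothesis rk_inj : injective rk.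
Hypothesis char0 : forall m : nat, m.+1%:R != 0 :> F.
Local Notation filling := {ffun box l -> X}.
Implicit Types (T : filling) (s : {perm box l}).

Definition refill T s : filling := [ffun b => T (s b)].

Variables (P : filling -> Prop) (v : filling -> V).
Hypothesis P_perm : forall T s, P T -> (forall b, up (s b) = up b) -> P (refill T s).
Hypothesis v_row0 : forall T s, P T -> (forall b, up b -> s b = b) -> v (refill T s) = v T.
Hypothesis v_col : forall T s, P T -> s \in column_group l ->
  v (refill T s) = (-1) ^+ s *: v T.
Hypothesis v_garnir : forall T j j' (A : {set box l}), P T -> (j < j')%N ->
  (forall b : box l, b \in A -> up b /\ (box_col b = j \/ box_col b = j')) ->
  (#|[set b : box l | up b & box_col b == j]| < #|A|)%N ->
  \sum_(s | perm_on A s) (-1) ^+ s *: v (refill T s) = 0.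

Definition row_weak T : Prop := forall b b', box_row b = box_row b' ->
  (box_col b < box_col b')%N -> (rk (T b) <= rk (T b'))%N.
Definition col_strict T : Prop := forall b b', up b -> up b' ->
  box_col b = box_col b' -> (box_row b < box_row b')%N -> (rk (T b) < rk (T b'))%N.

Let weight_sum (w : box l -> nat) T := (\sum_b w b * rk (T b))%N.

Lemma weight_sum_perm w T s :
  weight_sum w (refill T s) = (\sum_b w ((s^-1)%g b) * rk (T b))%N.
Proof.
rewrite /weight_sum (reindex_inj (@perm_inj _ s^-1)) /=.
by apply: eq_bigr => b _; rewrite ffunE permKV.
Qed.

Lemma weight_sum_inv w T s : (forall b, w (s b) = w b) ->
  weight_sum w (refill T s) = weight_sum w T.
Proof.
move=> ws; rewrite weight_sum_perm; apply: eq_bigr => b _.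
by rewrite -[w (_ b)]ws permKV.
Qed.

Lemma weight_sum_tperm w T b b' : (w b < w b')%N -> (rk (T b') < rk (T b))%N ->
  (weight_sum w T < weight_sum w (refill T (tperm b b')))%N.
Proof.
move=> wb rb; rewrite /weight_sum [in ltnRHS](eq_bigr (fun c => w c * rk (T (tperm b b' c)))%N).
  exact: (sum_tperm_lt wb rb).
by move=> c _; rewrite ffunE.
Qed.

(** Two potentials. A Garnir exchange moves large entries to a later column and raises the first;
    exchanges inside an upper column or inside the first row keep the first and raise the second. *)
Let colw b := if up b then box_col b else 0%N.
Let posw b := if up b then nat_of_ord (box_row b) else box_col b.

(** As [s] permutes the boxes, all entries may be lowered by [theta] without changing the difference
    of the sums. Then every box contributes a nonnegative amount, and a positive one where an entry
    of [B] moves to a box of [A]. *)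
Lemma garnir_increase T s (A B : {set box l}) j j' theta : (j < j')%N ->
  (forall b, b \in A -> [/\ up b, box_col b = j & (theta <= rk (T b))%N]) ->
  (forall b, b \in B -> [/\ up b, box_col b = j' & (rk (T b) < theta)%N]) ->
  perm_on (A :|: B) s -> s @: A != A ->
  (weight_sum colw T < weight_sum colw (refill T s))%N.
Proof.
move=> jj HA HB sX sA; rewrite weight_sum_perm /weight_sum.
have sX' b : (b \in A :|: B) = ((s^-1)%g b \in A :|: B).
  by rewrite -[in RHS](perm_closed _ sX) permKV.
pose d b : int := ((colw (s^-1%g b))%:Z - (colw b)%:Z) * ((rk (T b))%:Z - theta%:Z).
have dE : ((\sum_b colw (s^-1%g b) * rk (T b))%N%:Z - (\sum_b colw b * rk (T b))%N%:Z) = \sum_b d b.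
  rewrite /d [RHS](eq_bigr (fun b => ((colw (s^-1%g b) * rk (T b))%N%:Z - (colw b * rk (T b))%N%:Z)
     - theta%:Z * ((colw (s^-1%g b))%:Z - (colw b)%:Z))); last by move=> b _; lia.
  have sumw : \sum_b (colw (s^-1%g b))%:Z = \sum_b (colw b)%:Z.
    by rewrite [RHS](reindex_inj (@perm_inj _ s^-1%g)).
  rewrite sumrB -mulr_sumr !sumrB sumw subrr mulr0 subr0.
  by rewrite !(big_morph Posz PoszD (erefl _)).
have cA b : b \in A -> colw b = j by move=> /HA[ub <- _]; rewrite /colw ub.
have cB b : b \in B -> colw b = j' by move=> /HB[ub <- _]; rewrite /colw ub.
have d_ge0 b : 0 <= d b.
  have [bX|bX] := boolP (b \in A :|: B); last first.
    have -> : d b = 0; last by [].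
    have sb : (s^-1)%g b = b.
      by apply: (@perm_inj _ s); rewrite permKV (out_perm sX).
    by rewrite /d sb subrr mul0r.
  have := bX; rewrite sX' inE => /orP sb; move: bX; rewrite inE /d => /orP[bA|bB].
    have [_ _ tb] := HA b bA; apply: mulr_ge0; last by rewrite subr_ge0 lez_nat.
    by rewrite subr_ge0 lez_nat (cA b bA); case: sb => [/cA|/cB] ->; rewrite // ltnW.
  have [_ _ tb] := HB b bB; apply: mulr_le0; last by rewrite subr_le0 lez_nat ltnW.
  by rewrite subr_le0 lez_nat (cB b bB); case: sb => [/cA|/cB] ->; rewrite // ltnW.
have [b bB sbA] : exists2 b, b \in B & (s^-1)%g b \in A.
  have : ~~ (s @: A \subset A).
    by apply: contra sA => sub; rewrite eqEcard sub (card_imset _ (@perm_inj _ s)) leqnn.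
  case/subsetPn => _ /imsetP[a aA ->] nsa; exists (s a); last by rewrite permK.
  have : s a \in A :|: B by rewrite (perm_closed _ sX) inE aA.
  by rewrite inE (negPf nsa).
have : 0 < \sum_b d b.
  rewrite (bigD1 b) //=; apply: ltr_pwDl; last by apply: sumr_ge0.
  have [_ _ tb] := HB b bB; rewrite /d (cA _ sbA) (cB _ bB).
  by rewrite nmulr_rgt0 subr_lt0 ltz_nat.
by rewrite -dE subr_gt0 ltz_nat.
Qed.

(** Each violated inequality is traded for fillings of larger potential, which is bounded because
    fillings are finitely many. The vectors are abstract so that the argument serves for
    polytabloids, for the averages w_T and for vectors of an arbitrary irreducible module. *)
Lemma straightening (S : {vspace V}) :
  (forall T, P T -> row_weak T -> col_strict T -> v T \in S) ->
  forall T, P T -> v T \in S.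
Proof.
move=> HS; pose K := (\max_T weight_sum posw T).+1.
have pK T : (weight_sum posw T < K)%N by rewrite ltnS leq_bigmax.
(* [K] exceeds every value of the second potential, so that [mu] compares the two
   lexicographically. *)
pose mu T := (weight_sum colw T * K + weight_sum posw T)%N.
pose M := (\max_T mu T)%N.
have muM T : (mu T <= M)%N by rewrite leq_bigmax.
move=> T; have [m] := ubnP (M - mu T)%N; elim: m T => // m IHm T mT PT.
have step T' : P T' -> (mu T < mu T')%N -> v T' \in S.
  by move=> PT' lt; apply: IHm => //; have := muM T'; lia.
have posK T' : weight_sum colw T' = weight_sum colw T ->
    (weight_sum posw T < weight_sum posw T')%N -> (mu T < mu T')%N.
  by rewrite /mu => ->; rewrite ltn_add2l.
have colK T' : (weight_sum colw T < weight_sum colw T')%N -> (mu T < mu T')%N.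
  move=> lt; rewrite /mu; apply: (@leq_trans (weight_sum colw T * K + K)%N).
    by rewrite ltn_add2l.
  by rewrite addnC -mulSn; apply: leq_trans (leq_addr _ _); rewrite leq_mul2r lt orbT.
have tperm_up b b' : up b = up b' -> forall c, up (tperm b b' c) = up c.
  by move=> bb c; case: tpermP => // ->.
have [/existsP[b /existsP[b' /and4P[nb nb' cb rb]]]|row0S] := boolP [exists b, exists b',
   [&& ~~ up b, ~~ up b', (box_col b < box_col b')%N & (rk (T b') < rk (T b))%N]].
  have bb' : up b = up b' by rewrite (negPf nb) (negPf nb').
  rewrite -(v_row0 (s := tperm b b')) //; last first.
    by move=> c uc; rewrite tpermD //; apply: contraTneq uc => <-.
  apply: step; first by apply: P_perm => //; exact: tperm_up.
  apply: posK.
    by apply: weight_sum_inv => c; rewrite /colw tperm_up //; case: tpermP => // ->;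
       rewrite ?(negPf nb) ?(negPf nb').
  by apply: weight_sum_tperm; rewrite // /posw (negPf nb) (negPf nb').
have [/existsP[b /existsP[b' /and5P[ub ub' /eqP cb rb lt]]]|colS] := boolP [exists b, exists b',
   [&& up b, up b', box_col b == box_col b', (box_row b < box_row b')%N & (rk (T b') <= rk (T b))%N]].
  have sC := column_group_tperm ub ub' cb.
  have nbb : b != b' by apply: contraTneq rb => ->; rewrite ltnn.
  have vE := v_col PT sC; rewrite odd_tperm nbb scaleN1r in vE.
  (* With equal entries the exchange fixes the filling and changes the sign, so [v T] vanishes. *)
  have [eqr|] := eqVneq (rk (T b')) (rk (T b)).
    have TE : refill T (tperm b b') = T.
      by apply/ffunP => c; rewrite ffunE; case: tpermP => // ->; rewrite (rk_inj eqr).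
    move/eqP: vE; rewrite TE -subr_eq0 opprK -mulr2n -scaler_nat scaler_eq0 (negPf (char0 1)).
    by move=> /eqP->; exact: mem0v.
  move=> neq; rewrite -memvN -vE; apply: step.
    by apply: P_perm => //; apply: tperm_up; rewrite ub ub'.
  apply: posK.
    by apply: weight_sum_inv => c; rewrite /colw tperm_up ?ub ?ub' //; case: tpermP => // ->; rewrite cb.
  by apply: weight_sum_tperm; rewrite ?/posw ?ub ?ub' // ltn_neqAle neq.
have colT : col_strict T.
  move=> b b' ub ub' cb rb; rewrite ltnNge; apply/negP => le; case/negP: colS.
  by apply/existsP; exists b; apply/existsP; exists b'; rewrite ub ub' cb eqxx rb.
have [/existsP[b /existsP[b' /and5P[ub ub' /eqP rb cb lt]]]|rowS] := boolP [exists b, exists b',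
   [&& up b, up b', box_row b == box_row b', (box_col b < box_col b')%N & (rk (T b') < rk (T b))%N]];
  last first.
  apply: HS => // b b' rb cb; rewrite leqNgt; apply/negP => lt.
  have uu : up b = up b' by rewrite /up rb.
  have [ub|nub] := boolP (up b).
    case/negP: rowS; apply/existsP; exists b; apply/existsP; exists b'.
    by rewrite -uu ub rb eqxx cb.
  by case/negP: row0S; apply/existsP; exists b; apply/existsP; exists b'; rewrite -uu nub cb.
(* The Garnir sets of a descent from [b] to [b']: entries of [A] are at least that of [b], entries
   of [B] are smaller. The boxes under [b] in its column inject into [B] without [b'], so [A] and
   [B] together outnumber that column. *)
pose A := [set c : box l | [&& up c, box_col c == box_col b & (box_row b <= box_row c)%N]].
pose B := [set c : box l | [&& up c, box_col c == box_col b' & (box_row c <= box_row b')%N]].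
have HA c : c \in A -> [/\ up c, box_col c = box_col b & (rk (T b) <= rk (T c))%N].
  rewrite inE => /and3P[uc /eqP cc]; rewrite leq_eqVlt => /orP[/eqP rc|rc]; split=> //.
    by rewrite (_ : b = c) //; apply: box_eq => //; apply: val_inj.
  by apply/ltnW/colT.
have HB c : c \in B -> [/\ up c, box_col c = box_col b' & (rk (T c) < rk (T b))%N].
  rewrite inE => /and3P[uc /eqP cc]; rewrite leq_eqVlt => /orP[/eqP rc|rc]; split=> //.
    by rewrite (_ : c = b') //; apply: box_eq => //; apply: val_inj.
  by apply: ltn_trans lt; apply: colT.
have dAB : [disjoint A & B].
  apply/pred0P => c /=; apply/negP => /andP[/HA[_ ca _] /HB[_ cb' _]].
  by move: cb; rewrite -ca -cb' ltnn.
have := v_garnir (A := A :|: B) PT cb.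
case/(_ _ _)/wrap.
- by move=> c; rewrite inE => /orP[/HA|/HB] [-> -> _]; split=> //; [left|right].
- have -> : #|A :|: B| = (#|A| + #|B|)%N by rewrite cardsU disjoint_setI0 // cards0 subn0.
  pose C := [set c : box l | [&& up c, box_col c == box_col b & (box_row c < box_row b)%N]].
  have -> : [set c : box l | up c & box_col c == box_col b] = A :|: C.
    by apply/setP => c; rewrite !inE -!andb_orr; case: leqP; rewrite ?andbT.
  apply: leq_ltn_trans (leq_card_setU _ _) _; rewrite ltn_add2l.
  have mk c : exists c', (c \in C) ==> ((box_row c' == box_row c) && (box_col c' == box_col b')).
    have [|] := boolP (c \in C); last by exists c.
    rewrite inE => /and3P[uc _ rc]; have [||c' [rc' cc']] := @box_at b' (box_row c) (box_col b').
    - by rewrite -rb ltnW.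
    - by [].
    by exists c'; rewrite cc' eqxx andbT; apply/eqP/val_inj.
  pose f c := xchoose (mk c).
  have fE c : c \in C -> box_row (f c) = box_row c /\ box_col (f c) = box_col b'.
    by move=> cC; have /implyP/(_ cC)/andP[/eqP ? /eqP ?] := xchooseP (mk c).
  rewrite -(@card_in_imset _ _ f) => [|c c' cC cC' ff]; last first.
    have [[rc _] [rc' _]] := (fE c cC, fE c' cC').
    apply: box_eq; first by rewrite -rc -rc' ff.
    by move: cC cC'; rewrite !inE => /and3P[_ /eqP-> _] /and3P[_ /eqP-> _].
  apply: proper_card; apply/properP; split.
    apply/subsetP => _ /imsetP[c cC ->]; have [rc cc] := fE c cC.
    rewrite inE cc eqxx /up rc; move: cC; rewrite inE -rb => /and3P[uc _ /ltnW->].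
    by rewrite -/(up c) uc.
  exists b'; first by rewrite inE ub' eqxx leqnn.
  apply/negP => /imsetP[c cC bE]; have [rc _] := fE c cC.
  by move: cC; rewrite inE -rc -bE rb ltnn !andbF.
(* The sum runs over all permutations of the union rather than over coset representatives. Those
   preserving [A] also preserve [B], act inside columns and contribute [v T] each; their number is
   invertible, and all others raise the potential. *)
rewrite (bigID (fun s : {perm box l} => s @: A == A)) /=.
set N := \sum_(s | _ && _) _; move=> /eqP; rewrite addr_eq0 => /eqP.
have -> : N = #|[pred s : {perm box l} | perm_on (A :|: B) s && (s @: A == A)]|%:R *: v T.
  rewrite scaler_nat -sumr_const; apply: eq_bigr => s /andP[sX /eqP sA].
  have sAE c : (s c \in A) = (c \in A) by rewrite -{1}sA mem_imset //; apply: perm_inj.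
  rewrite v_col ?scalerA -?signr_addb ?addbb ?scale1r // inE; apply/forallP => c.
  have [cX|cX] := boolP (c \in A :|: B); last by rewrite (out_perm sX cX) !eqxx implybT.
  have scX : s c \in A :|: B by rewrite (perm_closed _ sX).
  have uc : up c by move: cX; rewrite inE => /orP[/HA[]|/HB[]].
  rewrite [X in X ==> _](_ : _ = false); last by rewrite eqn0Ngt -/(up c) uc.
  rewrite andbT; have [cA|cA] := boolP (c \in A).
    have := cA; rewrite -sAE => sc; have [_ -> _] := HA _ sc.
    by have [_ -> _] := HA _ cA.
  have /HB[_ -> _] : c \in B by move: cX; rewrite inE (negPf cA).
  by have /HB[_ -> _] : s c \in B by move: scX; rewrite inE sAE (negPf cA).
move=> E; have {E} : #|[pred s : {perm box l} | perm_on (A :|: B) s && (s @: A == A)]|%:R *: v T \in S.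
  rewrite E memvN; apply: memv_suml => s /andP[sX sA]; apply: memvZ.
  apply: step; last by apply: colK; apply: garnir_increase HA HB sX sA.
  apply: P_perm => // c; have [cX|cX] := boolP (c \in A :|: B); last by rewrite (out_perm sX cX).
  have scX : s c \in A :|: B by rewrite (perm_closed _ sX).
  have -> : up c by move: cX; rewrite inE => /orP[/HA[]|/HB[]].
  by move: scX; rewrite inE => /orP[/HA[]|/HB[]].
rewrite rpredZeq; case/orP=> // /eqP N0; exfalso; move: N0.
set C := [pred s : {perm box l} | _]; have : (0 < #|C|)%N.
  by apply/card_gt0P; exists 1%g; rewrite inE perm_on1 /= imset_perm1 eqxx.
by case: #|C| => // q _; apply/eqP.
Qed.

End Straightening.

(** * The last-letter order as a numerical rank *)

Section LastLetterOrder.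

Lemma last_letter_irr s : last_letter_lt s s = false.
Proof. by elim: s => //= x s ->; rewrite ltnn eqxx. Qed.

Lemma last_letter_trans : transitive last_letter_lt.
Proof.
move=> t s u; elim: t s u => [|y t IHt] [|x s] [|z u] //=.
case/orP=> [xy|/andP[/eqP-> st]] /orP[yz|/andP[/eqP yz tu]].
- by rewrite (ltn_trans xy yz).
- by rewrite -yz xy.
- by rewrite yz.
by rewrite yz eqxx (IHt _ _ st tu) orbT.
Qed.

Lemma last_letter_total s t : s != t -> last_letter_lt s t || last_letter_lt t s.
Proof.
elim: s t => [|x s IHs] [|y t] //=; rewrite eqseq_cons negb_and.
by case: (ltngtP x y) => //= _ /IHs.
Qed.

Variables (X : finType) (w : X -> seq nat).
Hypothesis w_inj : injective w.

(** Numbering words by how many precede them replaces the order by natural numbers, which the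
    potentials require. *)
Definition word_rank (x : X) : nat := #|[pred y | last_letter_lt (w y) (w x)]|.

Lemma word_rank_lt x y : (word_rank x < word_rank y)%N = last_letter_lt (w x) (w y).
Proof.
have mono x' y' : last_letter_lt (w x') (w y') -> (word_rank x' < word_rank y')%N.
  move=> xy; apply: proper_card; apply/properP; split.
    by apply/subsetP => z; rewrite !inE => /last_letter_trans; apply.
  by exists x'; rewrite !inE // last_letter_irr.
apply/idP/idP => [lt|]; last exact: mono.
have nxy : w x != w y by apply: contraTneq lt => /w_inj->; rewrite ltnn.
by have /orP[//|/mono] := last_letter_total nxy; rewrite ltnNge ltnW.
Qed.

Lemma word_rank_inj : injective word_rank.
Proof.
move=> x y xy; apply/w_inj/eqP; apply: contraT => /last_letter_total.
by rewrite -!word_rank_lt xy ltnn.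
Qed.

Lemma word_rank_le x y : (word_rank x <= word_rank y)%N = (w x == w y) || last_letter_lt (w x) (w y).
Proof.
rewrite leq_eqVlt word_rank_lt; congr (_ || _); apply/eqP/eqP; last by move/w_inj->.
by move/word_rank_inj->.
Qed.

Lemma semistandardP l (T : {ffun box l -> X}) :
  reflect (row_weak word_rank T /\ forall b b', box_col b = box_col b' ->
     (box_row b < box_row b')%N -> (word_rank (T b) < word_rank (T b'))%N)
   (semistandard (fun b => w (T b))).
Proof.
apply: (iffP forallP) => [H|[H1 H2] b]; last first.
  apply/forallP => b'; apply/andP; split; apply/implyP => /andP[/eqP E lt].
    by rewrite -word_rank_le; apply: H1.
  by rewrite -word_rank_lt; apply: H2.
split=> b b' E lt; have /forallP/(_ b')/andP[/implyP H1 /implyP H2] := H b.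
  by rewrite word_rank_le; apply: H1; rewrite E eqxx.
by rewrite word_rank_lt; apply: H2; rewrite E eqxx.
Qed.

End LastLetterOrder.

Lemma set_word_inj r : injective (@set_word r).
Proof.
move=> A B AB; apply/setP => i.
have E (C : {set 'I_r}) : (i \in C) = (val i \in set_word C).
  by rewrite mem_rev (mem_map val_inj) mem_enum.
by rewrite (E A) AB -E.
Qed.

Lemma multiset_word_inj r k : injective (@multiset_word r k).
Proof.
have cE m j : count_mem (val j) (@multiset_word r k m) = m j.
  rewrite /multiset_word count_rev count_flatten -map_comp sumnE big_map.
  rewrite (bigD1_seq j) ?mem_enum ?enum_uniq //= count_nseq /= eqxx mul1n.
  rewrite big1 ?addn0 // => i /negPf ij; rewrite count_nseq /=.
  by rewrite (inj_eq val_inj) ij.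
by move=> m m' E; apply/ffunP => j; apply: val_inj; rewrite /= -!cE E.
Qed.

Lemma set_word_nil r (A : {set 'I_r}) : (set_word A == [::]) = (A == set0).
Proof.
rewrite -size_eq0 size_rev size_map -cardE; exact: cards_eq0.
Qed.

Lemma multiset_word_nil r k (m : multiset r k) : (multiset_word m == [::]) = (msize m == 0%N).
Proof.
rewrite -size_eq0 size_rev size_flatten /shape -map_comp sumnE big_map enumT /=.
by congr (_ == _); apply: eq_bigr => j _; rewrite size_nseq.
Qed.

(** * Shapes of size n and the empty boxes of their first row *)

Section Shapes.
Variables (n r : nat) (l : seq nat).
Hypotheses (r_gt0 : (0 < r)%N) (le2rn : (2 * r <= n)%N) (ln : partition_of n l).

Lemma shape_sorted : sorted geq l. Proof. by case/and3P: ln. Qed.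

Lemma shape_size_gt0 : (0 < size l)%N.
Proof.
case/and3P: ln => _ _; case: l => //= /eqP n0.
by move: le2rn; rewrite -n0 leqn0 muln_eq0 /= eqn0Ngt r_gt0.
Qed.

Lemma card_box : #|box l| = n.
Proof.
case/and3P: ln => _ _ /eqP <-; rewrite card_tagged; congr sumn.
rewrite -[RHS](mkseq_nth 0%N); apply: (@eq_from_nth _ 0%N).
  by rewrite size_map -cardE card_ord size_mkseq.
move=> i; rewrite size_map -cardE card_ord => il.
by rewrite (nth_map (Ordinal il)) ?size_enum_ord // card_ord nth_mkseq // nth_enum_ord.
Qed.

Definition num_upper := #|[pred b : box l | up b]|.

Lemma card_first_row : (num_upper + nth 0 l 0 = n)%N.
Proof.
rewrite -card_box -(cardC [pred b : box l | up b]); congr addn.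
pose mk (j : 'I_(nth 0 l 0)) : box l :=
  @Tagged _ (Ordinal shape_size_gt0) (fun i : 'I_(size l) => 'I_(nth 0 l i)) j.
rewrite -[LHS]card_ord -(@card_imset _ _ mk); last first.
  by move=> j j' /eqP; rewrite eq_Tagged => /eqP.
apply: eq_card => b; apply/imsetP/idP => [[j _ ->]|]; first by [].
rewrite !inE /up -eqn0Ngt; case: b => i j; rewrite /box_row /= => /eqP i0.
have E : i = Ordinal shape_size_gt0 by apply: val_inj.
by move: j; rewrite E => j; exists j.
Qed.

Lemma num_upper_le_first_row : (num_upper <= r)%N -> (r <= nth 0 l 0)%N.
Proof. by have := card_first_row; move: le2rn; set a := nth _ _ _; lia. Qed.

(** If the first-row box under an upper box were nonempty, so would be those to its right, leaving
    at most [box_col b] empty boxes. But [box_col b] is smaller than the number of upper boxes,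
    hence than r, whereas at least n - r >= r boxes are empty. Strictness of columns thus only has
    to be checked above the first row. *)
Lemma first_row_empty (ne : pred (box l)) : (#|ne| <= r)%N ->
  (forall b, up b -> ne b) ->
  (forall b b' : box l, ~~ up b -> box_row b = box_row b' -> (box_col b < box_col b')%N -> ne b -> ne b') ->
  forall b b' : box l, ~~ up b -> up b' -> box_col b = box_col b' -> ~~ ne b.
Proof.
move=> ner neu ner0 b b' nub ub' cb; apply/negP => neb.
have le_up : (box_col b' < num_upper)%N.
  have ex (j : 'I_(box_col b').+1) : exists c : box l,
      (box_row c == box_row b') && (box_col c == j).
    have [||c [rc cc]] := @box_at l shape_sorted b' (box_row b') j; [by []|by case: j|].
    by exists c; rewrite cc eqxx andbT; apply/eqP/val_inj.
  pose f j := xchoose (ex j).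
  have fE j : box_row (f j) = box_row b' /\ box_col (f j) = j.
    by have /andP[/eqP ? /eqP ?] := xchooseP (ex j).
  rewrite -[X in (X <= _)%N]card_ord -(@card_imset _ _ f).
    by apply/subset_leq_card/subsetP => _ /imsetP[j _ ->]; rewrite inE /up (fE j).1.
  by move=> j j' ff; apply: val_inj; rewrite /= -(fE j).2 -(fE j').2 ff.
have le_ur : (num_upper <= r)%N.
  by apply: leq_trans ner; apply/subset_leq_card/subsetP => c; rewrite inE => /neu.
have : (#|[predC ne]| <= box_col b)%N.
  rewrite -[X in (_ <= X)%N]card_ord.
  have lt c : c \in [predC ne] -> (box_col c < box_col b)%N.
    rewrite inE ltnNge; apply: contra => le.
    have [/neu//|nuc] := boolP (up c).
    have rbc : box_row b = box_row c.
      by apply: val_inj => /=; move: nub nuc; rewrite /up -!eqn0Ngt => /eqP-> /eqP->.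
    move: le; rewrite leq_eqVlt => /orP[/eqP cbc|]; last by move/ner0; apply.
    by rewrite (box_eq (esym rbc) (esym cbc)).
  have [j0|j0] := posnP (box_col b).
    rewrite j0 card_ord leqn0; apply/eqP/eq_card0 => c; apply/negP => cN.
    by have := lt c (introN idP cN); rewrite j0.
  pose f (c : box l) : 'I_(box_col b) := insubd (Ordinal j0) (box_col c).
  rewrite -(@card_in_imset _ _ f) ?max_card // => c c' cN cN' /(congr1 val).
  rewrite !val_insubd !lt // => cc; apply: box_eq => //.
  have nu d : d \in [predC ne] -> box_row d = 0%N :> nat.
    by rewrite inE => nd; apply/eqP; rewrite eqn0Ngt; apply: contra nd; apply: neu.
  by apply: val_inj => /=; rewrite !nu.
have := cardC ne; rewrite card_box; move: ner le_ur le_up le2rn; rewrite cb.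
set x := #|_|; set y := #|_|; lia.
Qed.

End Shapes.

(** * Column permutations and the relations between polytabloids *)

Section ColumnGroup.
Variable l : seq nat.
Implicit Types (b : box l) (s t : {perm box l}).

Lemma column_groupP s : reflect (forall b, box_col (s b) = box_col b /\ (~~ up b -> s b = b))
  (s \in column_group l).
Proof.
rewrite inE; apply: (iffP forallP) => H b.
  have /andP[/eqP cb /implyP rb] := H b; split=> // nub; apply/eqP/rb.
  by rewrite eqn0Ngt.
have [-> rb] := H b; rewrite eqxx; apply/implyP; rewrite [_ == _]eqn0Ngt => /rb->.
by rewrite eqxx.
Qed.

Lemma column_group_up s b : s \in column_group l -> up (s b) = up b.
Proof.
move=> sC; rewrite /up !lt0n; congr negb; exact: column_group_first_row.
Qed.

Lemma column_group_set : group_set (column_group l).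
Proof.
apply/group_setP; split=> [|s t /column_groupP sC /column_groupP tC].
  by apply/column_groupP => b; rewrite perm1.
apply/column_groupP => b; have [[sc sr] [tc tr]] := (sC b, tC (s b)).
by rewrite permM tc sc; split=> // nub; rewrite sr // in tc tr *; rewrite tr.
Qed.

Definition column_grp : {group {perm box l}} := Group column_group_set.

Lemma column_groupV s : (s^-1%g \in column_group l) = (s \in column_group l).
Proof. exact: (@groupV _ column_grp). Qed.

Lemma column_groupM s t : s \in column_group l -> t \in column_group l ->
  (s * t)%g \in column_group l.
Proof. exact: (@groupM _ column_grp). Qed.

End ColumnGroup.

Section Polytabloids.
Variables (F : fieldType) (r : nat) (l : seq nat).
Hypothesis char0 : forall m : nat, m.+1%:R != 0 :> F.
Implicit Types (b : box l) (s : {perm box l}) (T : set_filling l r)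
  (beta : {ffun 'I_r -> box l}).
Local Notation v := (@polytabloid F r l).
Local Notation elt := (@tabloid_elt F r l).

Lemma polytabloidE T : v T = \sum_(s in column_group l) (-1) ^+ s *: elt (tabloid_of (refill T s)).
Proof. by []. Qed.

Lemma refillM T s t : refill (refill T s) t = refill T (t * s)%g.
Proof. by apply/ffunP => b; rewrite !ffunE permM. Qed.

Lemma polytabloid_col T s : s \in column_group l -> v (refill T s) = (-1) ^+ s *: v T.
Proof.
move=> sC; rewrite !polytabloidE scaler_sumr [RHS](reindex_inj (mulIg s)) /=.
apply: eq_big => t; first by rewrite (@groupMr _ (column_grp l)).
by move=> tC; rewrite refillM scalerA -signr_addb odd_permM addbCA addbb addbF.
Qed.

Lemma tabloid_row_perm T s : (forall b, box_row (s b) = box_row b) ->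
  tabloid_of (refill T s) = tabloid_of T.
Proof.
move=> sr; apply/ffunP => i; rewrite !ffunE; congr (_ :\ _); apply/setP => B.
apply/imsetP/imsetP => -[b]; rewrite inE => /eqP bi ->.
  by exists (s b); rewrite ?ffunE // inE sr bi.
by exists (s^-1 b)%g; rewrite ?ffunE ?permKV // inE -sr permKV bi.
Qed.

Lemma row0_perm_row s : (forall b, up b -> s b = b) -> forall b, box_row (s b) = box_row b.
Proof.
move=> su b; have [ub|nub] := boolP (up b); first by rewrite su.
have nus : ~~ up (s b).
  by apply: contra (nub) => usb; rewrite -(perm_inj (su _ usb)).
by apply: val_inj => /=; move: nub nus; rewrite /up -!eqn0Ngt => /eqP-> /eqP->.
Qed.

Lemma polytabloid_row0 T s : (forall b, up b -> s b = b) -> v (refill T s) = v T.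
Proof.
move=> su; rewrite !polytabloidE; apply: eq_bigr => t tC; congr (_ *: elt _).
rewrite refillM (_ : (t * s = s * t)%g) ?refillM -?refillM; last first.
  apply/permP => b; rewrite !permM; have [ub|nub] := boolP (up b).
    by rewrite su ?(su b) // column_group_up.
  have /column_groupP/(_ b)[_ ->] := tC; rewrite //.
  have /column_groupP/(_ (s b))[_ ->] := tC; rewrite //.
  by rewrite /up (row0_perm_row su).
by rewrite tabloid_row_perm //; apply: row0_perm_row.
Qed.

(** Pigeonhole: after undoing a column permutation, the boxes of [A] lie only in rows that meet
    column [j], and [A] is larger than that column above the first row, so two of them share a row.
    Exchanging these two changes the sign but not the tabloid. *)
Lemma polytabloid_garnir T (j j' : nat) (A : {set box l}) : (j < j')%N ->
  (forall b : box l, b \in A -> up b /\ (box_col b = j \/ box_col b = j')) ->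
  (#|[set b : box l | up b & box_col b == j]| < #|A|)%N ->
  \sum_(s | perm_on A s) (-1) ^+ s *: v (refill T s) = 0.
Proof.
move=> jj HA cA.
transitivity (\sum_(t in column_group l) \sum_(s | perm_on A s)
   (-1) ^+ t *: ((-1) ^+ s *: elt (tabloid_of (refill T (t * s)%g)))).
  rewrite exchange_big /=; apply: eq_bigr => s _; rewrite polytabloidE scaler_sumr.
  by apply: eq_bigr => t _; rewrite refillM !scalerA mulrC.
rewrite big1 // => t tC; rewrite -scaler_sumr.
have [b1 [b2 [nb rb s1 s2]]] : exists b1 b2,
    [/\ b1 != b2, box_row b1 = box_row b2, t b1 \in A & t b2 \in A].
  pose A' := t @^-1: A; pose C := [set b : box l | up b & box_col b == j].
  have cA' : (#|@box_row l @: A'| < #|A'|)%N.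
    have -> : #|A'| = #|A| by rewrite card_preimset //; apply: perm_inj.
    apply: leq_ltn_trans cA; apply: leq_trans (leq_imset_card (@box_row l) C).
    apply/subset_leq_card/subsetP => _ /imsetP[b bA ->].
    have [utb tb] : up (t b) /\ (box_col (t b) = j \/ box_col (t b) = j').
      by apply: HA; move: bA; rewrite inE.
    have ub : up b by rewrite -(column_group_up b tC).
    have le : (j <= box_col b)%N.
      by have /column_groupP/(_ b)[<- _] := tC; case: tb => ->; rewrite // ltnW.
    pose c : box l := @Tagged _ (box_row b) (fun i : 'I_(size l) => 'I_(nth 0 l i))
      (Ordinal (leq_ltn_trans le (ltn_ord (tagged b)))).
    by apply/imsetP; exists c; rewrite // inE /up eqxx andbT.
  suff /existsP[b1 /existsP[b2 /and4P[? /eqP ? ? ?]]] : [exists b1, exists b2,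
      [&& b1 != b2, box_row b1 == box_row b2, t b1 \in A & t b2 \in A]] by exists b1, b2.
  apply: contraTT cA' => H; rewrite -leqNgt card_in_imset // => b1 b2.
  rewrite !inE => s1 s2 rb; apply/eqP; apply: contraNT H => nb.
  by apply/existsP; exists b1; apply/existsP; exists b2; rewrite nb rb eqxx s1.
set S := \sum_(s | _) _; suff SN : S = - S.
  have : S *+ 2 = 0 by rewrite mulr2n {1}SN addNr.
  move/eqP; rewrite -scaler_nat scaler_eq0 (negPf (char0 1)) => /eqP->.
  by rewrite scaler0.
have ntb : t b1 != t b2 by rewrite (inj_eq perm_inj).
rewrite /S -sumrN [LHS](reindex_inj (mulgI (tperm (t b1) (t b2)))) /=; apply: eq_big => s.
  have tA : perm_on A (tperm (t b1) (t b2)).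
    apply/subsetP => b; rewrite inE; case: tpermP => [->|->|_ _]; rewrite ?eqxx //.
  apply/idP/idP => [sA|sA]; last exact: (perm_onM tA sA).
  by rewrite -(mulKg (tperm (t b1) (t b2)) s) tpermV; apply: perm_onM.
move=> _; rewrite odd_permM odd_tperm ntb signr_addb mulN1r scaleNr; congr (- (_ *: elt _)).
have -> : (t * (tperm (t b1) (t b2) * s) = tperm b1 b2 * (t * s))%g.
  rewrite !mulgA; congr (_ * s)%g; apply/permP => b; rewrite !permM.
  by rewrite (inj_tperm _ _ _ (@perm_inj _ t)).
rewrite -refillM tabloid_row_perm // => b.
by case: tpermP => // ->.
Qed.

Lemma SPT_refill T s : T \in SPT l r -> (forall b, up (s b) = up b) -> refill T s \in SPT l r.
Proof.
move=> /SPT_fib[beta ob ->] su; rewrite /refill fib_perm; apply: fib_SPT.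
apply/ontoP => b ub; have [|x xb] := (ontoP _ ob) (s b); first by rewrite su.
by exists x; rewrite ffunE xb permK.
Qed.

Lemma polytabloid_fib beta : v (fib beta) =
  \sum_(s in column_group l) (-1) ^+ s *: elt (tab [ffun x => s (beta x)]).
Proof.
rewrite polytabloidE (reindex_inj invg_inj) /=; apply: eq_big => s.
  exact: column_groupV.
by move=> _; rewrite odd_permV /refill fib_perm invgK.
Qed.

Lemma onto_perm beta s : s \in column_group l -> onto beta -> onto [ffun x => s (beta x)].
Proof.
move=> sC /ontoP ob; apply/ontoP => b ub; have [|x xb] := ob (s^-1 b)%g.
  by rewrite column_group_up ?column_groupV.
by exists x; rewrite ffunE xb permKV.
Qed.

Variable n : nat.
Hypotheses (r_gt0 : (0 < r)%N) (le2rn : (2 * r <= n)%N) (ln : partition_of n l).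

Lemma polytabloid_Pmod T : T \in SPT l r -> v T \in Pmod F r l.
Proof.
move: T; apply: (@straightening l (shape_sorted ln) F _ _ (word_rank (@set_word r))
  (word_rank_inj (@set_word_inj r)) char0 (fun T => T \in SPT l r) v).
- exact: SPT_refill.
- by move=> T s _; exact: polytabloid_row0.
- by move=> T s _; exact: polytabloid_col.
- by move=> T j j' A _; exact: polytabloid_garnir.
move=> T TS rT cT; apply: memv_span; apply/imageP; exists T => //.
rewrite inE TS; apply/(semistandardP (@set_word_inj r)); split=> // b b' cb rb.
have ub' : up b' by apply: leq_ltn_trans rb.
have [ub|nub] := boolP (up b); first exact: cT.
have [beta ob TE] := SPT_fib TS.
have neE c : (T c != set0) = (c \in [seq beta x | x : 'I_r]).
  rewrite TE; apply/set0Pn/imageP => [[x]|[x _ ->]]; last by exists x; rewrite fibE.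
  by rewrite fibE => /eqP <-; exists x.
have nlt c : last_letter_lt (set_word (T c)) [::] = false by case: set_word.
have ne0 (A B : {set 'I_r}) : (word_rank (@set_word r) A <= word_rank (@set_word r) B)%N ->
    A != set0 -> B != set0.
  rewrite word_rank_le; last exact: set_word_inj.
  move=> le; apply: contraNneq => B0; move: le; rewrite B0 -set_word_nil.
  have /eqP-> : set_word (set0 : {set 'I_r}) == [::] by rewrite set_word_nil.
  by case: (set_word A).
have Tb : T b = set0.
  apply/eqP/negPn; apply: (first_row_empty r_gt0 le2rn ln (ne := [pred c | T c != set0])) cb => //.
  - apply: leq_trans (_ : #|[seq beta x | x : 'I_r]| <= r)%N.
      by apply/subset_leq_card/subsetP => c; rewrite inE neE.
    by apply: leq_trans (card_size _) _; rewrite size_map -cardE card_ord.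
  - by move=> c uc; have [x <-] := (ontoP _ ob) c uc; rewrite /= neE image_f.
  by move=> c c' _ rc cc /=; apply: ne0; apply: rT.
rewrite word_rank_lt ?Tb; last exact: set_word_inj.
have /eqP-> : set_word (set0 : {set 'I_r}) == [::] by rewrite set_word_nil.
have : T b' != set0 by have [x <-] := (ontoP _ ob) b' ub'; rewrite neE image_f.
by rewrite -set_word_nil; case: set_word.
Qed.

Lemma Pmod_ind (Q : tabspace F r l -> Prop) :
  (forall c u w, Q u -> Q w -> Q (c *: u + w)) -> Q 0 ->
  (forall beta, onto beta -> Q (v (fib beta))) -> forall u, u \in Pmod F r l -> Q u.
Proof.
move=> Qlin Q0 Qv u /coord_span->; apply: (big_ind Q) => // [x y Qx Qy|i _].
  by rewrite -[x]scale1r; apply: Qlin.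
rewrite -[_ *: _]addr0; apply: Qlin => //.
set w := _`_i; have /imageP[T + ->] : w \in [seq v T | T in SSPT l r].
  by rewrite /w; case: i {w} => i /= il; apply: mem_nth; rewrite size_map -cardE.
by rewrite inE => /andP[/SPT_fib[beta ob ->] _]; apply: Qv.
Qed.

End Polytabloids.

(** * Gluing diagrams and the column antisymmetrizer *)

Section KernelDiagrams.
Variable r : nat.
Local Notation vertex := ('I_r + 'I_r)%type.

Definition kernel_sets (E : eqType) (d : vertex -> E) : {set {set vertex}} :=
  [set [set v | d v == d u] | u : vertex].

Lemma compat_kernel_sets (E Om : eqType) (d : vertex -> E) (h : vertex -> Om) :
  reflect (forall u v, d u = d v -> h u = h v) (compat (kernel_sets d) h).
Proof.
apply: (iffP forall_inP) => [H u v uv|H _ /imsetP[w _ ->]].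
  have /forall_inP/(_ u) := H _ (imset_f _ (isT : v \in predT)).
  by rewrite inE uv eqxx => /(_ isT)/forall_inP/(_ v); rewrite inE eqxx => /(_ isT)/eqP.
apply/forall_inP => u; rewrite inE => /eqP uw; apply/forall_inP => v.
by rewrite inE => /eqP vw; apply/eqP/H; rewrite uw vw.
Qed.

Variables M K : eqType.
Implicit Types beta gamma : 'I_r -> M + K.

(* Vertices carrying the same mark are joined across the two rows; unmarked
   blocks are kept apart. *)
Definition glue_label beta gamma (v : vertex) : M + (K + K) :=
  match v with
  | inl x => match beta x with inl m => inl m | inr k => inr (inl k) end
  | inr y => match gamma y with inl m => inl m | inr k => inr (inr k) end
  end.

Definition glue beta gamma : diagram r := diagram_of (kernel_sets (glue_label beta gamma)).

Lemma compat_glueP (Om : eqType) beta gamma (h : vertex -> Om) :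
  reflect (forall u v, glue_label beta gamma u = glue_label beta gamma v -> h u = h v)
          (compat (val (glue beta gamma)) h).
Proof. by rewrite compat_components; apply: compat_kernel_sets. Qed.

Lemma glue_topE beta gamma x y :
  glue_label beta gamma (inl x) = glue_label beta gamma (inl y) <-> beta x = beta y.
Proof.
rewrite /=; case: (beta x) (beta y) => [m|k] [m'|k'] //=.
- by split=> [[->]|[->]].
- by split=> [[->]|[->]].
Qed.

Lemma glue_botE beta gamma x y :
  glue_label beta gamma (inr x) = glue_label beta gamma (inr y) <-> gamma x = gamma y.
Proof.
rewrite /=; case: (gamma x) (gamma y) => [m|k] [m'|k'] //=.
- by split=> [[->]|[->]].
- by split=> [[->]|[->]].
Qed.

Lemma glue_crossE beta gamma x y :
  glue_label beta gamma (inl x) = glue_label beta gamma (inr y) <->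
  exists2 m, beta x = inl m & gamma y = inl m.
Proof.
rewrite /=; case: (beta x) (gamma y) => [m|k] [m'|k'] //=.
- by split=> [[->]|[m1 [->] [->]]] //; exists m'.
- by split=> // -[].
- by split=> // -[].
by split=> // -[].
Qed.

Lemma rho_glueP (Om : finType) beta gamma (f g : {ffun 'I_r -> Om}) :
  reflect [/\ forall x y, beta x = beta y -> f x = f y,
              forall x y, gamma x = gamma y -> g x = g y
            & forall x y m, beta x = inl m -> gamma y = inl m -> f x = g y]
          (rho (val (glue beta gamma)) f g).
Proof.
apply: (iffP (compat_glueP _ _ _)) => [H|[Hb Hg Hx] [x|x] [y|y]].
- split=> [x y xy|x y xy|x y m xm ym].
  + by have /= := H (inl x) (inl y); apply; apply/glue_topE.
  + by have /= := H (inr x) (inr y); apply; apply/glue_botE.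
  by have /= := H (inl x) (inr y); apply; apply/glue_crossE; exists m.
- by move/glue_topE/Hb.
- by move/glue_crossE=> [m]; apply: Hx.
- by move/esym/glue_crossE=> [m yx xm]; apply/esym; apply: (Hx _ _ m).
by move/glue_botE/Hg.
Qed.

Lemma rho_glue_sym (Om : finType) beta gamma (f g : {ffun 'I_r -> Om}) :
  rho (val (glue beta gamma)) f g = rho (val (glue gamma beta)) g f.
Proof.
by apply/rho_glueP/rho_glueP => -[H1 H2 H3]; split=> // x y m xm ym; apply/esym; apply: H3 xm.
Qed.

(** Blocks of [eta] lie inside classes of [gamma], so stacking them below the diagram creates no new
    connection. *)
Lemma aconn_glue l (eta : {ffun 'I_r -> box l}) beta gamma u v :
  (forall x y, eta x = eta y -> gamma x = gamma y) ->
  aconn (glue beta gamma) eta u v <-> glue_label beta gamma u = glue_label beta gamma v.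
Proof.
move=> eg; split=> [|uv].
  apply: hconn_compat; apply/acompatP; split; first by apply/compat_glueP.
  by move=> x y /eg xy; apply/glue_botE.
apply: (@hconn_edge _ _ [set w | hconn (kernel_sets (glue_label beta gamma)) u w]).
- by rewrite inE mem_components.
- by rewrite inE hconn_refl.
rewrite inE; apply: (@hconn_edge _ _ [set w | glue_label beta gamma w == glue_label beta gamma v]).
- exact: imset_f.
- by rewrite inE uv.
by rewrite inE.
Qed.

End KernelDiagrams.

(** * Glued diagrams as transition operators between polytabloids *)

Section NormalizedGluing.
Variables (F : fieldType) (r n : nat) (la : seq nat).
Hypothesis n0 : n%:R != 0 :> F.
Implicit Types (beta gamma : {ffun 'I_r -> box la}).

(** Upper boxes carry the marks that propagate; boxes of the first row merely tell the unmarked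
    blocks apart. *)
Definition mark (b : box la) : box la + box la := if up b then inl b else inr b.

Lemma mark_inj : injective mark.
Proof. by move=> b c; rewrite /mark; case: ifP => _; case: ifP => _ // []. Qed.

Lemma mark_inl b c : mark b = inl c <-> up b /\ b = c.
Proof.
by rewrite /mark; case: ifP => [ub|nub]; split; by [move=> [->]|move=> [_ ->]|move=> []|].
Qed.

Definition box_glue beta gamma : diagram r :=
  glue (fun x => mark (beta x)) (fun x => mark (gamma x)).

(* The normalization makes [glue_op beta gamma] send the polytabloid of [gamma]
   to that of [beta]. *)
Definition glue_op mu beta gamma (u : tabspace F r mu) : tabspace F r mu :=
  (n%:R ^+ act_exponent (box_glue beta gamma) (tab gamma))^-1
    *: partalg_act n (diag_elt F (val (box_glue beta gamma))) u.

Lemma blocks_kernel mu (eta : {ffun 'I_r -> box mu}) gamma :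
  (forall x y, eta x = eta y <-> gamma x = gamma y) -> blocks (tab eta) = blocks (tab gamma).
Proof.
move=> eg; have E x : fib eta (eta x) = fib gamma (gamma x).
  by apply/setP => y; rewrite !fibE; apply/eqP/eqP => /eg.
by apply/setP => B; apply/mem_blocks/mem_blocks => -[x ->]; exists x; rewrite E.
Qed.

Lemma glue_opE mu (eta eta' : {ffun 'I_r -> box mu}) beta gamma :
  onto eta -> onto eta' -> (forall x y, eta x = eta y <-> gamma x = gamma y) ->
  (forall x y, eta' x = eta' y <-> beta x = beta y) ->
  (forall x y, up (eta y) -> eta' x = eta y <-> up (beta x) /\ beta x = gamma y) ->
  glue_op beta gamma (polytabloid F (fib eta)) = polytabloid F (fib eta').
Proof.
move=> oe oe' eg eb ebg; rewrite /glue_op.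
have spec : act_spec (box_glue beta gamma) eta eta'.
  have aE u v := aconn_glue (fun x => mark (beta x)) u v
     (fun x y exy => congr1 mark ((eg x y).1 exy)).
  split=> [x y|x y uy].
    split=> [/eb xy|/aE/glue_topE/mark_inj/eb//].
    by apply/aE/glue_topE; rewrite xy.
  split=> [/(ebg x y uy)[ub xy]|/aE/glue_crossE[b /mark_inl[ub xb] /mark_inl[_ yb]]].
    by apply/aE/glue_crossE; exists (beta x); apply/mark_inl; rewrite // -xy.
  by apply/ebg; rewrite // yb.
rewrite (act_specE F n oe oe' spec) scalerA.
have -> : act_exponent (box_glue beta gamma) (tab eta) =
          act_exponent (box_glue beta gamma) (tab gamma).
  by rewrite /act_exponent /act_stack (blocks_kernel eg).
by rewrite mulVf ?scale1r // expf_neq0.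
Qed.

Lemma glue_op_self beta gamma : onto beta -> onto gamma ->
  glue_op beta gamma (polytabloid F (fib gamma)) = polytabloid F (fib beta).
Proof.
move=> ob og; apply: glue_opE => // x y uy.
by split=> [xy|[]//]; rewrite xy.
Qed.

Lemma glue_op_linear mu beta gamma c (u v : tabspace F r mu) :
  glue_op beta gamma (c *: u + v) = c *: glue_op beta gamma u + glue_op beta gamma v.
Proof. by rewrite /glue_op linearP scalerDr !scalerA mulrC. Qed.

Lemma glue_op0 mu beta gamma : glue_op beta gamma (0 : tabspace F r mu) = 0.
Proof. by rewrite /glue_op linear0 scaler0. Qed.

Lemma glue_opZ mu beta gamma c (u : tabspace F r mu) :
  glue_op beta gamma (c *: u) = c *: glue_op beta gamma u.
Proof. by have := glue_op_linear beta gamma c u 0; rewrite glue_op0 !addr0. Qed.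

End NormalizedGluing.

(** * Sorting columns and comparing shapes *)

Section ColumnSorting.
Variables (l : seq nat).
Hypothesis l_sorted : sorted geq l.

(* Among the column permutations, one maximizing [\sum row * psi] sorts the
   columns of [psi]; its values in a column are then positive and increasing. *)
Lemma column_sort (psi : box l -> nat) :
  (forall c, up c -> (0 < psi c)%N) ->
  (forall c c' : box l, up c -> up c' -> box_col c = box_col c' -> psi c = psi c' -> c = c') ->
  exists2 s, s \in column_group l & forall c, up c -> (box_row c <= psi (s c))%N.
Proof.
move=> psi0 psi_inj.
pose rw (c : box l) := if up c then nat_of_ord (box_row c) else 0%N.
pose W (s : {perm box l}) := (\sum_c rw c * psi (s c))%N.
have C1 : (1%g : {perm box l}) \in column_group l by exact: (group1 (column_grp l)).
case: (@arg_maxnP _ 1%g (mem (column_group l)) W C1) => s sC smax.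
exists s => //.
have /column_groupP sP := sC.
have incr c c' : up c -> up c' -> box_col c = box_col c' -> (box_row c < box_row c')%N ->
    (psi (s c) < psi (s c'))%N.
  move=> uc uc' cc rc; rewrite ltn_neqAle; apply/andP; split.
    apply/eqP => /psi_inj E; move: rc; rewrite (@perm_inj _ s c c') ?ltnn //.
    by apply: E; rewrite ?column_group_up // !(sP _).1.
  rewrite leqNgt; apply/negP => lt.
  have /smax : (tperm c c' * s)%g \in column_group l.
    by apply: column_groupM => //; apply: column_group_tperm.
  rewrite /geq /= leqNgt /W => /negP; apply.
  rewrite [X in (_ < X)%N](eq_bigr (fun d => rw d * (psi \o s) (tperm c c' d)))%N.
    by apply: (@sum_tperm_lt _ rw (psi \o s)); rewrite // /rw uc uc'.
  by move=> d _; rewrite permM.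
move=> c; have [m] := ubnP (box_row c); elim: m c => // m IHm c cm uc.
have [r1|r1] := leqP (box_row c) 1.
  by apply: leq_trans r1 _; apply: psi0; rewrite column_group_up.
have [||c' [rc' cc']] := @box_at l l_sorted c (box_row c).-1 (box_col c).
- exact: leq_pred.
- by [].
have lt : (box_row c' < box_row c)%N by rewrite rc' ltn_predL; apply: leq_trans r1.
have uc' : up c' by rewrite /up rc' -subn1 subn_gt0.
have le : (box_row c' <= psi (s c'))%N by apply: IHm; rewrite // (leq_trans lt).
apply: leq_trans (incr c' c uc' uc cc' lt); apply: leq_trans _ (_ : (box_row c').+1 <= _)%N.
  by rewrite rc' prednK //; apply: leq_trans r1.
by rewrite ltnS.
Qed.

End ColumnSorting.

(** The statistic n(lambda), the sum of (i - 1) lambda_i with rows numbered from 1; the first row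
    contributes nothing. It ranks the shapes that have equally many upper boxes. *)
Definition row_weight l := (\sum_(b : box l | up b) box_row b)%N.

Lemma card_row l (i : 'I_(size l)) : #|[set b : box l | box_row b == i]| = nth 0 l i.
Proof.
pose mk (j : 'I_(nth 0 l i)) : box l := @Tagged _ i (fun i : 'I_(size l) => 'I_(nth 0 l i)) j.
rewrite -[RHS]card_ord -(@card_imset _ _ mk); last first.
  by move=> j j' /eqP; rewrite eq_Tagged => /eqP.
apply: eq_card => -[i' j]; rewrite inE; apply/eqP/imsetP => [|[j' _ ->] //].
by rewrite /box_row /= => E; move: j; rewrite E => j; exists j.
Qed.

(** A bijection of upper boxes that preserves rows matches the row lengths above the first row; the
    first row is then determined by n. *)
Lemma shape_eq r n la mu (f : box la -> box mu) : (0 < r)%N -> (2 * r <= n)%N ->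
  partition_of n la -> partition_of n mu ->
  num_upper la = num_upper mu -> {in [pred b | up b] &, injective f} ->
  (forall b, up b -> box_row (f b) = box_row b :> nat) -> la = mu.
Proof.
move=> r_gt0 le2rn pla pmu nu fI fr.
have fu b : up b -> up (f b) by move=> ub; rewrite /up fr.
have fim : f @: [set b | up b] = [set b | up b].
  apply/eqP; rewrite eqEcard card_in_imset; last first.
    by move=> b c; rewrite !inE; apply: fI.
  have -> : #|[set b : box la | up b]| = num_upper la by rewrite cardsE.
  have -> : #|[set b : box mu | up b]| = num_upper mu by rewrite cardsE.
  by rewrite nu leqnn andbT; apply/subsetP => _ /imsetP[b ub ->]; rewrite !inE in ub *; apply: fu.
have rowE (l : seq nat) i : (0 < i)%N -> nth 0 l i = #|[set b : box l | up b & box_row b == i :> nat]|.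
  move=> i0; have [il|li] := ltnP i (size l).
    rewrite -(card_row (Ordinal il)); apply: eq_card => b; rewrite !inE /up.
    by rewrite -val_eqE /=; case: eqP => [->|]; rewrite ?i0 ?andbF.
  rewrite nth_default //; apply/esym/eq_card0 => b; rewrite !inE.
  by apply/negP => /andP[_ /eqP bi]; move: li; rewrite -bi leqNgt ltn_ord.
have nthE i : (0 < i)%N -> nth 0 la i = nth 0 mu i.
  move=> i0; rewrite !rowE // -(@card_in_imset _ _ f); last first.
    by move=> b c; rewrite !inE => /andP[ub _] /andP[uc _]; apply: fI.
  apply: eq_card => b; rewrite inE; apply/imsetP/andP => [[c]|[ub rb]].
    by rewrite inE => /andP[uc /eqP rc] ->; rewrite fu // fr // rc.
  have : b \in f @: [set b | up b] by rewrite fim inE.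
  case/imsetP => c; rewrite inE => uc E; exists c => //.
  by rewrite inE uc -fr // -E.
have nth0E : nth 0 la 0 = nth 0 mu 0.
  apply: (@addnI (num_upper la)); by rewrite [in RHS]nu
    (card_first_row r_gt0 le2rn pla) (card_first_row r_gt0 le2rn pmu).
have nthA i : nth 0 la i = nth 0 mu i by case: i => [|i]; [exact: nth0E | exact: nthE].
have pos (l : seq nat) i : partition_of n l -> (i < size l)%N -> nth 0 l i != 0.
  by case/and3P=> _ l0 _ il; apply: contraNneq l0 => E; have := mem_nth 0%N il; rewrite [nth _ _ _]E.
apply: (@eq_from_nth _ 0) => [|i _]; last exact: nthA.
apply/eqP; rewrite eqn_leq; apply/andP; split; rewrite leqNgt; apply/negP.
  by move/(pos _ _ pla); rewrite nthA nth_default ?eqxx.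
by move/(pos _ _ pmu); rewrite -nthA nth_default ?eqxx.
Qed.

(** The labelling on which the symmetrizer is built. The first r boxes needed are reached in order
    and surplus vertices join the block of the first upper box, so nothing is left for the first
    row; with no upper box at all, a single block remains there. *)
Lemma minimal_tableau r l : (0 < r)%N -> (0 < size l)%N -> (0 < nth 0 l 0)%N ->
  (num_upper l <= r)%N -> exists beta : {ffun 'I_r -> box l}, [/\ onto beta,
    (0 < num_upper l)%N -> forall x, up (beta x) &
    num_upper l = 0 -> forall x y, beta x = beta y].
Proof.
move=> r_gt0 l0 l00 le_mr; have [m0|m0] := posnP (num_upper l).
  pose b0 : box l := @Tagged _ (Ordinal l0) (fun i : 'I_(size l) => 'I_(nth 0 l i)) (Ordinal l00).
  exists [ffun=> b0]; split=> [|//|_ x y]; last by rewrite !ffunE.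
  by apply/ontoP => b ub; have := card0_eq m0 b; rewrite inE ub.
pose U := [pred b : box l | up b]; have mU : #|U| = num_upper l by [].
pose beta := [ffun x : 'I_r => enum_val (A := U) (insubd (Ordinal m0) (val x))].
exists beta; split=> [|_ x|]; last by move=> m1; move: (m0); rewrite m1.
  apply/ontoP => b ub; have bU : b \in U by [].
  have lt := ltn_ord (enum_rank_in bU b).
  exists (Ordinal (leq_trans lt le_mr)); rewrite ffunE.
  rewrite (_ : insubd _ _ = enum_rank_in bU b) ?enum_rankK_in //.
  by apply: val_inj; rewrite val_insubd /= lt.
by rewrite ffunE; have := enum_valP (A := U) (insubd (Ordinal m0) (val x)).
Qed.

(** * The module axioms on the span of the polytabloids *)

Section PartitionModuleFacts.
Variables (F : numClosedFieldType) (r n : nat) (l : seq nat).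
Hypotheses (r_gt0 : (0 < r)%N) (le2rn : (2 * r <= n)%N) (ln : partition_of n l).
Hypothesis le_mr : (num_upper l <= r)%N.
Local Notation act := (@partalg_act F r n l).
Local Notation Pmod := (Pmod F r l).
Implicit Types (beta : {ffun 'I_r -> box l}) (x y : partalg r F) (u : tabspace F r l).

Lemma char0F m : m.+1%:R != 0 :> F. Proof. by rewrite pnatr_eq0. Qed.

Lemma first_row_ge : (r <= nth 0 l 0)%N.
Proof. exact: (num_upper_le_first_row r_gt0 le2rn ln). Qed.

Let l_gt0 := shape_size_gt0 r_gt0 le2rn ln.

Definition tvec beta : tabspace F r l := polytabloid F (fib beta).

Lemma legit_tvec beta : onto beta -> legit (tvec beta).
Proof.
move=> ob; rewrite /tvec polytabloid_fib; apply: legit_sum => s sC.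
by apply: legitZ; apply: legit_elt; apply: onto_perm.
Qed.

Lemma tvec_Pmod beta : onto beta -> tvec beta \in Pmod.
Proof. by move=> ob; exact: (polytabloid_Pmod char0F r_gt0 le2rn ln (fib_SPT ob)). Qed.

Lemma Pmod_legit u : u \in Pmod -> legit u.
Proof.
move: u; apply: Pmod_ind; [exact: legit_lin | exact: legit0 | exact: legit_tvec].
Qed.

Lemma act_linl (c : F) x y u : act (c *: x + y) u = c *: act x u + act y u.
Proof.
rewrite /partalg_act scaler_sumr -big_split; apply: eq_bigr => p _.
rewrite scaler_sumr -big_split; apply: eq_bigr => t _ /=.
by rewrite !ffunE mulrDl scalerDl -mulrA -scalerA.
Qed.

Lemma act_linr (c : F) x u w : act x (c *: u + w) = c *: act x u + act x w.
Proof. exact: linearP. Qed.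

Lemma act0r x : act x 0 = 0.
Proof. exact: linear0. Qed.

Lemma actZr (c : F) x u : act x (c *: u) = c *: act x u.
Proof. exact: linearZ. Qed.

Lemma act_sumr (I : Type) (s : seq I) (P : pred I) (G : I -> tabspace F r l) x :
  act x (\sum_(i <- s | P i) G i) = \sum_(i <- s | P i) act x (G i).
Proof. exact: linear_sum. Qed.

Lemma act_suml (I : Type) (s : seq I) (P : pred I) (G : I -> partalg r F) u :
  act (\sum_(i <- s | P i) G i) u = \sum_(i <- s | P i) act (G i) u.
Proof.
apply: (big_morph (act^~ u)) => [x y|]; first by have := act_linl 1 x y u; rewrite !scale1r.
by have := act_linl (-1) 0 0 u; rewrite scaler0 addr0 scaleN1r addNr.
Qed.

Lemma actZl (c : F) x u : act (c *: x) u = c *: act x u.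
Proof.
have := act_linl c x 0 u; rewrite addr0 => ->.
by have := act_suml [::] xpredT (fun i : nat => 0) u; rewrite !big_nil => ->; rewrite addr0.
Qed.

Lemma act_diag x u : act x u = \sum_p x p *: act (diag_elt F (val p)) u.
Proof.
rewrite {1}[x]diag_decomposition act_suml.
by apply: eq_bigr => p _; rewrite actZl.
Qed.

Lemma diag_act_tvec p beta : onto beta ->
  (act (diag_elt F (val p)) (tvec beta) = 0 /\ ~~ act_nonzero p (tab beta)) \/
  exists2 beta', onto beta' /\ act_spec p beta beta' &
    act (diag_elt F (val p)) (tvec beta) = n%:R ^+ act_exponent p (tab beta) *: tvec beta'.
Proof.
move=> ob; have [nz|nz] := boolP (act_nonzero p (tab beta)); [right|left].
  have [beta' ob' s] := act_spec_exists l_gt0 first_row_ge ob nz.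
  by exists beta' => //; apply: act_specE.
by split=> //; apply: act_eq0.
Qed.

Lemma Pmod_act x u : u \in Pmod -> act x u \in Pmod.
Proof.
move=> uP; rewrite act_diag; apply: memv_suml => p _; apply: memvZ.
move: u uP; apply: Pmod_ind => [c u w uP wP||beta ob].
- by rewrite act_linr; apply: memvD => //; apply: memvZ.
- by rewrite act0r mem0v.
have [[-> _]|[beta' [ob' _] ->]] := diag_act_tvec p ob; first exact: mem0v.
by apply: memvZ; apply: tvec_Pmod.
Qed.

Lemma Pmod_act_mul x y u : u \in Pmod -> act (partalg_mul n x y) u = act x (act y u).
Proof.
by move=> /Pmod_legit; apply: act_mul => //; apply: first_row_ge.
Qed.

Lemma act_perm_tvec (s : 'S_r) beta : onto beta ->
  act (perm_elt F s) (tvec beta) = tvec [ffun i => beta (s^-1 i)%g].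
Proof.
move=> ob; rewrite /tvec !polytabloid_fib act_sumr; apply: eq_bigr => t tC.
rewrite actZr.
have E := act_perm_elt F r_gt0 le2rn le_mr l_gt0 first_row_ge s (onto_perm tC ob).
rewrite E; congr (_ *: tabloid_elt _ (tab _)); apply/ffunP => i; rewrite !ffunE.
by [].
Qed.

End PartitionModuleFacts.

Lemma scaler_swap (R : comPzRingType) (V : lmodType R) (a b : R) (u : V) :
  a *: (b *: u) = b *: (a *: u).
Proof. by rewrite !scalerA mulrC. Qed.

Lemma aconn_glue_label r (M K : eqType) (be ga : 'I_r -> M + K) l (eta : {ffun 'I_r -> box l}) u v :
  glue_label be ga u = glue_label be ga v -> aconn (glue be ga) eta u v.
Proof.
move=> uv; apply: (@hconn_edge _ _ [set w | hconn (kernel_sets (glue_label be ga)) u w]).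
- by rewrite inE mem_components.
- by rewrite inE hconn_refl.
rewrite inE; apply: (@hconn_edge _ _ [set w | glue_label be ga w == glue_label be ga v]).
- exact: imset_f.
- by rewrite inE uv.
by rewrite inE.
Qed.

(** * The symmetrizer of one shape acting on modules of other shapes *)

Section Symmetrizer.
Variables (F : numClosedFieldType) (r n : nat) (la : seq nat) (beta0 : {ffun 'I_r -> box la}).
Hypotheses (r_gt0 : (0 < r)%N) (le2rn : (2 * r <= n)%N) (pla : partition_of n la).
Hypotheses (ob0 : onto beta0)
  (up0 : (0 < num_upper la)%N -> forall x, up (beta0 x))
  (cst0 : num_upper la = 0%N -> forall x y, beta0 x = beta0 y).

Lemma n_neq0 : n%:R != 0 :> F.
Proof. by rewrite pnatr_eq0 -lt0n; apply: leq_trans le2rn; rewrite muln_gt0. Qed.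

Definition permute (s : {perm box la}) : {ffun 'I_r -> box la} := [ffun x => s (beta0 x)].

(* The column antisymmetrizer of [beta0], written with diagrams. *)
Definition zop mu (u : tabspace F r mu) : tabspace F r mu :=
  \sum_(s in column_group la) (-1) ^+ s *: glue_op n (permute s) beta0 (glue_op n beta0 beta0 u).

Lemma column_hit s x : s \in column_group la -> exists y, s (beta0 x) = beta0 y.
Proof.
move=> sC; have [ux|nux] := boolP (up (beta0 x)).
  have [|y yE] := (ontoP _ ob0) (s (beta0 x)); first by rewrite column_group_up.
  by exists y.
by exists x; have /column_groupP/(_ (beta0 x))[_ H] := sC; apply: H.
Qed.

Lemma no_upper (l : seq nat) (b : box l) : num_upper l = 0%N -> up b = false.
Proof. by move=> m0; have := card0_eq m0 b; rewrite inE. Qed.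

Section OneShape.
Variable mu : seq nat.
Hypotheses (pmu : partition_of n mu) (le_mu : (num_upper mu <= r)%N).

(** Stated on vertices, because the values of [th] at boxes not met by [beta0] are irrelevant. *)
Definition relabelling (th : box la -> box mu) : Prop :=
  (forall x y, th (beta0 x) = th (beta0 y) -> beta0 x = beta0 y) /\
  (forall x, up (th (beta0 x)) = up (beta0 x)).

Definition relabel (th : box la -> box mu) (s : {perm box la}) : {ffun 'I_r -> box mu} :=
  [ffun x => th (s (beta0 x))].

(** Blocks of the result are unions of blocks of [beta0], and upper ones contain upper ones only,
    since unmarked blocks do not reach the bottom. With [mu] having at least as many upper boxes as
    [la], counting forces equality and a one-to-one correspondence of the upper blocks. *)
Lemma glue_self_poly (eta : {ffun 'I_r -> box mu}) : onto eta ->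
  (num_upper la <= num_upper mu)%N ->
  glue_op n beta0 beta0 (tvec F eta) = 0 \/
  num_upper la = num_upper mu /\ exists c om, [/\ relabelling om, onto (relabel om 1%g) &
    glue_op n beta0 beta0 (tvec F eta) = c *: tvec F (relabel om 1%g)].
Proof.
move=> oe le_m; rewrite /glue_op.
have [[-> _]|[eta' [oe' [sA sB]] ->]] := diag_act_tvec F r_gt0 le2rn pmu le_mu (box_glue beta0 beta0) oe.
  by left; rewrite scaler0.
right.
have Ea x y : beta0 x = beta0 y -> eta' x = eta' y.
  by move=> xy; apply/sA/aconn_glue_label/glue_topE; rewrite xy.
have Eb x : up (eta' x) -> up (beta0 x).
  move=> ux; have [y yx] := (ontoP _ oe) _ ux; have uy : up (eta y) by rewrite yx.
  have /sB : eta' x = eta y by []; move/(_ uy) => xy; apply: contraT => nux.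
  (* The indicator of the unmarked top block of [x]; it is constant on components, as no bottom
     vertex carries its label. *)
  pose h (v : 'I_r + 'I_r) := if v is inl z then beta0 z == beta0 x else false.
  suff : h (inl x) = h (inr y) by rewrite /= eqxx.
  apply: hconn_compat xy; apply/acompatP; split=> //; apply/compat_glueP.
  have lx : mark (beta0 x) = inr (beta0 x) by rewrite /mark (negPf nux).
  have hE v : h v = (glue_label (fun x => mark (beta0 x)) (fun x => mark (beta0 x)) v == inr (inl (beta0 x))).
    case: v => z /=; rewrite /mark; case: ifP => uz //.
    by apply/negbTE/eqP => zx; rewrite -zx uz in nux.
  by move=> u v uv; rewrite !hE uv.
pose x0 := Ordinal r_gt0.
pose om b := if [pick x | beta0 x == b] is Some x then eta' x else eta' x0.
have omE x : om (beta0 x) = eta' x.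
  by rewrite /om; case: pickP => [y /eqP/Ea//|/(_ x)]; rewrite eqxx.
have relE : relabel om 1%g = eta' by apply/ffunP => x; rewrite ffunE perm1 omE.
suff [em rel] : num_upper la = num_upper mu /\ relabelling om.
  split=> //; rewrite -relE scalerA; move: (_ * _) => c; exists c, om; split=> //.
  by rewrite relE.
have [m0|m0] := posnP (num_upper la).
  have m0' : num_upper mu = 0%N.
    apply: eq_card0 => b; rewrite inE; apply/negP => ub.
    have [x xb] := (ontoP _ oe') b ub.
    by have := Eb x; rewrite xb => /(_ ub); rewrite no_upper.
  split; first by rewrite m0 m0'.
  by split=> [x y _|x]; [apply: cst0 | rewrite !no_upper].
have sub : [set b : box mu | up b] \subset om @: [set b | up b].
  apply/subsetP => b; rewrite inE => ub; have [x xb] := (ontoP _ oe') b ub.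
  by apply/imsetP; exists (beta0 x); rewrite ?inE ?omE ?up0.
have c1 : #|[set b : box mu | up b]| = num_upper mu by rewrite cardsE.
have c2 : #|[set b : box la | up b]| = num_upper la by rewrite cardsE.
have le1 := subset_leq_card sub; have le2 := leq_imset_card om (mem [set b : box la | up b]).
have em : num_upper la = num_upper mu.
  by apply/eqP; rewrite eqn_leq le_m /= -c1 -c2; exact: leq_trans le1 le2.
split=> //; have /imset_injP omI : #|om @: [set b | up b]| == #|[set b : box la | up b]|.
  by rewrite eqn_leq le2 c2 em -c1.
have imE : [set b : box mu | up b] = om @: [set b | up b].
  by apply/eqP; rewrite eqEcard sub c1 -em -c2.
split=> [x y|x]; first by apply: omI; rewrite inE up0.
have : om (beta0 x) \in om @: [set b | up b] by rewrite imset_f ?inE ?up0.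
by rewrite -imE inE up0 // => ->.
Qed.

Lemma relabel_kernel th s x y : relabelling th -> s \in column_group la ->
  relabel th s x = relabel th s y <-> beta0 x = beta0 y.
Proof.
move=> [thI _] sC; rewrite !ffunE; split=> [|->//].
have [[x' xE] [y' yE]] := (column_hit x sC, column_hit y sC).
by rewrite xE yE => /thI; rewrite -xE -yE => /perm_inj.
Qed.

Lemma relabel_up th s x : relabelling th -> s \in column_group la ->
  up (relabel th s x) = up (beta0 x).
Proof.
move=> [_ thU] sC; rewrite ffunE; have [x' xE] := column_hit x sC.
by rewrite xE thU -xE column_group_up.
Qed.

Lemma glue_relabel th s : relabelling th -> onto (relabel th 1%g) -> s \in column_group la ->
  glue_op n (permute s) beta0 (tvec F (relabel th 1%g)) = tvec F (relabel th s).
Proof.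
move=> rth oth sC; have C1 := group1 (column_grp la).
have hit x : exists x', s^-1%g (beta0 x) = beta0 x' by apply: column_hit; rewrite column_groupV.
apply: (glue_opE n_neq0) => // [|x y|x y|x y uy].
- apply/ontoP => b ub; have [x xb] := (ontoP _ oth) b ub.
  have [x' xE] := hit x; exists x'; rewrite ffunE -xE permKV.
  by rewrite -xb ffunE perm1.
- exact: relabel_kernel.
- rewrite relabel_kernel // !ffunE; split=> [->//|]; exact: perm_inj.
have uby : up (beta0 y) by rewrite -(relabel_up y rth C1).
have [x' xE] := column_hit x sC.
rewrite !ffunE perm1 xE; split=> [/rth.1 E|[_ ->//]]; by rewrite E.
Qed.

Definition signed_sum th : tabspace F r mu :=
  \sum_(s in column_group la) (-1) ^+ s *: tabloid_elt F (tab (relabel th s)).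

Lemma relabelling_perm th (s : {perm box mu}) : s \in column_group mu ->
  relabelling th -> relabelling (fun b => s (th b)).
Proof.
move=> sC [thI thU]; split=> [x y /perm_inj/thI//|x].
by rewrite column_group_up.
Qed.

(** Exchanging the two sums puts the column group of [la] inside, so that vanishing can be decided
    for each relabelling separately. *)
Lemma zop_poly eta : onto eta -> (num_upper la <= num_upper mu)%N ->
  zop (tvec F eta) = 0 \/
  num_upper la = num_upper mu /\ exists c om, relabelling om /\
    zop (tvec F eta) = c *: \sum_(s in column_group mu) (-1) ^+ s *: signed_sum (fun b => s (om b)).
Proof.
move=> oe le; have [E|[em [c [om [ro oo E]]]]] := glue_self_poly oe le.
  by left; rewrite /zop E big1 // => s _; rewrite glue_op0 scaler0.
right; split=> //; exists c, om; split=> //.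
rewrite /zop E scaler_sumr.
transitivity (\sum_(s in column_group la) c *: ((-1) ^+ s *: tvec F (relabel om s))).
  by apply: eq_bigr => s sC; rewrite glue_opZ (glue_relabel ro oo sC) scaler_swap.
rewrite -!scaler_sumr; congr (_ *: _).
transitivity (\sum_(s in column_group la) \sum_(t in column_group mu)
   (-1) ^+ t *: ((-1) ^+ s *: tabloid_elt F (tab (relabel (fun b => t (om b)) s)))).
  apply: eq_bigr => s _; rewrite /tvec polytabloid_fib scaler_sumr; apply: eq_bigr => t _.
  rewrite scaler_swap; congr (_ *: (_ *: tabloid_elt F (tab _))).
  by apply/ffunP => x; rewrite !ffunE.
rewrite exchange_big; apply: eq_bigr => t _.
by rewrite /signed_sum scaler_sumr.
Qed.

(** If two boxes of a column of [la] land in the same row of [mu], exchanging them changes the sign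
    but not the tabloid. Otherwise the landing rows in each column are distinct and positive, and
    sorting them makes the box of row i land in row i or higher: the dominance argument for Specht
    modules. *)
Lemma signed_sum_sort th : relabelling th ->
  signed_sum th = 0 \/ exists2 s, s \in column_group la &
    forall c, up c -> (box_row c <= box_row (th (s c)))%N.
Proof.
move=> rth; have [/existsP[c /existsP[c' /and5P[uc uc' /eqP cc nc /eqP rc]]]|inj] :=
  boolP [exists c, exists c', [&& up c, up c', box_col c == box_col c', c != c' &
     box_row (th c) == box_row (th c')]].
  left; have tC := column_group_tperm uc uc' cc.
  suff SN : signed_sum th = - signed_sum th.
    have : signed_sum th *+ 2 = 0 by rewrite mulr2n {1}SN addNr.
    by move/eqP; rewrite -scaler_nat scaler_eq0 pnatr_eq0 => /eqP.
  rewrite /signed_sum -sumrN [LHS](reindex_inj (mulIg (tperm c c'))) /=.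
  apply: eq_big => s; first by rewrite (@groupMr _ (column_grp la)).
  rewrite (@groupMr _ (column_grp la)) // => sC.
  rewrite odd_permM odd_tperm nc signr_addb mulrN1 scaleNr; congr (- (_ *: tabloid_elt F _)).
  apply/tabP; split=> [x|x y]; last by rewrite !relabel_kernel ?column_groupM.
  by rewrite !ffunE permM; case: tpermP => [->|->|].
right; apply: (@column_sort la (shape_sorted pla) (fun c => box_row (th c))) => [c uc|c c' uc uc' cc rc].
  by have [x xc] := (ontoP _ ob0) c uc; rewrite -xc -/(up _) rth.2 xc.
apply/eqP; apply: contraNT inj => nc; apply/existsP; exists c; apply/existsP; exists c'.
by rewrite uc uc' cc nc eqxx /=; apply/eqP/val_inj.
Qed.

Lemma relabel_row_weight th s : relabelling th -> num_upper la = num_upper mu ->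
  s \in column_group la ->
  [/\ {in [pred b | up b] &, injective (fun c => th (s c))} &
   (\sum_(c | up c) box_row (th (s c)) = row_weight mu)%N].
Proof.
move=> [thI thU] em sC.
have hit c : up c -> exists x, s c = beta0 x.
  by move=> uc; have [|x <-] := (ontoP _ ob0) (s c); [rewrite column_group_up | exists x].
have I : {in [pred b | up b] &, injective (fun c => th (s c))}.
  move=> c c'; rewrite !inE => uc uc'; have [[x xE] [x' xE']] := (hit c uc, hit c' uc').
  by rewrite /= xE xE' => /thI; rewrite -xE -xE' => /perm_inj.
split=> //.
have imE : (fun c => th (s c)) @: [set c | up c] = [set b | up b].
  apply/eqP; rewrite eqEcard card_in_imset; last by move=> c c'; rewrite !inE; apply: I.
  have -> : #|[set b : box la | up b]| = num_upper la by rewrite cardsE.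
  have -> : #|[set b : box mu | up b]| = num_upper mu by rewrite cardsE.
  rewrite em leqnn andbT; apply/subsetP => _ /imsetP[c uc ->]; rewrite !inE in uc *.
  by have [x xE] := hit c uc; rewrite xE thU -xE column_group_up.
transitivity (\sum_(b in [set b : box mu | up b]) box_row b)%N; last first.
  by apply: eq_bigl => b; rewrite inE.
rewrite -imE big_imset /=; last by move=> c c'; rewrite !inE; apply: I.
by apply: eq_bigl => c; rewrite inE.
Qed.

(** The landing rows add up to [row_weight mu], so the inequalities obtained by sorting must all be
    equalities. *)
Lemma signed_sum_rows th : relabelling th -> num_upper la = num_upper mu ->
  (row_weight mu <= row_weight la)%N ->
  signed_sum th = 0 \/ exists2 s, s \in column_group la &
    forall c, up c -> box_row (th (s c)) = box_row c :> nat.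
Proof.
move=> rth em le; have [->|[s sC srt]] := signed_sum_sort rth; [by left | right].
exists s => // c uc; have [_ E] := relabel_row_weight rth em sC.
have lif : forall c0 : box la, up c0 ->
    (box_row c0 <= box_row (th (s c0)) ?= iff (nat_of_ord (box_row c0) == box_row (th (s c0))))%N.
  by move=> d ud; apply/leqif_eq/srt.
have [_ /esym] := leqif_sum lif; rewrite E eqn_leq le andbT.
have -> : (\sum_(i : box la | up i) box_row i <= row_weight mu)%N.
  by rewrite -E; apply: leq_sum.
by move/forall_inP/(_ c uc)/eqP->.
Qed.

Lemma signed_sum_neq th : relabelling th -> num_upper la = num_upper mu ->
  (row_weight mu <= row_weight la)%N -> la != mu -> signed_sum th = 0.
Proof.
move=> rth em le; have [->//|[s sC srt]] := signed_sum_rows rth em le.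
have [I _] := relabel_row_weight rth em sC => /eqP[].
exact: (shape_eq r_gt0 le2rn pla pmu em I srt).
Qed.

End OneShape.
End Symmetrizer.

(** * Irreducibility of the modules of the partition algebra *)

Section SymmetrizerConsequences.
Variables (F : numClosedFieldType) (r n : nat) (la : seq nat) (beta0 : {ffun 'I_r -> box la}).
Hypotheses (r_gt0 : (0 < r)%N) (le2rn : (2 * r <= n)%N) (pla : partition_of n la).
Hypothesis le_la : (num_upper la <= r)%N.
Hypotheses (ob0 : onto beta0)
  (up0 : (0 < num_upper la)%N -> forall x, up (beta0 x))
  (cst0 : num_upper la = 0%N -> forall x y, beta0 x = beta0 y).

Let nF0 := n_neq0 F r_gt0 le2rn.
Local Notation Z := (zop n beta0).
Local Notation permute := (permute beta0).

(** For equal shapes the sorted relabelling preserves rows, so up to a sign the sum is the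
    polytabloid of [beta0]. *)
Lemma signed_sum_same th : relabelling (mu := la) beta0 th ->
  exists c, signed_sum F beta0 th = c *: tvec F beta0.
Proof.
move=> rth; have [->|[s sC srt]] :=
  signed_sum_rows F pla ob0 rth erefl (leqnn _).
  by exists 0; rewrite scale0r.
exists ((-1) ^+ s); rewrite /signed_sum /tvec polytabloid_fib scaler_sumr.
rewrite [LHS](reindex_inj (mulIg s)) /=; apply: eq_big => t.
  by rewrite (@groupMr _ (column_grp la)).
rewrite (@groupMr _ (column_grp la)) // => tC.
rewrite odd_permM addbC signr_addb -scalerA; congr (_ *: (_ *: tabloid_elt F _)).
have tsC : (t * s)%g \in column_group la by apply: column_groupM.
apply/tabP; split=> [x|x y]; last first.
  by rewrite (relabel_kernel ob0) // !ffunE; split=> [->//|/perm_inj].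
rewrite !ffunE permM; have [u|nu] := boolP (up (t (beta0 x))).
  by apply: val_inj; exact: srt.
have nux : ~~ up (beta0 x) by rewrite -(column_group_up _ tC).
have := relabel_up ob0 x rth tsC; rewrite !ffunE permM (negPf nux) => /negbT nu'.
by apply: val_inj => /=; move: nu nu'; rewrite /up -!eqn0Ngt => /eqP-> /eqP->.
Qed.

Lemma zop_linear mu c (u v : tabspace F r mu) : Z (c *: u + v) = c *: Z u + Z v.
Proof.
rewrite /zop scaler_sumr -big_split; apply: eq_bigr => s _ /=.
by rewrite !glue_op_linear scalerDr scaler_swap.
Qed.

Lemma zop0 mu : Z (0 : tabspace F r mu) = 0.
Proof. by rewrite /zop big1 // => s _; rewrite !glue_op0 scaler0. Qed.

Lemma zop_same u : u \in Pmod F r la -> exists c, Z u = c *: tvec F beta0.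
Proof.
move: u; apply: Pmod_ind => [c u w [a Ea] [b Eb]||eta oe].
- by exists (c * a + b); rewrite zop_linear Ea Eb scalerA scalerDl.
- by exists 0; rewrite zop0 scale0r.
have [E|[_ [c [om [ro E]]]]] := zop_poly F r_gt0 le2rn ob0 up0 cst0 pla le_la oe (leqnn _).
  by exists 0; rewrite /tvec in E *; rewrite E scale0r.
suff [a Ea] : exists a, \sum_(s in column_group la)
    (-1) ^+ s *: signed_sum F beta0 (fun b => s (om b)) = a *: tvec F beta0.
  by exists (c * a); rewrite -/(tvec F eta) E Ea scalerA.
apply: (big_ind (fun w => exists a, w = a *: tvec F beta0)).
- by exists 0; rewrite scale0r.
- by move=> _ _ [a ->] [a' ->]; exists (a + a'); rewrite scalerDl.
move=> s sC; have [a ->] := signed_sum_same (relabelling_perm sC ro).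
by exists ((-1) ^+ s * a); rewrite scalerA.
Qed.

Lemma zop_kill mu u : partition_of n mu -> (num_upper mu <= r)%N -> u \in Pmod F r mu ->
  (num_upper la < num_upper mu)%N \/
  [/\ num_upper la = num_upper mu, (row_weight mu <= row_weight la)%N & la != mu] ->
  Z u = 0.
Proof.
move=> pmu le_mu uP cond; move: u uP; apply: Pmod_ind => [c u w Eu Ew||eta oe].
- by rewrite zop_linear Eu Ew scaler0 addr0.
- exact: zop0.
have le : (num_upper la <= num_upper mu)%N by case: cond => [/ltnW//|[->]].
have [//|[em [c [om [ro E]]]]] := zop_poly F r_gt0 le2rn ob0 up0 cst0 pmu le_mu oe le.
case: cond => [|[_ rw ne]]; first by rewrite em ltnn.
rewrite -/(tvec F eta) E big1 ?scaler0 // => s sC.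
by rewrite (signed_sum_neq F r_gt0 le2rn pla ob0 pmu) ?scaler0 //; apply: relabelling_perm.
Qed.

(* [zop] is the action of an element of the partition algebra, on every module. *)
Definition zelt : partalg r F := \sum_(s in column_group la)
  ((-1) ^+ s * (n%:R ^+ act_exponent (box_glue (permute s) beta0) (tab beta0))^-1
    * (n%:R ^+ act_exponent (box_glue beta0 beta0) (tab beta0))^-1) *:
  partalg_mul n (diag_elt F (val (box_glue (permute s) beta0)))
                (diag_elt F (val (box_glue beta0 beta0))).

Lemma act_zelt mu u : partition_of n mu -> (num_upper mu <= r)%N -> u \in Pmod F r mu ->
  partalg_act n zelt u = Z u.
Proof.
move=> pmu le_mu uP; rewrite act_suml; apply: eq_bigr => s _.
rewrite actZl.
rewrite (Pmod_act_mul r_gt0 le2rn pmu le_mu _ _ uP).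
rewrite -2!scalerA.
rewrite /glue_op.
rewrite [X in _ = _ *: (_ *: X)]actZr.
reflexivity.
Qed.

Lemma tvec_generate (U : {vspace tabspace F r la}) :
  (forall x u, u \in U -> partalg_act n x u \in U) -> tvec F beta0 \in U ->
  (Pmod F r la <= U)%VS.
Proof.
move=> Ust U0; apply/subvP; apply: Pmod_ind => [c u w uU wU||beta ob].
- by apply: memvD => //; apply: memvZ.
- exact: mem0v.
rewrite -(glue_op_self nF0 ob ob0).
by apply: memvZ; apply: Ust.
Qed.

Local Notation frm := (form r_gt0 le2rn le_la).

Lemma form_linr (c : F) (u v v' : tabspace F r la) :
  frm u (c *: v + v') = c^* * frm u v + frm u v'.
Proof.
rewrite /form mulr_sumr -big_split; apply: eq_bigr => g _ /=.
by rewrite linearP /= rmorphD rmorphM mulrDr mulrCA.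
Qed.

Lemma form_adj_glue (beta gamma : {ffun 'I_r -> box la}) (u v : tabspace F r la) : legit u -> legit v ->
  frm (partalg_act n (diag_elt F (val (box_glue beta gamma))) u) v =
  frm u (partalg_act n (diag_elt F (val (box_glue gamma beta))) v).
Proof.
move=> lu lv; apply: form_adjoint => //.
- exact: shape_size_gt0 r_gt0 le2rn pla.
- exact: first_row_ge r_gt0 le2rn pla le_la.
by move=> f g; apply: rho_glue_sym.
Qed.

Let wP := tvec_Pmod F r_gt0 le2rn pla ob0.

(** The adjoint of each summand sends the vector of [beta0] to itself times a power of n and the
    sign of the permutation, which cancels the sign of the summand. The constant is a sum of
    positive terms, so the exponents need not be compared. *)
Lemma form_zop u : u \in Pmod F r la -> exists2 C : F, C != 0 &
  frm (tvec F beta0) (Z u) = C * frm (tvec F beta0) u.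
Proof.
move=> uP; have lP v : v \in Pmod F r la -> legit v by apply: Pmod_legit.
pose e s := act_exponent (box_glue (permute s) beta0) (tab beta0).
pose e1 := act_exponent (box_glue beta0 beta0) (tab beta0).
pose e' s := act_exponent (box_glue beta0 (permute s)) (tab (permute s)).
exists (\sum_(s in column_group la) (n%:R ^- e s * n%:R ^- e1 * n%:R ^+ e' s * n%:R ^+ e1)).
  have n_gt0 : 0 < n%:R :> F by rewrite lt0r nF0 ler0n.
  rewrite psumr_neq0 => [|s _]; last by rewrite !mulr_ge0 ?invr_ge0 ?exprn_ge0 ?ler0n.
  apply/hasP; exists 1%g; rewrite ?mem_index_enum // (group1 (column_grp la)) /=.
  by rewrite !mulr_gt0 ?invr_gt0 ?exprn_gt0.
rewrite mulr_suml; have fsum (I : finType) (P : pred I) (G : I -> tabspace F r la) :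
    frm (tvec F beta0) (\sum_(i | P i) G i) = \sum_(i | P i) frm (tvec F beta0) (G i).
  apply: (big_morph (frm (tvec F beta0))) => [x y|].
    by have := form_linr 1 (tvec F beta0) x y; rewrite scale1r rmorph1 mul1r.
  by rewrite /form big1 // => g _; rewrite linear0 rmorph0 mulr0.
have frmZ (c : F) v : frm (tvec F beta0) (c *: v) = c^* * frm (tvec F beta0) v.
  have := form_linr c (tvec F beta0) v 0; rewrite addr0 => ->.
  by rewrite [X in _ + X](_ : _ = 0) ?addr0 // /form big1 // => g _; rewrite linear0 rmorph0 mulr0.
rewrite /zop fsum; apply: eq_bigr => s sC.
have E2 : partalg_act n (diag_elt F (val (box_glue beta0 (permute s)))) (tvec F beta0) =
    (n%:R ^+ e' s * (-1) ^+ s) *: tvec F beta0.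
  have sVC : (s^-1)%g \in column_group la by rewrite column_groupV.
  have sE : tvec F (permute s^-1%g) = (-1) ^+ s *: tvec F beta0.
    rewrite /tvec -polytabloid_col // /refill fib_perm; congr (polytabloid F (fib _)).
  rewrite -scalerA -sE.
  have <- : glue_op n beta0 (permute s) (tvec F beta0) = tvec F (permute s^-1%g).
    apply: (glue_opE nF0) => //.
    - exact: onto_perm.
    - by move=> x y; rewrite !ffunE; split=> [->//|/perm_inj].
    - by move=> x y; rewrite !ffunE; split=> [/perm_inj|->].
    move=> x y uy; rewrite !ffunE; split=> [E|[ux ->]]; last by rewrite permK.
    have E' : beta0 x = s (beta0 y) by rewrite -E permKV.
    by rewrite E' column_group_up.
  by rewrite /glue_op scalerA mulfV ?scale1r // expf_neq0.
have E3 : partalg_act n (diag_elt F (val (box_glue beta0 beta0))) (tvec F beta0) = n%:R ^+ e1 *: tvec F beta0.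
  have E1 := glue_op_self nF0 ob0 ob0; rewrite -/(tvec F beta0) in E1.
  by rewrite -[in RHS]E1 /glue_op scalerA mulfV ?scale1r // expf_neq0.
have Zl (c : F) v v' : frm (c *: v) v' = c * frm v v'.
  have := form_linl r_gt0 le2rn le_la c v 0 v'; rewrite addr0 => ->.
  by rewrite [X in _ + X](_ : _ = 0) ?addr0 // /form big1 // => g _; rewrite linear0 mul0r.
have aP x v : v \in Pmod F r la -> partalg_act n x v \in Pmod F r la.
  exact: Pmod_act r_gt0 le2rn pla le_la x v.
have cs : ((-1) ^+ s)^* = (-1) ^+ s :> F by rewrite rmorph_sign.
have ce i : (n%:R ^- i)^* = n%:R ^- i :> F by rewrite fmorphV rmorphXn /= conjC_nat.
rewrite /glue_op -/(e s) -/e1; move: (e s) (e' s) e1 E2 E3 => i i' j E2 E3.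
rewrite !frmZ cs !ce -form_adj_glue; [|exact: lP|by apply/lP/memvZ/aP].
rewrite [X in frm X _]E2 Zl frmZ ce -form_adj_glue; [|exact: lP|exact: lP].
rewrite [X in frm X _]E3 Zl; move: (frm _ _) => q. move: (_ ^- i) => x1; move: (_ ^- j) => x2; move: (_ ^+ i') => x3; move: (_ ^+ j) => x4.
have t2 : (-1) ^+ s * (-1) ^+ s = 1 :> F by rewrite -signr_addb addbb.
move: ((-1) ^+ s) t2 => t t2.
by transitivity (t * t * (x1 * x2 * x3 * x4 * q)); [ring | rewrite t2 mul1r].
Qed.

(** If the symmetrizer vanishes on [U], the vector of [beta0] is orthogonal to [U]. It generates the
    module and [U] is stable under adjoints of glued diagrams, so the whole module, and [U] itself,
    is orthogonal to [U]. *)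
Lemma zop_detects (U : {vspace tabspace F r la}) : (U <= Pmod F r la)%VS ->
  (forall x u, u \in U -> partalg_act n x u \in U) ->
  U = 0%VS \/ exists2 u, u \in U & Z u != 0.
Proof.
move=> sU Ust; have lP v : v \in Pmod F r la -> legit v by apply: Pmod_legit.
have [/hasP[u uB uz]|/hasPn Z0] := boolP (has (fun u => Z u != 0) (vbasis U)).
  by right; exists u => //; apply: vbasis_mem.
have {}Z0 u : u \in U -> Z u = 0.
  move/coord_vbasis->; elim/big_rec: _ => [|i w _ IH]; first exact: zop0.
  rewrite zop_linear IH addr0.
  have iB : (vbasis U)`_i \in vbasis U by apply: mem_nth; rewrite size_tuple.
  by have /negPn/eqP-> := Z0 _ iB; rewrite scaler0.
left; apply/eqP; rewrite -subv0; apply/subvP => u uU; rewrite memv0; apply/eqP.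
have lu := lP _ (subvP sU _ uU).
have sz := shape_size_gt0 r_gt0 le2rn pla.
have fr := first_row_ge r_gt0 le2rn pla le_la.
apply: (form_eq0 sz fr lu (r_gt0 := r_gt0) (le2rn := le2rn) (le_mr := le_la)).
have F0 v : v \in U -> frm (tvec F beta0) v = 0.
  move=> vU; have [C C0 E] := form_zop (subvP sU _ vU).
  apply/eqP; rewrite -(mulrI_eq0 _ (mulfI C0)) -E Z0 //.
  by rewrite /form big1 // => g _; rewrite linear0 rmorph0 mulr0.
suff H v : v \in Pmod F r la -> frm v u = 0 by apply: H; exact: (subvP sU).
move: v; apply: Pmod_ind => [c v w Ev Ew||beta ob].
- by rewrite form_linl Ev Ew mulr0 addr0.
- by rewrite /form big1 // => g _; rewrite linear0 mul0r.
rewrite -(glue_op_self nF0 ob ob0) /glue_op.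
set c := _^-1; set w := partalg_act _ _ _.
have := form_linl r_gt0 le2rn le_la c w 0 u; rewrite addr0 => ->.
rewrite /w form_adj_glue //; last exact: lP.
rewrite F0 ?mulr0 ?add0r; last exact: Ust.
by rewrite /form big1 // => g _; rewrite linear0 mul0r.
Qed.

Lemma Pmod_irreducible (U : {vspace tabspace F r la}) : (U <= Pmod F r la)%VS ->
  (forall x u, u \in U -> partalg_act n x u \in U) -> U = 0%VS \/ U = Pmod F r la.
Proof.
move=> sU Ust; have [->|[u uU uz]] := zop_detects sU Ust; [by left | right].
have Zst v : v \in U -> Z v \in U.
  move=> vU; rewrite /zop; apply: memv_suml => s _; apply: memvZ.
  by apply: memvZ; apply: (Ust); apply: memvZ; apply: Ust.
apply/eqP; rewrite eqEsubv sU /=; apply: tvec_generate => //.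
have [c E] := zop_same (subvP sU _ uU).
by have := Zst u uU; rewrite E rpredZeq => /orP[/eqP c0|//]; move: uz; rewrite E c0 scale0r eqxx.
Qed.

End SymmetrizerConsequences.

(** * Colorings and multiset partition tableaux *)

Lemma card_interval (r s t : nat) : (t <= r)%N -> #|[set i : 'I_r | (s <= i < t)%N]| = (t - s)%N.
Proof.
move=> tr; rewrite cardsE -sum1_card -[RHS]muln1 -sum_nat_const_nat.
rewrite (big_nat_widen s t r xpredT (fun=> 1%N) tr) (big_nat_widenl s 0%N) // big_mkord.
by apply: eq_bigl => i; rewrite unfold_in andbC.
Qed.

Section Coloring.
Variables (r k : nat) (a : weight r k).

Definition prefix_sum (m : nat) : nat := (\sum_(j < k | (j < m)%N) val a j)%N.

Lemma in_intervalE (j : 'I_k) (i : 'I_r) :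
  in_interval a j i = (prefix_sum j <= i < prefix_sum j.+1)%N.
Proof. by []. Qed.

Lemma prefix_sumS (j : 'I_k) : prefix_sum j.+1 = (prefix_sum j + val a j)%N.
Proof.
rewrite /prefix_sum (bigD1 j) //= addnC; congr (_ + _)%N.
by apply: eq_bigl => i; rewrite ltnS ltn_neqAle andbC.
Qed.

Lemma prefix_sum_le m m' : (m <= m')%N -> (prefix_sum m <= prefix_sum m')%N.
Proof.
move=> le; rewrite /prefix_sum [X in (_ <= X)%N](bigID (fun j : 'I_k => (j < m)%N)) /=.
apply: leq_trans (leq_addr _ _); apply: eq_leq; apply: eq_bigl => j.
by case: (ltnP j m) => jm; rewrite ?andbF // (leq_trans jm le).
Qed.

Lemma prefix_sum_all : prefix_sum k = r.
Proof.
rewrite /prefix_sum -[RHS](eqP (valP a)); apply: eq_bigl => j; exact: ltn_ord.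
Qed.

Lemma color_exists (i : 'I_r) : exists j, in_interval a j i.
Proof.
have ex : exists m, (i < prefix_sum m)%N by exists k; rewrite prefix_sum_all.
case: (ex_minnP ex) => -[|m] im mmin.
  by move: im; rewrite /prefix_sum big1 // => j; rewrite ltn0.
have mk : (m < k)%N by apply: mmin; rewrite prefix_sum_all.
exists (Ordinal mk); rewrite in_intervalE /= im andbT leqNgt; apply/negP => /mmin.
by rewrite ltnn.
Qed.

Definition color (i : 'I_r) : 'I_k := xchoose (color_exists i).

Lemma in_interval_color j i : in_interval a j i = (color i == j).
Proof.
have ci : in_interval a (color i) i := xchooseP (color_exists i).
apply/idP/eqP => [|<-//]; move: ci; rewrite !in_intervalE => /andP[c1 c2] /andP[j1 j2].
apply/val_inj/eqP; rewrite eqn_leq; apply/andP; split; rewrite leqNgt; apply/negP => /prefix_sum_le le.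
  by move: (leq_trans j2 (leq_trans le c1)); rewrite ltnn.
by move: (leq_trans c2 (leq_trans le j1)); rewrite ltnn.
Qed.

Lemma card_color j : #|[set i | color i == j]| = val a j.
Proof.
have le : (prefix_sum j.+1 <= r)%N by rewrite -prefix_sum_all prefix_sum_le.
rewrite -[RHS](addKn (prefix_sum j)) -prefix_sumS -(card_interval _ le).
by apply: eq_card => i; rewrite !inE -in_interval_color in_intervalE.
Qed.

Lemma young_subgroupP (s : 'S_r) :
  reflect (forall i, color (s i) = color i) (s \in young_subgroup a).
Proof.
rewrite inE; apply: (iffP forallP) => [H i|H i].
  have /forallP/(_ (color i)) := H i; rewrite !in_interval_color eqxx /=.
  by move/eqP.
by apply/forallP => j; rewrite !in_interval_color H implybb.
Qed.

Definition block_color (B : {set 'I_r}) : multiset r k :=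
  [ffun j => inord #|[set i in B | in_interval a j i]|].

Lemma block_colorE B j : block_color B j = #|[set i in B | color i == j]| :> nat.
Proof.
rewrite ffunE inordK.
  by apply: eq_card => i; rewrite !inE in_interval_color.
by rewrite ltnS; apply: leq_trans (max_card _) _; rewrite card_ord.
Qed.

Lemma msize_block_color B : msize (block_color B) = #|B|.
Proof.
rewrite /msize (eq_bigr (fun j => \sum_(i in B | color i == j) 1)%N) => [|j _].
  rewrite -sum1_card [RHS](partition_big color predT) //=.
by rewrite block_colorE -sum1_card; apply: eq_bigl => i; rewrite !inE.
Qed.

End Coloring.

(** Equal fibre sizes say that the two lists of values are rearrangements of each other. *)
Lemma fiber_perm (r : nat) (X : eqType) (f g : 'I_r -> X) :
  (forall x, #|[set i | f i == x]| = #|[set i | g i == x]|) ->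
  exists s : 'S_r, forall i, f i = g (s i).
Proof.
move=> fg; have cnt (h : 'I_r -> X) x : count_mem x [tuple h i | i < r] = #|[set i | h i == x]|.
  rewrite /= count_map -sum1_count big_enum_cond -sum1_card.
  by apply: eq_bigl => i; rewrite !inE.
have /tuple_permP[s E] : perm_eq [tuple f i | i < r] [tuple g i | i < r].
  by apply/allP => x _ /=; rewrite -!/(count_mem _ _) !cnt fg.
exists s => i; have := congr1 (fun t => nth (f i) t i) E.
by rewrite !nth_mktuple tnth_mktuple.
Qed.

Section ColoredFillings.
Variables (r k : nat) (l : seq nat) (a : weight r k).
Hypothesis r_gt0 : (0 < r)%N.
Implicit Types (beta gamma : {ffun 'I_r -> box l}) (T : mset_filling l r k).

Lemma coloringE (S : set_filling l r) b : coloring a S b = block_color a (S b).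
Proof. by rewrite ffunE. Qed.

Lemma coloring_fib beta b j : coloring a (fib beta) b j = #|[set i | (color a i, beta i) == (j, b)]| :> nat.
Proof.
rewrite coloringE block_colorE; apply: eq_card => i.
by rewrite !inE fibE xpair_eqE andbC.
Qed.

Lemma coloring_weight beta : has_weight a (coloring a (fib beta)).
Proof.
apply/forallP => j; rewrite -(card_color a) -sum1_card (partition_big beta predT) //=.
apply/eqP; apply: eq_bigr => b _; rewrite coloring_fib -sum1_card.
by apply: eq_bigl => i; rewrite !inE xpair_eqE.
Qed.

Lemma coloring_MPT beta : onto beta -> coloring a (fib beta) \in MPT l r k.
Proof.
move=> /ontoP ob; rewrite inE; apply/andP; split.
  apply/forall_inP => b /ob[i ib]; rewrite coloringE msize_block_color.
  by apply/card_gt0P; exists i; rewrite fibE ib.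
apply/eqP; rewrite -[RHS](card_ord r) -sum1_card [RHS](partition_big beta predT) //=.
apply: eq_bigr => b _; rewrite coloringE msize_block_color -sum1_card.
by apply: eq_bigl => i; rewrite fibE.
Qed.

(** A colored tableau records the fibre sizes of the map to pairs of a color and a box; a
    permutation relating two such maps preserves colors, so it lies in the Young subgroup. *)
Lemma coloring_transitive beta gamma : coloring a (fib beta) = coloring a (fib gamma) ->
  exists2 s, s \in young_subgroup a & gamma = [ffun i => beta (s^-1 i)%g].
Proof.
move=> E; have [[j b]|s Es] := @fiber_perm r _ (fun i => (color a i, beta i)) (fun i => (color a i, gamma i)).
  by rewrite -!coloring_fib E.
exists s; first by apply/young_subgroupP => i; have [] := Es i.
by apply/ffunP => i; rewrite ffunE; have [_ ->] := Es (s^-1 i)%g; rewrite permKV.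
Qed.

Lemma coloring_exists T : T \in MPT l r k -> has_weight a T ->
  exists2 beta, onto beta & coloring a (fib beta) = T.
Proof.
rewrite inE => /andP[/forall_inP Tup /eqP Tr] /forallP Ta.
(* All prescribed pairs of a color and a box with their multiplicities; a permutation will align
   their colors with the intervals of [a]. *)
pose L := flatten [seq nseq (T p.2 p.1) p | p <- enum {: 'I_k * box l}].
have cL p : count_mem p L = T p.2 p.1.
  rewrite count_flatten -map_comp sumnE big_map (bigD1_seq p) ?mem_enum ?enum_uniq //=.
  rewrite count_nseq /= eqxx mul1n big1 ?addn0 // => q /negPf qp.
  by rewrite count_nseq /= qp.
have sL : size L = r.
  rewrite size_flatten /shape -map_comp sumnE big_map -[RHS]Tr enumT /=.
  rewrite [RHS](eq_bigr (fun b => \sum_(j < k) T b j)%N) // exchange_big pair_big /=.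
  by apply: eq_bigr => p _; rewrite size_nseq.
pose t := Tuple (introT eqP sL).
have ct p : #|[set i | tnth t i == p]| = T p.2 p.1.
  rewrite -cL -[L]/(tval t) -[X in count_mem p X]map_tnth_enum count_map -sum1_count big_enum_cond -sum1_card.
  by apply: eq_bigl => i; rewrite !inE.
have [j|s Es] := @fiber_perm r _ (color a) (fun i => (tnth t i).1).
  rewrite card_color (eqP (Ta j)) -sum1_card (partition_big (fun i => (tnth t i).2) predT) //=.
  apply: eq_bigr => b _; rewrite -(ct (j, b)) -sum1_card; apply: eq_bigl => i.
  by rewrite !inE -xpair_eqE; case: (tnth t i).
pose beta : {ffun 'I_r -> box l} := [ffun i => (tnth t (s i)).2].
have bE b j : coloring a (fib beta) b j = T b j :> nat.
  rewrite coloring_fib -(ct (j, b)) -(card_imset _ (@perm_inj _ s)).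
  apply: eq_card => i; rewrite inE; apply/imsetP/eqP => [[i']|E].
    by rewrite inE ffunE Es => /eqP[<- <-] ->; case: (tnth _ _).
  by exists (s^-1 i)%g; rewrite ?permKV // inE ffunE Es permKV E.
have cE : coloring a (fib beta) = T.
  by apply/ffunP => b; apply/ffunP => j; apply: val_inj; apply: bE.
exists beta => //; apply/ontoP => b ub.
case: (pickP [pred i | beta i == b]) => [i /eqP ib|no]; first by exists i.
have := Tup b ub; rewrite -cE coloringE msize_block_color eq_card0 // => i.
by rewrite fibE; apply: no.
Qed.

Lemma coloring_refill beta (s : {perm box l}) :
  coloring a (refill (fib beta) s) = refill (coloring a (fib beta)) s.
Proof. by apply/ffunP => b; rewrite [RHS]ffunE !coloringE ffunE. Qed.

End ColoredFillings.

(** * The vectors w_T and straightening of colored tableaux *)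

Section MultisetTableaux.
Variables (F : numClosedFieldType) (r k n : nat) (l : seq nat).
Hypotheses (r_gt0 : (0 < r)%N) (le2rn : (2 * r <= n)%N) (ln : partition_of n l).
Implicit Types (a : weight r k) (beta gamma : {ffun 'I_r -> box l}) (T : mset_filling l r k).
Local Notation mrank := (word_rank (@multiset_word r k)).

Lemma mrank0 (m : multiset r k) : msize m = 0%N -> mrank m = 0%N.
Proof.
move=> m0; apply: eq_card0 => m'; rewrite !inE.
have /eqP-> : multiset_word m == [::] by rewrite multiset_word_nil m0.
by case: multiset_word.
Qed.

Lemma mrank_gt0 (m : multiset r k) : (0 < mrank m)%N = (0 < msize m)%N.
Proof.
apply/idP/idP; first by apply: contraTltn; rewrite leqn0 => /eqP/mrank0->.
move=> m0; have -> : 0%N = mrank [ffun=> ord0].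
  by rewrite mrank0 // /msize big1 // => j _; rewrite ffunE.
rewrite word_rank_lt; last exact: multiset_word_inj.
have /eqP-> : multiset_word ([ffun=> ord0] : multiset r k) == [::].
  by rewrite multiset_word_nil /msize big1 // => j _; rewrite ffunE.
by move: m0; rewrite lt0n -multiset_word_nil; case: multiset_word.
Qed.

Lemma SSMPT_strict T : T \in MPT l r k -> row_weak mrank T -> col_strict mrank T ->
  T \in SSMPT l r k.
Proof.
move=> TM rT cT; rewrite inE TM; apply/(semistandardP (@multiset_word_inj r k)).
split=> // b b' cb rb; have ub' : up b' by apply: leq_ltn_trans rb.
have [ub|nub] := boolP (up b); first exact: cT.
move: TM; rewrite inE => /andP[/forall_inP Tup /eqP Tr].
have : ~~ (0 < msize (T b))%N.
  apply: (first_row_empty r_gt0 le2rn ln (ne := [pred c | (0 < msize (T c))%N])) cb => //.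
    rewrite -[X in (_ <= X)%N]Tr -sum1_card big_mkcond /=; apply: leq_sum => c _.
    by case: ifP.
  by move=> c c' _ rc cc /=; rewrite -!mrank_gt0 => /leq_trans; apply; apply: rT.
rewrite -eqn0Ngt => /eqP Tb0; rewrite mrank0 // mrank_gt0; exact: Tup.
Qed.

(** Colored tableaux lift to set tableaux and refilling commutes with coloring, so the relations
    need only be known for [u]. Both the spanning by the w_T and the morphism into an irreducible
    module come from here. *)
Lemma mset_straightening a (V : vectType F) (v : mset_filling l r k -> V)
    (u : set_filling l r -> V) (S : {vspace V}) :
  (forall (T : set_filling l r) (s : {perm box l}), T \in SPT l r -> (forall b, up b -> s b = b) ->
     u (refill T s) = u T) ->
  (forall (T : set_filling l r) (s : {perm box l}), T \in SPT l r -> s \in column_group l ->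
     u (refill T s) = (-1) ^+ s *: u T) ->
  (forall (T : set_filling l r) (j j' : nat) (A : {set box l}), T \in SPT l r -> (j < j')%N ->
     (forall b : box l, b \in A -> up b /\ (box_col b = j \/ box_col b = j')) ->
     (#|[set b : box l | up b & box_col b == j]| < #|A|)%N ->
     \sum_(s | perm_on A s) (-1) ^+ s *: u (refill T s) = 0) ->
  (forall T : set_filling l r, T \in SPT l r -> v (coloring a T) = u T) ->
  (forall T, T \in SSMPT l r k -> has_weight a T -> v T \in S) ->
  forall T, T \in MPT l r k -> has_weight a T -> v T \in S.
Proof.
move=> u_row0 u_col u_garnir vu HS.
have lift T : T \in MPT l r k /\ has_weight a T -> exists beta,
    [/\ fib beta \in SPT l r, T = coloring a (fib beta) &
     forall s, refill T s = coloring a (refill (fib beta) s)].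
  move=> [TM Ta]; have [beta ob <-] := coloring_exists TM Ta.
  by exists beta; split=> // [|s]; [exact: fib_SPT | rewrite coloring_refill].
suff H : forall T, T \in MPT l r k /\ has_weight a T -> v T \in S by move=> T TM Ta; apply: H.
apply: (@straightening l (shape_sorted ln) F _ _ mrank (word_rank_inj (@multiset_word_inj r k))
  (char0F F) (fun T => T \in MPT l r k /\ has_weight a T) v).
- move=> T s /lift[beta [bS _ ->]] su.
  have [gamma og ->] := SPT_fib (SPT_refill bS su).
  by split; [exact: coloring_MPT | exact: coloring_weight].
- move=> T s /lift[beta [bS TE ->]] su; rewrite TE !vu ?u_row0 //.
  by apply: SPT_refill => // b; rewrite /up (row0_perm_row su).
- move=> T s /lift[beta [bS TE ->]] sC; rewrite TE !vu ?u_col //.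
  by apply: SPT_refill => // b; apply: column_group_up.
- move=> T j j' A /lift[beta [bS TE E]] jj HA cA.
  rewrite -[RHS](u_garnir _ _ _ _ bS jj HA cA); apply: eq_bigr => s sA.
  rewrite E vu //; apply: SPT_refill => // b.
  have [bA|bA] := boolP (b \in A); last by rewrite (out_perm sA bA).
  by have [ub _] := HA b bA; have [-> _] := HA (s b) (etrans (perm_closed b sA) bA).
move=> T [TM Ta] rT cT; apply: HS => //; exact: SSMPT_strict.
Qed.

Hypothesis le_mr : (num_upper l <= r)%N.
Local Notation act := (@partalg_act F r n l).

Definition yact a := act (young_idem F a).

Lemma yactE a u : yact a u = #|young_subgroup a|%:R^-1 *:
  \sum_(s in young_subgroup a) act (perm_elt F s) u.
Proof. by rewrite /yact /young_idem actZl act_suml. Qed.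

Lemma yact_perm a s u : u \in Pmod F r l -> s \in young_subgroup a ->
  yact a (act (perm_elt F s) u) = yact a u.
Proof.
move=> uP sa; rewrite /yact.
have <- := Pmod_act_mul r_gt0 le2rn ln le_mr (young_idem F a) (perm_elt F s) uP.
by rewrite (young_idem_perm F r_gt0 le2rn sa).
Qed.

Lemma yact_coloring a beta gamma : onto beta -> coloring a (fib beta) = coloring a (fib gamma) ->
  yact a (tvec F gamma) = yact a (tvec F beta).
Proof.
move=> ob /coloring_transitive[s sa ->].
have E := act_perm_tvec F r_gt0 le2rn ln le_mr s ob; rewrite -E.
by apply: yact_perm => //; exact: (tvec_Pmod F r_gt0 le2rn ln ob).
Qed.

Definition wsum a T : tabspace F r l := #|coloring_fiber a T|%:R^-1
       *: \sum_(S in coloring_fiber a T) polytabloid F S.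

(** The Young subgroup permutes the tableaux of a given coloring, so s_a fixes their sum; by
    transitivity s_a also takes the same value on each of them. Comparing the two gives the
    average. *)
Lemma wsum_tvec a beta : onto beta ->
  wsum a (coloring a (fib beta)) = yact a (tvec F beta).
Proof.
move=> ob; rewrite /wsum; set C := coloring_fiber a _.
have CP (S : set_filling l r) : S \in C -> exists gamma, [/\ onto gamma, S = fib gamma &
    coloring a (fib gamma) = coloring a (fib beta)].
  rewrite inE => /andP[/SPT_fib[gamma og ->] /eqP E]; by exists gamma.
have bC : fib beta \in C by rewrite inE fib_SPT // eqxx.
have C0 : #|C|%:R != 0 :> F by rewrite pnatr_eq0 -lt0n; apply/card_gt0P; exists (fib beta).
set Sm := \sum_(S in C) _.
have SmP : Sm \in Pmod F r l.
  apply: memv_suml => S /CP[gamma [og -> _]]; exact: (tvec_Pmod F r_gt0 le2rn ln og).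
have y1 : yact a Sm = #|C|%:R *: yact a (tvec F beta).
  rewrite /Sm /yact act_sumr scaler_nat -sumr_const; apply: eq_bigr => S /CP[gamma [og -> E]].
  by apply: yact_coloring.
pose mv (s : 'S_r) (S : set_filling l r) : set_filling l r := [ffun b => s @: S b].
have mv_fib s gamma : mv s (fib gamma) = fib [ffun i => gamma (s^-1 i)%g].
  apply/ffunP => b; rewrite [LHS]ffunE; apply/setP => i; rewrite [RHS]fibE [in RHS]ffunE.
  by rewrite -{1}(permKV s i) (mem_imset _ _ (@perm_inj _ s)) fibE.
have y2 : yact a Sm = Sm.
  rewrite yactE (eq_bigr (fun=> Sm)).
    by rewrite sumr_const -scaler_nat scalerA mulVf ?scale1r // pnatr_eq0 -lt0n young_card_gt0.
  move=> s sa; rewrite /Sm act_sumr.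
  transitivity (\sum_(S in C) polytabloid F (mv s S)).
    apply: eq_bigr => S /CP[gamma [og -> _]]; rewrite mv_fib.
    exact: (act_perm_tvec F r_gt0 le2rn ln le_mr s og).
  have mvI : injective (mv s).
    move=> S S' /ffunP E; apply/ffunP => b; have := E b; rewrite !ffunE.
    by apply: imset_inj; apply: perm_inj.
  have mvC (t : 'S_r) S : t \in young_subgroup a -> S \in C -> mv t S \in C.
    move=> ta /CP[gamma [og -> E]]; rewrite mv_fib inE -E; apply/andP; split.
      apply: fib_SPT; apply/ontoP => b ub; have [i ib] := (ontoP _ og) b ub.
      by exists (t i); rewrite ffunE permK.
    apply/eqP/ffunP => b; apply/ffunP => j; apply: val_inj; rewrite /= !coloring_fib.
    rewrite -[RHS](card_imset _ (@perm_inj _ t)); apply: eq_card => i.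
    rewrite inE [in LHS]ffunE -[in RHS](permKV t i) (mem_imset _ _ (@perm_inj _ t)).
    rewrite inE; congr ((_, _) == _).
    by rewrite -{1}(permKV t i) ((young_subgroupP _ _) ta).
  rewrite [RHS](reindex_inj mvI) /=; apply: eq_bigl => S.
  apply/idP/idP => [|mS]; first exact: mvC.
  have -> : S = mv s^-1%g (mv s S).
    apply/ffunP => b; rewrite !ffunE -imset_comp (eq_imset _ (permK s)) imset_id //.
  by apply: mvC => //; rewrite (@groupV _ (young_group a)).
by rewrite -[Sm]y2 y1 scalerA mulVf ?scale1r.
Qed.

Lemma wsum_span a T (S : {vspace tabspace F r l}) :
  (forall T, T \in SSMPT l r k -> has_weight a T -> wsum a T \in S) ->
  T \in MPT l r k -> has_weight a T -> wsum a T \in S.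
Proof.
move=> HS; move: T; apply: (@mset_straightening a _ (wsum a) (fun T : set_filling l r => yact a (polytabloid F T))) => //.
- by move=> T s _ su; rewrite polytabloid_row0.
- by move=> T s _ sC; rewrite polytabloid_col // /yact actZr.
- move=> T j j' A TS jj HA cA.
  rewrite -[RHS](act0r n l (young_idem F a)).
  rewrite -[in RHS](polytabloid_garnir (char0F F) T jj HA cA) [RHS]act_sumr.
  by apply: eq_bigr => s _; rewrite [RHS]actZr.
by move=> T /SPT_fib[beta ob ->]; apply: wsum_tvec.
Qed.

End MultisetTableaux.

(** * Linear independence of the vectors w_T *)

Section LeadingContents.
Variables (F : numClosedFieldType) (r k n : nat) (l : seq nat) (a : weight r k).
Hypotheses (r_gt0 : (0 < r)%N) (le2rn : (2 * r <= n)%N) (ln : partition_of n l).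
Implicit Types (beta gamma : {ffun 'I_r -> box l}) (T : mset_filling l r k).
Local Notation mrank := (word_rank (@multiset_word r k)).

(** The empty multiset is discarded because a tabloid does not see empty boxes. *)
Definition content T : {ffun 'I_(size l) * multiset r k -> nat} :=
  [ffun ix => if msize ix.2 == 0%N then 0%N
              else #|[set b : box l | (box_row b, T b) == ix]|].

Definition tab_content (t : tabloid r l) : {ffun 'I_(size l) * multiset r k -> nat} :=
  [ffun ix => #|[set B in t ix.1 | block_color a B == ix.2]|].

Lemma tab_content_fib beta : tab_content (tab beta) = content (coloring a (fib beta)).
Proof.
apply/ffunP => -[i x]; rewrite [LHS]ffunE [RHS]ffunE /=; case: eqP => [x0|/eqP x0].
  apply: eq_card0 => B; rewrite !inE; apply/negP => /andP[/mem_tab[y _ ->] /eqP E].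
  move: x0; rewrite -E msize_block_color => /eqP; rewrite cards_eq0 => /eqP/setP/(_ y).
  by rewrite fibE eqxx inE.
pose fb (b : box l) : {set 'I_r} := fib beta b.
have hit b : coloring a (fib beta) b = x -> exists y, beta y = b.
  case: (pickP [pred y | beta y == b]) => [y /eqP <- _|no E]; first by exists y.
  case/negP: x0; rewrite -E coloringE msize_block_color; apply/eqP/eq_card0 => y.
  by rewrite fibE; apply: no.
rewrite -(@card_in_imset _ _ fb [set b | (box_row b, coloring a (fib beta) b) == (i, x)]).
  apply: eq_card => B; rewrite inE; apply/andP/imsetP => [[/mem_tab[y yi ->] /eqP E]|[b]].
    by exists (beta y); rewrite // inE coloringE E yi.
  rewrite inE => /eqP[bi bx] ->; have [y yb] := hit b bx.
  split; last by rewrite -bx coloringE.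
  by apply/mem_tab; exists y; rewrite yb.
move=> b c; rewrite !inE => /eqP[_ bx] /eqP[_ cx] E.
have [y yb] := hit b bx; have := fibE beta b y; rewrite -/(fb b) E fibE yb eqxx.
by move/eqP.
Qed.

(** On polytabloids this functional depends on the coloring alone, so its value on the average w_T
    can be read off from any tableau of the fibre. *)
Definition lead c (u : tabspace F r l) : F^o := \sum_(t | tab_content t == c) u t.

Lemma lead_is_linear c : linear (lead c).
Proof.
move=> x u v; rewrite /lead scaler_sumr -big_split; apply: eq_bigr => t _.
by rewrite !ffunE.
Qed.

HB.instance Definition _ c := GRing.isLinear.Build F (tabspace F r l) F^o _
  (lead c) (lead_is_linear c).

Definition lead_coeff T c : F :=
  \sum_(s in column_group l) (-1) ^+ s * (content (refill T s) == c)%:R.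

Lemma lead_elt c t : lead c (tabloid_elt F t) = (tab_content t == c)%:R.
Proof.
rewrite /lead; have [tc|tc] := boolP (tab_content t == c).
  rewrite (bigD1 t) //= ffunE eqxx big1 ?addr0 // => t' /andP[_ /negPf tt'].
  by rewrite ffunE tt'.
rewrite big1 // => t' tc'; rewrite ffunE; case: eqP => // E.
by move: tc; rewrite -E tc'.
Qed.

Lemma lead_polytabloid beta c :
  lead c (polytabloid F (fib beta)) = lead_coeff (coloring a (fib beta)) c.
Proof.
rewrite polytabloidE linear_sum /lead_coeff; apply: eq_bigr => s _.
rewrite linearZ /= lead_elt -coloring_refill /refill fib_perm.
by rewrite -tab_content_fib.
Qed.

Lemma lead_wsum T c : T \in MPT l r k -> has_weight a T ->
  lead c (wsum F a T) = lead_coeff T c.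
Proof.
move=> TM Ta; rewrite /wsum linearZ linear_sum /=.
have [beta ob E] := coloring_exists TM Ta.
have C0 : #|coloring_fiber a T|%:R != 0 :> F.
  rewrite pnatr_eq0 -lt0n; apply/card_gt0P; exists (fib beta).
  by rewrite inE fib_SPT // E eqxx.
rewrite (eq_bigr (fun=> lead_coeff T c)) => [|S].
  by rewrite sumr_const -(mulr_natl (lead_coeff T c)) -[LHS]/(_ * (_ * _)) mulrA mulVf ?mul1r.
by rewrite inE => /andP[/SPT_fib[gamma og ->] /eqP <-]; apply: lead_polytabloid.
Qed.

Definition height_sum T : nat := (\sum_b box_row b * mrank (T b))%N.

Lemma height_sum_content T T' : content T = content T' -> height_sum T = height_sum T'.
Proof.
have H S : height_sum S = (\sum_(ix : 'I_(size l) * multiset r k) ix.1 * mrank ix.2 * content S ix)%N.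
  rewrite /height_sum (partition_big (fun b => (box_row b, S b)) predT) //=.
  apply: eq_bigr => -[i x] _; rewrite ffunE /=; case: eqP => [x0|_].
    by rewrite muln0 big1 // => b /eqP[_ ->]; rewrite mrank0 ?muln0.
  rewrite (eq_bigr (fun=> i * mrank x)%N) => [|b /eqP[-> ->]//].
  by rewrite sum_nat_const mulnC; congr (_ * _)%N; apply: eq_card => b; rewrite inE.
by move=> E; rewrite !H E.
Qed.

(** Let [b] be the lowest box moved by a column permutation. Its image and its preimage both lie
    higher in the column, so exchanging the contents found at [b] and at the preimage brings a
    larger entry up. A maximizing permutation therefore moves nothing. *)
Lemma height_sum_column T s : col_strict mrank T -> s \in column_group l -> s != 1%g ->
  (height_sum (refill T s) < height_sum T)%N.
Proof.
move=> cT; have C1 : (1%g : {perm box l}) \in column_group l by exact: (group1 (column_grp l)).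
pose W s := height_sum (refill T s).
case: (@arg_maxnP _ 1%g (mem (column_group l)) W C1) => m mC mmax.
have unique s' : s' \in column_group l -> (W m <= W s')%N -> s' = 1%g.
  move=> sC le; apply/eqP; apply: contraT => ns.
  have /existsP[b0 b0P] : [exists b, s' b != b].
    apply: contraT => /existsPn H; case/negP: ns; apply/eqP/permP => b; rewrite perm1.
    by apply/eqP/negPn/H.
  case: (@arg_minnP _ b0 (fun b => s' b != b) (fun b => nat_of_ord (box_row b)) b0P) => b bP bmin.
  have /column_groupP sP := sC.
  have ub : up b by apply: contraT => /(sP b).2/eqP; rewrite (negPf bP).
  pose b' := (s'^-1)%g b; have sb' : s' b' = b by rewrite permKV.
  have rowlt c : s' c != c -> c != b -> box_col c = box_col b -> (box_row b < box_row c)%N.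
    move=> cP cb cc; rewrite ltn_neqAle bmin // andbT; apply: contra cb => /eqP E.
    by apply/eqP/box_eq => //; apply: val_inj.
  have nb' : b' != b by apply: contra bP => /eqP E; rewrite -{1}E sb'.
  have cb' : box_col b' = box_col b by rewrite -(sP b').1 sb'.
  have lt1 : (box_row b < box_row b')%N by apply: rowlt; rewrite ?sb' // eq_sym.
  have lt2 : (box_row b < box_row (s' b))%N.
    by apply: rowlt; rewrite ?(inj_eq perm_inj) // (sP b).1.
  have ub' : up b' by apply: leq_ltn_trans lt1.
  have : (W s' < W (tperm b b' * s')%g)%N.
    rewrite /W /height_sum.
    rewrite [X in (X < _)%N](eq_bigr (fun c => box_row c * (mrank \o T \o s') c)%N);
      last by move=> c _; rewrite ffunE.
    rewrite [X in (_ < X)%N](eq_bigr (fun c => box_row c * (mrank \o T \o s') (tperm b b' c))%N);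
      last by move=> c _; rewrite ffunE permM.
    apply: (@sum_tperm_lt _ (fun c => nat_of_ord (box_row c)) (mrank \o T \o s')) => //=.
    by rewrite sb'; apply: cT; rewrite ?column_group_up // (sP b).1.
  have tC : (tperm b b' * s')%g \in column_group l.
    by apply: column_groupM => //; apply: column_group_tperm.
  by have := mmax _ tC; rewrite /geq /= => le'; rewrite ltnNge (leq_trans le' le).
have m1 := unique m mC (leqnn _).
move=> sC ns; have T1 : height_sum T = W m.
  by rewrite m1 /W; congr height_sum; apply/ffunP => b; rewrite ffunE perm1.
rewrite T1 ltn_neqAle; apply/andP; split; last exact: mmax.
apply: contra ns => /eqP E; apply/eqP/unique => //.
by rewrite -E.
Qed.

(** If [S'] exceeded [S] at [b], count the entries of that row above [S b]: in [S] they lie strictly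
    to the right of [b], and in [S'] all those boxes and [b] itself qualify, contradicting equal
    contents. *)
Lemma content_row_inj T T' : row_weak mrank T -> row_weak mrank T' ->
  content T = content T' -> T = T'.
Proof.
have key S S' b : row_weak mrank S -> row_weak mrank S' -> content S = content S' ->
    (mrank (S' b) <= mrank (S b))%N.
  move=> rS rS' E; rewrite leqNgt; apply/negP => lt.
  pose A0 := fun S1 : mset_filling l r k =>
    [set c : box l | (box_row c == box_row b) && (mrank (S b) < mrank (S1 c))%N].
  have cardA S1 : #|A0 S1| =
      (\sum_(x : multiset r k | (mrank (S b) < mrank x)%N) content S1 (box_row b, x))%N.
    rewrite -sum1_card (partition_big S1 (fun x => (mrank (S b) < mrank x)%N)) /=; last first.
      by move=> c; rewrite inE => /andP[].
    apply: eq_bigr => x lx; rewrite ffunE /= -leqn0 leqNgt -mrank_gt0 (leq_ltn_trans _ lx) //=.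
    rewrite sum1dep_card; apply: eq_card => c; rewrite !inE xpair_eqE.
    by case: (S1 c =P x) => [->|]; rewrite ?andbF // lx !andbT.
  have : A0 S \proper A0 S'.
    apply/properP; split.
      apply/subsetP => c; rewrite !inE => /andP[/eqP cb ltc]; rewrite cb eqxx /=.
      apply: leq_trans lt _; case: (ltngtP (box_col b) (box_col c)) => bc.
      - exact: rS'.
      - by have := rS _ _ cb bc; rewrite leqNgt ltc.
      by have -> : c = b by apply: box_eq.
    by exists b; rewrite !inE eqxx ?ltnn.
  by move/proper_card; rewrite !cardA E ltnn.
move=> rT rT' E; apply/ffunP => b; apply: (word_rank_inj (@multiset_word_inj r k)).
by apply/eqP; rewrite eqn_leq !key.
Qed.

(** Triangularity for [height_sum]: the content of one tableau can arise from a different one only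
    through a nontrivial column permutation, which lowers the height. *)
Lemma wsum_free (c : mset_filling l r k -> F) :
  \sum_(T in SSMPT l r k | has_weight a T) c T *: wsum F a T = 0 ->
  forall T, T \in SSMPT l r k -> has_weight a T -> c T = 0.
Proof.
move=> c0 T TS Ta.
have MP T1 : T1 \in SSMPT l r k -> [/\ T1 \in MPT l r k, row_weak mrank T1 & col_strict mrank T1].
  rewrite inE => /andP[TM /(semistandardP (@multiset_word_inj r k))[rT cT]]; split=> //.
  by move=> b b' _ _; apply: cT.
have refill1 T1 : refill T1 1%g = T1 by apply/ffunP => b; rewrite ffunE perm1.
apply: (@triangular_free F _ _ (fun T => (T \in SSMPT l r k) && has_weight a T)
  lead_coeff content height_sum c); last by rewrite TS.
- move=> T1 /andP[/MP[T1M _ cT1] _]; rewrite /lead_coeff (bigD1 1%g) /=; last first.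
    exact: (group1 (column_grp l)).
  rewrite odd_perm1 expr0 mul1r refill1 eqxx big1 ?addr0 ?oner_neq0 // => s /andP[sC ns].
  case: eqP => [/height_sum_content E|_]; last by rewrite mulr0.
  by have := height_sum_column cT1 sC ns; rewrite E ltnn.
- move=> T1 T2 /andP[/MP[T1M rT1 cT1] _] /andP[/MP[T2M rT2 cT2] _] nz.
  have /existsP[s /andP[sC /eqP E]] :
      [exists s in column_group l, content (refill T2 s) == content T1].
    apply: contraR nz => /exists_inPn H; apply/eqP; rewrite /lead_coeff big1 // => s sC.
    by rewrite (negPf (H s sC)) mulr0.
  have [s1|ns] := eqVneq s 1%g.
    by left; apply: content_row_inj => //; rewrite -E s1 refill1.
  by right; rewrite -(height_sum_content E); apply: height_sum_column.
move=> y; have := congr1 (lead y) c0; rewrite linear_sum linear0 => E; rewrite -[RHS]E.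
apply: eq_bigr => /= T1 /andP[/MP[T1M _ _] T1a].
by rewrite [RHS]linearZ /= lead_wsum.
Qed.

End LeadingContents.

(** * The multiset partition algebra and its modules *)

Lemma free_map (F : fieldType) (V : vectType F) (I : eqType) (w : I -> V) (e : seq I) :
  uniq e ->
  (forall c : I -> F, \sum_(i <- e) c i *: w i = 0 -> forall i, i \in e -> c i = 0) ->
  free [seq w i | i <- e].
Proof.
move=> ue H; have [->|[i0 i0e]] : e = [::] \/ exists i, i \in e.
- by case: e {ue H} => [|i e]; [left | right; exists i; rewrite mem_head].
- exact: nil_free.
apply/(@freeP _ _ _ (map_tuple w (in_tuple e))) => c c0 j.
pose d i := if insub (index i e) is Some j then c j else 0 : F.
have dE (j' : 'I_(size e)) : d (nth i0 e j') = c j'.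
  by rewrite /d index_uniq // insubT //= => lt; congr c; apply: val_inj.
rewrite -dE; apply: H; last by apply: mem_nth.
rewrite (big_nth i0) big_mkord -[RHS]c0; apply: eq_bigr => j' _.
by rewrite dE /= (nth_map i0).
Qed.

HB.lock Definition corner (F : numClosedFieldType) (r k n : nat) (a b : weight r k)
    (x : partalg r F) : {ffun weight r k * weight r k -> partalg r F} :=
  [ffun ab : weight r k * weight r k => if ab == (a, b) then
     partalg_mul n (partalg_mul n (young_idem F a) x) (young_idem F b) else 0].

Section PaintedAlgebraFacts.
Variables (F : numClosedFieldType) (r k n : nat).
Hypotheses (r_gt0 : (0 < r)%N) (le2rn : (2 * r <= n)%N).
Local Notation A := (MP F r k n).
Local Notation "x ** y" := (partalg_mul n x y) (at level 40, left associativity).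
Local Notation "'s_ a" := (young_idem F a) (at level 8, a at level 2).
Implicit Types (a b c : weight r k) (x y : partalg r F).

Let idemK a : 's_a ** 's_a = 's_a := young_idemK r_gt0 le2rn (@char0F F) a.
Let mulA x y z : x ** (y ** z) = x ** y ** z := pmulA r_gt0 le2rn x y z.

Local Notation corner := (@corner F r k n).

Lemma cornerE a b x c d : corner a b x (c, d) =
  if (c == a) && (d == b) then 's_a ** x ** 's_b else 0.
Proof. by rewrite corner.unlock ffunE xpair_eqE. Qed.

Lemma mem_MP (x : alg_ambient A) :
  reflect (forall a b, 's_a ** x (a, b) ** 's_b = x (a, b)) (x \in alg_space A).
Proof.
apply: (iffP (mem_ext_dsum _ _)) => [H a b|H [a b]].
  have /memv_imgP[y _ ->] := H (a, b); rewrite lfunE /= /sandwich /=.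
  by rewrite !mulA idemK -!mulA idemK.
by apply/memv_imgP; exists (x (a, b)); rewrite ?memvf // lfunE /= /sandwich H.
Qed.

Lemma corner_mem a b x : (corner a b x : alg_ambient A) \in alg_space A.
Proof.
apply/mem_MP => a' b'; rewrite cornerE; case: andP => [[/eqP-> /eqP->]|_].
  by rewrite !mulA idemK -!mulA idemK.
by rewrite (pmul0r r_gt0 le2rn) (pmul0l r_gt0 le2rn).
Qed.

Lemma corner_linear a b (c : F) x y : corner a b (c *: x + y) = c *: corner a b x + corner a b y.
Proof.
rewrite corner.unlock; apply/ffunP => ab; rewrite !ffunE; case: eqP => _; last by rewrite scaler0 addr0.
by rewrite (pmulDr r_gt0 le2rn) (pmulDl r_gt0 le2rn).
Qed.

Lemma corner_sum (x : alg_ambient A) : x \in alg_space A ->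
  x = \sum_(ab : weight r k * weight r k) corner ab.1 ab.2 (x ab).
Proof.
move=> /mem_MP xM; apply/ffunP => -[a b]; rewrite sum_ffunE (bigD1 (a, b)) //=.
rewrite big1 => [|[c d] cd]; last by rewrite cornerE -xpair_eqE eq_sym (negPf cd).
by rewrite cornerE !eqxx xM addr0.
Qed.

Lemma corner_mul a b c d x y : mp_mul n (corner a b x) (corner c d y) =
  if b == c then corner a d (x ** 's_b ** y) else 0.
Proof.
have m0l z : 0 ** z = 0 := pmul0l r_gt0 le2rn z.
have m0r z : z ** 0 = 0 := pmul0r r_gt0 le2rn z.
apply/ffunP => -[a' d']; rewrite [LHS]ffunE /=.
have [<-|bc] := eqVneq b c.
  rewrite (bigD1 b isT) big1 => [|b' /andP[_ /negPf b'b]]; last first.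
    by rewrite (cornerE a b x a' b') b'b andbF m0l.
  rewrite [LHS]addr0 (cornerE a b x a' b) (cornerE b d y b d').
  rewrite (cornerE a d (x ** 's_b ** y) a' d') !eqxx andbT andTb.
  case: (a' == a); last by rewrite m0l.
  case: (d' == d); last by rewrite m0r.
  by rewrite !mulA -(mulA _ 's_b 's_b) idemK.
rewrite [RHS]ffunE big1 => [//|b' _].
rewrite (cornerE a b x a' b') (cornerE c d y b' d').
have [->|_] := eqVneq b' b; first by rewrite (negPf bc) m0r.
by rewrite andbF m0l.
Qed.

Lemma one_corner : mp_one F r k = \sum_a corner a a (perm_elt F 1%g).
Proof.
apply/ffunP => -[a b]; rewrite ffunE sum_ffunE /=.
have [<-|ab] := eqVneq a b.
  rewrite (bigD1 a) //= big1 => [|c /negPf ca]; last by rewrite cornerE eq_sym ca.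
  by rewrite cornerE !eqxx (perm_elt1_mulr r_gt0 le2rn) idemK addr0.
rewrite big1 // => c _; rewrite cornerE.
by case: eqP => // <-; rewrite eq_sym (negPf ab).
Qed.

End PaintedAlgebraFacts.

(** * Components and corners of the modules of the painted algebra *)

Section PaintedModule.
Variables (F : numClosedFieldType) (r k n : nat) (l : seq nat).
Hypotheses (r_gt0 : (0 < r)%N) (le2rn : (2 * r <= n)%N) (ln : partition_of n l).
Hypothesis le_mr : (num_upper l <= r)%N.
Local Notation A := (MP F r k n).
Local Notation M := (MPmod F r k n l).
Local Notation act := (@partalg_act F r n l).
Local Notation Pmod := (Pmod F r l).
Local Notation yact := (@yact F r k n l).
Local Notation "'s_ a" := (young_idem F a) (at level 8, a at level 2).
Implicit Types (a b : weight r k) (x y : partalg r F) (u : {ffun weight r k -> tabspace F r l}).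

Let Pact_mul x y w (wP : w \in Pmod) := Pmod_act_mul r_gt0 le2rn ln le_mr x y wP.
Let Pact x w (wP : w \in Pmod) := Pmod_act r_gt0 le2rn ln le_mr x wP.

Lemma yactK a w : w \in Pmod -> yact a (yact a w) = yact a w.
Proof.
by move=> wP; rewrite /yact -(Pact_mul _ _ wP) (young_idemK r_gt0 le2rn (@char0F F)).
Qed.

Lemma mem_MPmod u :
  reflect (forall a, u a \in Pmod /\ yact a (u a) = u a) ((u : mod_ambient M) \in mod_space M).
Proof.
apply: (iffP (mem_ext_dsum _ _)) => H a.
  have /memv_imgP[w wP ->] := H a; rewrite lfunE /=.
  by split; [exact: Pact | exact: yactK].
have [uP E] := H a; apply/memv_imgP; exists (u a); first exact: uP.
by rewrite lfunE /= -[LHS]E.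
Qed.

Lemma mp_actE (x : {ffun weight r k * weight r k -> partalg r F}) u a :
  mp_act n x u a = \sum_b act (x (a, b)) (u b).
Proof. by rewrite ffunE. Qed.

Definition inject a (w : tabspace F r l) : {ffun weight r k -> tabspace F r l} :=
  [ffun c => if c == a then w else 0].

Lemma injectE a w c : inject a w c = if c == a then w else 0.
Proof. by rewrite ffunE. Qed.

Lemma inject_is_linear a : linear (inject a).
Proof.
move=> c u v; apply/ffunP => b; rewrite [RHS]ffunE [in RHS]ffunE !injectE.
by case: eqP => _; rewrite ?scaler0 ?addr0.
Qed.

HB.instance Definition _ a := GRing.isLinear.Build F (tabspace F r l)
  {ffun weight r k -> tabspace F r l} _ (inject a) (inject_is_linear a).

Lemma inject_sum u : u = \sum_a inject a (u a).
Proof.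
apply/ffunP => a; rewrite sum_ffunE (bigD1 a) //= injectE eqxx big1 ?addr0 // => b /negPf ba.
by rewrite injectE eq_sym ba.
Qed.

Lemma inject_mem a w : w \in Pmod -> (inject a (yact a w) : mod_ambient M) \in mod_space M.
Proof.
move=> wP; apply/mem_MPmod => b; rewrite injectE; case: eqP => [->|_].
  by split; [exact: Pact | exact: yactK].
by split; [exact: mem0v | exact: act0r].
Qed.

Lemma corner_act a b x u : (u : mod_ambient M) \in mod_space M ->
  mp_act n (corner n a b x) u = inject a (yact a (act x (u b))).
Proof.
move=> /mem_MPmod uM; apply/ffunP => c; rewrite mp_actE injectE.
rewrite (bigD1 b) //= big1 => [|d /negPf db]; last first.
  by rewrite cornerE db andbF -(scale0r 0) actZl scale0r.
rewrite addr0 cornerE eqxx andbT; case: (c == a); last first.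
  by rewrite -(scale0r 0) actZl scale0r.
have [uP E] := uM b; rewrite (Pact_mul _ _ uP) -/(yact b (u b)) E.
by rewrite (Pact_mul _ _ uP).
Qed.

Lemma MPmod_representation : is_representation M.
Proof.
split.
- move=> x u /= /(mem_MP r_gt0 le2rn) xA /mem_MPmod uM; apply/mem_MPmod => a.
  rewrite mp_actE; split.
    by apply: memv_suml => b _; apply: Pact; have [] := uM b.
  rewrite /yact act_sumr; apply: eq_bigr => b _; have [uP _] := uM b.
  rewrite -(Pact_mul _ _ uP); congr (act _ _).
  have E := xA a b; rewrite -E !(pmulA r_gt0 le2rn).
  by rewrite (young_idemK r_gt0 le2rn (@char0F F)).
- move=> c x y /= _ _ u _; apply/ffunP => a.
  rewrite [RHS]ffunE [in RHS]ffunE !mp_actE scaler_sumr -big_split.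
  by apply: eq_bigr => b _ /=; rewrite [X in act X _]ffunE [X in act (X + _) _]ffunE act_linl.
- move=> c x /= _ u v _ _; apply/ffunP => a.
  rewrite [RHS]ffunE [in RHS]ffunE !mp_actE scaler_sumr -big_split.
  by apply: eq_bigr => b _ /=; rewrite [X in act _ X]ffunE [X in act _ (X + _)]ffunE act_linr.
- move=> u /mem_MPmod uM; apply/ffunP => a; rewrite [LHS]mp_actE.
  rewrite (bigD1 a) //= big1 => [|b /negPf ba]; last first.
    by rewrite ffunE /= eq_sym ba -(scale0r 0) actZl scale0r.
  by rewrite addr0 ffunE /= eqxx; have [_ E] := uM a.
move=> x y /= xA yA u /mem_MPmod uM; apply/ffunP => a.
rewrite [LHS]mp_actE [RHS]mp_actE.
transitivity (\sum_c \sum_b act (x (a, b)) (act (y (b, c)) (u c))).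
  apply: eq_bigr => c _; rewrite ffunE /= act_suml; apply: eq_bigr => b _.
  by rewrite Pact_mul //; have [] := uM c.
rewrite exchange_big /=; apply: eq_bigr => b _.
by rewrite mp_actE act_sumr.
Qed.

End PaintedModule.

Lemma MPT_weight (l : seq nat) (r k : nat) (T : mset_filling l r k) : T \in MPT l r k ->
  exists a, has_weight a T.
Proof.
rewrite inE => /andP[_ /eqP Tr].
have Tj : (\sum_j \sum_b T b j = r)%N by rewrite exchange_big.
have le j : (\sum_b T b j < r.+1)%N by rewrite ltnS -[X in (_ <= X)%N]Tj (bigD1 j) //= leq_addr.
pose m : multiset r k := [ffun j => inord (\sum_b T b j)].
have mE j : m j = (\sum_b T b j)%N :> nat by rewrite ffunE inordK.
have ms : msize m == r by rewrite -[X in _ == X]Tj; apply/eqP/eq_bigr => j _; rewrite mE.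
by exists (exist _ m ms); apply/forallP => j /=; rewrite mE.
Qed.

Lemma has_weight_inj (l : seq nat) (r k : nat) (T : mset_filling l r k) a b :
  has_weight a T -> has_weight b T -> a = b.
Proof.
move=> /forallP Ta /forallP Tb; apply: val_inj; apply/ffunP => j; apply: val_inj.
by rewrite /= (eqP (Ta j)) (eqP (Tb j)).
Qed.

Lemma MPT_num_upper (l : seq nat) (r k : nat) (T : mset_filling l r k) :
  T \in MPT l r k -> (num_upper l <= r)%N.
Proof.
rewrite inE => /andP[/forall_inP Tup /eqP Tr].
rewrite -[X in (_ <= X)%N]Tr /num_upper -sum1_card big_mkcond /=; apply: leq_sum => b _.
by case: ifP => // /Tup.
Qed.

(** * The basis of semistandard vectors *)

Section PaintedModuleBasis.
Variables (F : numClosedFieldType) (r k n : nat) (l : seq nat).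
Hypotheses (r_gt0 : (0 < r)%N) (le2rn : (2 * r <= n)%N) (ln : partition_of n l).
Hypothesis le_mr : (num_upper l <= r)%N.
Local Notation M := (MPmod F r k n l).
Local Notation act := (@partalg_act F r n l).
Local Notation Pmod := (Pmod F r l).
Local Notation yact := (@yact F r k n l).
Local Notation inject := (@inject F r k l).
Implicit Types (a b : weight r k) (T : mset_filling l r k).

Lemma w_vectorE T a : (w_vector F n T : {ffun weight r k -> tabspace F r l}) a =
  if has_weight a T then wsum F a T else 0.
Proof. by rewrite ffunE. Qed.

Lemma w_vector_inject T a : has_weight a T -> w_vector F n T = inject a (wsum F a T).
Proof.
move=> Ta; apply/ffunP => b; rewrite w_vectorE injectE.
have [->|ba] := eqVneq b a; first by rewrite Ta.
by case: ifP => // Tb; case/eqP: ba; apply: has_weight_inj Tb Ta.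
Qed.

Lemma wsum_Pmod T a : T \in MPT l r k -> has_weight a T ->
  exists2 w, w \in Pmod & wsum F a T = yact a w.
Proof.
move=> TM Ta; have [beta ob <-] := coloring_exists TM Ta.
exists (tvec F beta); first exact: (tvec_Pmod F r_gt0 le2rn ln ob).
exact: (wsum_tvec F r_gt0 le2rn ln le_mr a ob).
Qed.

Lemma w_vector_mem T : T \in MPT l r k -> w_vector F n T \in mod_space M.
Proof.
move=> TM; have [a Ta] := MPT_weight TM; rewrite (w_vector_inject Ta).
have [w wP ->] := wsum_Pmod TM Ta.
exact: (inject_mem r_gt0 le2rn ln le_mr).
Qed.

Lemma MPmod_span (U : {vspace mod_ambient M}) :
  (forall T, T \in SSMPT l r k -> w_vector F n T \in U) -> (mod_space M <= U)%VS.
Proof.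
move=> HU; apply/subvP => u /(mem_MPmod r_gt0 le2rn ln le_mr) uM.
rewrite [u]inject_sum; apply: memv_suml => a _; have [uP <-] := uM a.
move: (u a) uP; apply: Pmod_ind => [c v w vU wU||beta ob].
- by rewrite /yact act_linr [inject a _]linearP; apply: memvD => //; apply: memvZ.
- by rewrite /yact act0r [inject a _]linear0 mem0v.
rewrite -(wsum_tvec F r_gt0 le2rn ln le_mr a ob).
suff : wsum F a (coloring a (fib beta)) \in (linfun (inject a) @^-1: U)%VS.
  by rewrite -memv_preim lfunE.
apply: (wsum_span r_gt0 le2rn ln le_mr) => [T TS Ta||].
- by rewrite -memv_preim lfunE /= -(w_vector_inject Ta); apply: HU.
- exact: coloring_MPT.
exact: coloring_weight.
Qed.

Lemma w_vector_free : free [seq w_vector F n T | T in SSMPT l r k].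
Proof.
apply: free_map => [|c c0 T]; first exact: enum_uniq.
rewrite mem_enum => TS.
have [a Ta] : exists a, has_weight a T by apply: MPT_weight; move: TS; rewrite inE => /andP[].
apply: (@wsum_free F r k l a c) => //.
have := congr1 (fun u : {ffun weight r k -> tabspace F r l} => u a) c0.
rewrite /= sum_ffunE [RHS]ffunE big_enum /= => E; rewrite -[RHS]E.
rewrite [LHS]big_mkcondr; apply: eq_bigr => T' _; rewrite [RHS]ffunE w_vectorE.
by case: ifP => // _; rewrite scaler0.
Qed.

Lemma w_vector_basis : basis_of (mod_space M) [seq w_vector F n T | T in SSMPT l r k].
Proof.
apply/andP; split; last exact: w_vector_free.
rewrite eqEsubv; apply/andP; split.
  apply/span_subvP => _ /mapP[T TS ->]; apply: (@w_vector_mem T).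
  by move: TS; rewrite mem_enum inE => /andP[].
by apply: MPmod_span => T TS; apply: memv_span; apply: map_f; rewrite mem_enum.
Qed.

Lemma w_vector_neq0 T : T \in SSMPT l r k -> w_vector F n T != 0.
Proof.
by move=> TS; apply: (free_not0 w_vector_free); apply: map_f; rewrite mem_enum.
Qed.

End PaintedModuleBasis.

(** * Irreducible and pairwise nonisomorphic modules *)

Section PaintedModuleSimple.
Variables (F : numClosedFieldType) (r k n : nat).
Hypotheses (r_gt0 : (0 < r)%N) (le2rn : (2 * r <= n)%N).
Local Notation A := (MP F r k n).
Local Notation M := (MPmod F r k n).
Implicit Types (la mu : seq nat) (x y : partalg r F).

Lemma Lambda_MPP la : Lambda_MP r k n la ->
  [/\ partition_of n la, (num_upper la <= r)%N & exists T, T \in SSMPT la r k].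
Proof.
case/andP=> pla /set0Pn[T TS]; split=> //; last by exists T.
by move: TS; rewrite inE => /andP[/MPT_num_upper].
Qed.

Definition act_on la (u : tabspace F r la) x : tabspace F r la := partalg_act n x u.

Lemma act_on_is_linear la (u : tabspace F r la) : linear (act_on u).
Proof. by move=> c x y; apply: act_linl. Qed.

HB.instance Definition _ la (u : tabspace F r la) := GRing.isLinear.Build F
  (partalg r F) (tabspace F r la) _ (act_on u) (act_on_is_linear u).

(** The vectors reached from [u] by one algebra element form a submodule, which contains [u] because
    the identity diagram acts trivially; by irreducibility it is everything. *)
Lemma Pmod_generate la u v : partition_of n la -> (num_upper la <= r)%N ->
  u \in Pmod F r la -> u != 0 -> v \in Pmod F r la -> exists x, partalg_act n x u = v.
Proof.
move=> pla le_la uP u0 vP; pose U := limg (linfun (act_on u)).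
have UP w : reflect (exists x, partalg_act n x u = w) (w \in U).
  apply: (iffP memv_imgP) => [[x _ ->]|[x <-]]; first by exists x; rewrite lfunE.
  by exists x; rewrite ?memvf // lfunE.
have [l0 l00] : (0 < size la)%N /\ (0 < nth 0 la 0)%N.
  split; first exact: (shape_size_gt0 r_gt0 le2rn pla).
  exact: leq_trans r_gt0 (first_row_ge r_gt0 le2rn pla le_la).
have [beta0 [ob0 up0 cst0]] := minimal_tableau r_gt0 l0 l00 le_la.
have sU : (U <= Pmod F r la)%VS.
  by apply/subvP => w /UP[x <-]; apply: (Pmod_act r_gt0 le2rn pla le_la).
have [x w /UP[y <-]|U0|UE] := Pmod_irreducible r_gt0 le2rn pla le_la ob0 up0 cst0 sU.
- by apply/UP; exists (partalg_mul n x y); apply: (Pmod_act_mul r_gt0 le2rn pla le_la).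
- case/eqP: u0; apply/eqP; rewrite -memv0 -U0; apply/UP; exists (perm_elt F 1%g).
  move: u uP {U UP sU U0}; apply: Pmod_ind => [c u w Eu Ew||beta ob].
  + by rewrite act_linr Eu Ew.
  + exact: act0r.
  rewrite (act_perm_tvec F r_gt0 le2rn pla le_la 1%g ob); congr (tvec F _).
  by apply/ffunP => i; rewrite ffunE invg1 perm1.
by apply/UP; rewrite UE.
Qed.

(** A nonzero submodule has a vector with a nonzero component at some [a], and a single corner from
    [a] to [b] carries it to any prescribed component at [b]. *)
Lemma MPmod_irreducible la : Lambda_MP r k n la -> irreducible_representation (M la).
Proof.
case/Lambda_MPP=> pla le_la [T TS]; split.
- exact: (MPmod_representation F k r_gt0 le2rn pla le_la).
- move=> V0; case/eqP: (w_vector_neq0 F n TS); apply/eqP; rewrite -memv0 -V0.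
  apply: (w_vector_mem F r_gt0 le2rn pla le_la).
  by move: TS; rewrite inE => /andP[].
move=> U [sU Ust]; have [->|U0] := eqVneq U 0%VS; [by left | right].
have uU := memv_pick U; set u : {ffun weight r k -> tabspace F r la} := vpick U in uU.
have uM : (u : mod_ambient (M la)) \in mod_space (M la) := subvP sU _ uU.
have /forallPn[a ua] : ~~ [forall a, u a == 0].
  apply: contra U0 => /forallP u0; rewrite -vpick0; apply/eqP/ffunP => a.
  by rewrite [RHS]ffunE; apply/eqP.
have uaP : u a \in Pmod F r la by have [] := mem_MPmod r_gt0 le2rn pla le_la _ uM a.
apply/eqP; rewrite eqEsubv sU /=; apply/subvP => w wM.
rewrite [w : {ffun weight r k -> tabspace F r la}]inject_sum; apply: memv_suml => b _.
have [wP Ew] := mem_MPmod r_gt0 le2rn pla le_la _ wM b.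
have [x Ex] := Pmod_generate pla le_la uaP ua wP.
rewrite -Ew -Ex -(corner_act r_gt0 le2rn pla le_la b a x uM).
by apply: (Ust); first exact: (corner_mem r_gt0 le2rn).
Qed.

(** The symmetrizer lies in P_r(n) and has to be brought into a corner of the painted algebra
    without losing its effect on [la]. It is framed by two elements, leading from a vector w_T to
    one that the symmetrizer does not kill, and from its image back to w_T. *)
Lemma separation la mu : Lambda_MP r k n la -> Lambda_MP r k n mu ->
  (num_upper la < num_upper mu)%N \/
  [/\ num_upper la = num_upper mu, (row_weight mu <= row_weight la)%N & la != mu] ->
  exists2 x : alg_ambient A, x \in alg_space A &
    (forall v, v \in mod_space (M mu) -> mod_act (x : alg_ambient A) v = 0) /\
    exists2 u, u \in mod_space (M la) & mod_act (x : alg_ambient A) u != 0.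
Proof.
move=> /Lambda_MPP[pla le_la [T TS]] /Lambda_MPP[pmu le_mu _] cond.
have [l0 l00] : (0 < size la)%N /\ (0 < nth 0 la 0)%N.
  split; first exact: (shape_size_gt0 r_gt0 le2rn pla).
  exact: leq_trans r_gt0 (first_row_ge r_gt0 le2rn pla le_la).
have [beta0 [ob0 up0 cst0]] := minimal_tableau r_gt0 l0 l00 le_la.
have TM : T \in MPT la r k by move: TS; rewrite inE => /andP[].
have [a Ta] := MPT_weight TM.
have uM := w_vector_mem F r_gt0 le2rn pla le_la TM.
have u0 := w_vector_neq0 F n TS.
rewrite (w_vector_inject F n Ta) in uM u0; set w := wsum F a T in uM u0.
have w0 : w != 0 by apply: contra u0 => /eqP->; rewrite linear0.
have := mem_MPmod r_gt0 le2rn pla le_la _ uM a; rewrite injectE eqxx => -[wP Ew].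
have [|P0|[t0 t0P z0]] := zop_detects r_gt0 le2rn pla le_la ob0 (subvv (Pmod F r la)).
- by move=> x v; apply: (Pmod_act r_gt0 le2rn pla le_la).
- by case/eqP: w0; apply/eqP; rewrite -memv0 -P0.
have [x Ex] := Pmod_generate pla le_la wP w0 t0P.
have Ez mu' (pmu' : partition_of n mu') (le_mu' : (num_upper mu' <= r)%N) v :=
  @act_zelt F r n la beta0 r_gt0 le2rn mu' v pmu' le_mu'.
have zP : zop n beta0 t0 \in Pmod F r la.
  by rewrite -(Ez _ pla le_la) //; apply: (Pmod_act r_gt0 le2rn pla le_la).
have [y Ey] := Pmod_generate pla le_la zP z0 wP.
exists (corner n a a (partalg_mul n y (partalg_mul n (zelt F n beta0) x))).
  exact: (corner_mem r_gt0 le2rn).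
split=> [v vM|].
  rewrite /= (corner_act r_gt0 le2rn pmu le_mu a a _ vM).
  have [vP _] := mem_MPmod r_gt0 le2rn pmu le_mu _ vM a.
  rewrite !(Pmod_act_mul r_gt0 le2rn pmu le_mu) //.
  have xvP := Pmod_act r_gt0 le2rn pmu le_mu x vP.
  rewrite (Ez _ pmu le_mu) // (zop_kill r_gt0 le2rn pla ob0 up0 cst0 pmu le_mu xvP cond).
  by rewrite act0r /yact act0r linear0.
exists (inject a w) => //=.
rewrite (corner_act r_gt0 le2rn pla le_la a a _ uM) injectE eqxx.
rewrite !(Pmod_act_mul r_gt0 le2rn pla le_la) // Ex (Ez _ pla le_la) // Ey Ew.
by apply: contra w0 => /eqP/ffunP/(_ a); rewrite injectE eqxx ffunE => ->.
Qed.

(** Isomorphic modules have the same annihilator, and two distinct shapes satisfy the condition of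
    [separation] in one order or the other. *)
Lemma MPmod_not_isomorphic la mu : Lambda_MP r k n la -> Lambda_MP r k n mu ->
  isomorphic_modules (M la) (M mu) -> la = mu.
Proof.
move=> Lla Lmu [f [fI fS fA]]; apply/eqP; apply: contraT => lamu.
have fM u : u \in mod_space (M la) -> f u \in mod_space (M mu).
  by move=> uM; rewrite -fS; apply: memv_img.
have kill (x : alg_ambient A) : x \in alg_space A ->
    (forall v, v \in mod_space (M mu) -> mod_act (x : alg_ambient A) v = 0) <->
    (forall u, u \in mod_space (M la) -> mod_act (x : alg_ambient A) u = 0).
  move=> xA; split=> [H u uM|H v].
    have [[stable _ _ _ _] _ _] := MPmod_irreducible Lla.
    by apply: fI; rewrite ?mem0v ?stable // fA // H ?fM // linear0.
  by rewrite -fS => /memv_imgP[u uM ->]; rewrite -fA // H // linear0.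
have lower_la : ~ ((num_upper la < num_upper mu)%N \/
    [/\ num_upper la = num_upper mu, (row_weight mu <= row_weight la)%N & la != mu]).
  move=> /(separation Lla Lmu)[x xA [/(kill x xA) H [u uM]]].
  by rewrite H ?eqxx.
have lower_mu : ~ ((num_upper mu < num_upper la)%N \/
    [/\ num_upper mu = num_upper la, (row_weight la <= row_weight mu)%N & mu != la]).
  move=> /(separation Lmu Lla)[x xA [H [u uM]]].
  by rewrite (proj2 (kill x xA) H) ?eqxx.
case: (ltngtP (num_upper la) (num_upper mu)) => E.
- by case: lower_la; left.
- by case: lower_mu; left.
case/orP: (leq_total (row_weight la) (row_weight mu)) => le.
  by case: lower_mu; right; rewrite eq_sym.
by case: lower_la; right.
Qed.

End PaintedModuleSimple.

(** * Products with glued diagrams *)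

Section Relabelling.

Lemma extend_injection (X Y : finType) (P : pred X) (Q : pred Y) (g : X -> Y) :
  {in P &, injective g} -> (forall x, P x -> Q (g x)) -> #|P| = #|Q| -> #|X| = #|Y| ->
  exists e : X -> Y, [/\ injective e, forall x, P x -> e x = g x & forall x, Q (e x) = P x].
Proof.
move=> gI gQ PQ XY; pose eX := enum [predC P]; pose eY := enum [predC Q].
have sE : size eX = size eY.
  by rewrite -!cardE; apply/eqP; rewrite -(eqn_add2l #|P|) cardC {1}PQ cardC XY.
pose e x := if P x then g x else nth (g x) eY (index x eX).
have lt x : ~~ P x -> (index x eX < size eY)%N.
  by move=> Px; rewrite -sE index_mem mem_enum.
have nQ x : ~~ P x -> ~~ Q (e x).
  move=> Px; rewrite /e (negPf Px).
  by have := mem_nth (g x) (lt x Px); rewrite mem_enum.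
have eQ x : Q (e x) = P x.
  by case: (boolP (P x)) => [Px|/nQ/negPf//]; rewrite /e Px gQ.
exists e; split=> // [x y E|x Px]; last by rewrite /e Px.
have := congr1 Q E; rewrite !eQ => PE; case: (boolP (P x)) => Px; move: E; rewrite /e -PE.
  by rewrite Px => /gI; apply; rewrite // /in_mem /= -?PE.
have Py : ~~ P y by rewrite -PE.
rewrite (negPf Px) (set_nth_default (g x) (g y)) ?lt // => /eqP.
rewrite nth_uniq ?enum_uniq ?lt // => /eqP E.
by rewrite -(nth_index x (_ : x \in eX)) ?mem_enum // E nth_index ?mem_enum.
Qed.

Lemma glue_eq (r : nat) (M K M' K' : eqType) (beta gamma : 'I_r -> M + K)
    (beta' gamma' : 'I_r -> M' + K') :
  (forall x y, beta x = beta y <-> beta' x = beta' y) ->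
  (forall x y, gamma x = gamma y <-> gamma' x = gamma' y) ->
  (forall x y, (exists2 m, beta x = inl m & gamma y = inl m) <->
               (exists2 m, beta' x = inl m & gamma' y = inl m)) ->
  glue beta gamma = glue beta' gamma'.
Proof.
move=> Eb Eg Ex; rewrite /glue; congr diagram_of; rewrite /kernel_sets.
apply: eq_imset => u; apply/setP => v; rewrite !inE.
suff E : glue_label beta gamma v = glue_label beta gamma u <->
    glue_label beta' gamma' v = glue_label beta' gamma' u.
  by apply/eqP/eqP => /E.
case: v u => [x|x] [y|y].
- by rewrite (glue_topE beta gamma) (glue_topE beta' gamma').
- by rewrite (glue_crossE beta gamma) (glue_crossE beta' gamma').
- split=> /esym H; apply/esym.
    by apply/(glue_crossE beta' gamma')/Ex/(glue_crossE beta gamma).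
  by apply/(glue_crossE beta gamma)/Ex/(glue_crossE beta' gamma').
by rewrite (glue_botE beta gamma) (glue_botE beta' gamma').
Qed.

Lemma box_glue_relabel (r : nat) (l l' : seq nat) (e : box l -> box l')
    (beta gamma : {ffun 'I_r -> box l}) : injective e ->
  (forall x y, beta x = gamma y -> up (e (beta x)) = up (beta x)) ->
  box_glue [ffun x => e (beta x)] [ffun x => e (gamma x)] = box_glue beta gamma.
Proof.
move=> eI eu; have mE (b c : 'I_r -> box l) x y :
    mark (e (b x)) = mark (e (c y)) <-> mark (b x) = mark (c y).
  by split=> [/mark_inj/eI->|/mark_inj->].
apply: glue_eq => x y; rewrite ?ffunE ?mE //.
split=> -[m /mark_inl[u1 <-] /mark_inl[u2]] => [/eI E|E].
  have ub : up (beta x) by rewrite -(eu x y).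
  by exists (beta x); apply/mark_inl; split=> //; rewrite E.
have ue : up (e (beta x)) by rewrite (eu x y).
by exists (e (beta x)); apply/mark_inl; split=> //; rewrite E.
Qed.

(* Any shape with m boxes above the first row would do. *)
Definition hook (n m : nat) : seq nat := (n - m)%N :: nseq m 1%N.

Lemma hook_partition n m : (m < n)%N -> partition_of n (hook n m).
Proof.
move=> mn; have nm0 : (0 < n - m)%N by rewrite subn_gt0.
apply/and3P; split.
- rewrite /= (path_sortedE (rev_trans leq_trans)); apply/andP; split.
    by rewrite all_nseq /geq /= nm0 orbT.
  by elim: m {mn nm0} => [|[|m] IH].
- by rewrite inE eq_sym (gtn_eqF nm0) mem_nseq andbF.
by rewrite /= sumn_nseq mul1n subnK // ltnW.
Qed.

End Relabelling.

Lemma hook_num_upper r n m : (0 < r)%N -> (2 * r <= n)%N -> (m <= r)%N -> num_upper (hook n m) = m.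
Proof.
move=> r_gt0 le2rn mr; have mn : (m < n)%N by lia.
have := card_first_row r_gt0 le2rn (hook_partition mn) => /=.
by move: mn; lia.
Qed.

(** * Products of diagrams with glued half-diagrams *)

Section DiagramProducts.
Variables (F : fieldType) (r n : nat) (l : seq nat).
Hypotheses (r_gt0 : (0 < r)%N) (le2rn : (2 * r <= n)%N) (ln : partition_of n l).
Hypothesis le_mr : (num_upper l <= r)%N.
Hypothesis char0 : forall m : nat, m.+1%:R != 0 :> F.
Implicit Types (p : diagram r) (beta gamma : {ffun 'I_r -> box l}).
Local Notation "x ** y" := (partalg_mul n x y) (at level 40, left associativity).
Local Notation dia p := (diag_elt F (val p)).

(** A mark that does not join top to bottom may be treated as an unmarked label: the boxes are
    transported to a shape with one upper box fewer, [b] going to the first row. *)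
Lemma box_glue_miss beta gamma b : up b ->
  (forall x y, beta x = gamma y -> beta x != b) ->
  exists beta' gamma' : {ffun 'I_r -> box (hook n (num_upper l).-1)},
    box_glue beta gamma = box_glue beta' gamma'.
Proof.
move=> ub miss; have mr := le_mr; set m := num_upper l in mr *.
have m0 : (0 < m)%N by apply/card_gt0P; exists b.
have m1r : (m.-1 <= r)%N by lia.
have lh : partition_of n (hook n m.-1) by apply: hook_partition; move: le2rn r_gt0; lia.
pose P := [pred c : box l | up c & c != b].
pose Q := [pred c : box (hook n m.-1) | up c].
have PQ : #|P| = #|Q|.
  rewrite [RHS](hook_num_upper r_gt0 le2rn m1r); have := cardD1 b [pred c : box l | up c].
  rewrite inE ub -[#|[pred c : box l | up c]|]/m => ->; rewrite add1n /=.
  by apply: eq_card => c; rewrite !inE andbC.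
have XY : #|box l| = #|box (hook n m.-1)| by rewrite (card_box ln) (card_box lh).
have sPQ : size (enum P) = size (enum Q) by rewrite -!cardE.
have [c0 _] : exists c : box (hook n m.-1), true.
  have : (0 < #|box (hook n m.-1)|)%N by rewrite -XY; apply/card_gt0P; exists b.
  by case/card_gt0P=> c _; exists c.
pose g (c : box l) := nth c0 (enum Q) (index c (enum P)).
have [c c' Pc Pc'||e [eI _ eQ]] := @extend_injection _ _ P Q g _ _ PQ XY.
- move=> /eqP; rewrite nth_uniq ?enum_uniq -?sPQ ?index_mem ?mem_enum //.
  by move=> /eqP E; rewrite -(nth_index c (_ : c \in enum P)) ?mem_enum // E nth_index ?mem_enum.
- move=> c Pc; have : g c \in enum Q by rewrite mem_nth // -sPQ index_mem mem_enum.
  by rewrite mem_enum.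
exists [ffun x => e (beta x)], [ffun x => e (gamma x)].
apply/esym/box_glue_relabel => // x y xy.
by have := eQ (beta x); rewrite /= (miss x y xy) andbT.
Qed.

Section Values.
Variable Om : finType.
Implicit Types (f g h : {ffun 'I_r -> Om}) (w : Om).

(** The constraint that [gamma] and the bottom word impose on the upper letters. With it a glued
    diagram becomes, as a function of its top word, a tensor of the kind handled by [vsum]. *)
Definition zval gamma h (phi : {ffun box l -> Om}) : bool :=
  bcompat gamma h && [forall y, up (gamma y) ==> (phi (gamma y) == h y)].

Lemma rho_box_glue w beta gamma g h : onto beta ->
  rho (val (box_glue beta gamma)) g h =
  bcompat beta g && zval gamma h (upval w beta g).
Proof.
move=> /ontoP ob; apply/rho_glueP/andP => [[Hb Hg Hx]|[Hb /andP[Hg /forallP Hx]]].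
  have bg : bcompat beta g by apply/bcompatP => x y xy; apply: Hb; rewrite xy.
  split=> //; apply/andP; split; first by apply/bcompatP => x y xy; apply: Hg; rewrite xy.
  apply/forallP => y; apply/implyP => uy; have [x xy] := ob _ uy.
  have -> : upval w beta g (gamma y) = g x by rewrite -xy upvalE // xy.
  by apply/eqP; apply: (Hx x y (gamma y)); apply/mark_inl; rewrite ?xy.
split=> [x y /mark_inj|x y /mark_inj|x y b /mark_inl[ux xb] /mark_inl[uy yb]].
- exact: (bcompatP _ _ Hb).
- exact: (bcompatP _ _ Hg).
have := Hx y; rewrite uy /= => /eqP <-; rewrite yb -xb upvalE //.
Qed.

End Values.

Lemma rhoM_diag_glue (w : 'I_n) p beta gamma (f h : {ffun 'I_r -> 'I_n}) : onto beta ->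
  rhoM f h (dia p ** dia (box_glue beta gamma)) =
  vsum w p beta f (fun phi => (zval gamma h phi)%:R).
Proof.
move=> ob; rewrite (rhoM_ord_mul r_gt0 le2rn); apply: eq_bigr => g _.
rewrite (rhoM_diag F f g (valP p)) (rhoM_diag F g h (valP (box_glue beta gamma))).
by rewrite (rho_box_glue w) // -!natrM !mulnb andbA.
Qed.

Lemma diag_glue_nonzero p beta beta' gamma : onto beta -> onto beta' -> act_spec p beta beta' ->
  dia p ** dia (box_glue beta gamma) =
  n%:R ^+ act_exponent p (tab beta) *: dia (box_glue beta' gamma).
Proof.
move=> ob ob' s; apply: (partalg_ext le2rn) => f h.
have n0 : (0 < n)%N by apply: leq_trans le2rn; rewrite muln_gt0.
pose w := Ordinal n0; rewrite (rhoM_diag_glue w) // (vsum_spec _ _ _ ob ob' s) card_ord.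
rewrite linearZ /= rhoM_diag ?(valP (box_glue beta' gamma)) // (rho_box_glue w) //.
by rewrite -[RHS]/(_ * _) -mulnb natrM mulrA.
Qed.

Definition merge (b b' : box l) beta : {ffun 'I_r -> box l} :=
  [ffun x => if beta x == b' then b else beta x].

(** Words passing through [p] agree on the two blocks, so joining their marks leaves the product
    unchanged and frees the second box. *)
Lemma diag_glue_merge p beta gamma x0 y0 : up (beta x0) -> up (beta y0) ->
  aconn p beta (inr x0) (inr y0) ->
  dia p ** dia (box_glue beta gamma) =
  dia p ** dia (box_glue (merge (beta x0) (beta y0) beta) (merge (beta x0) (beta y0) gamma)).
Proof.
move=> ux uy xy; apply: (partalg_ext le2rn) => f h.
have H (q : diagram r) : rhoM f h (dia p ** dia q) =
    \sum_g (rho (val p) f g)%:R * (rho (val q) g h)%:R :> F.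
  rewrite (rhoM_ord_mul r_gt0 le2rn); apply: eq_bigr => g _.
  by rewrite (rhoM_diag F f g (valP p)) (rhoM_diag F g h (valP q)).
rewrite [LHS]H [RHS]H; apply: eq_bigr => g _.
have guard (b1 b2 b3 : bool) : (b1 -> b2 = b3) -> b1%:R * b2%:R = b1%:R * b3%:R :> F.
  by case: b1 => [->|_]; rewrite // !mul0r.
apply: guard => R.
set b := beta x0 in ux *; set b' := beta y0 in uy *.
have mergeb (c : {ffun 'I_r -> box l}) x : merge b b' c x = b -> c x = b \/ c x = b'.
  by rewrite ffunE; case: eqP => [->|_]; [right | left].
have mergen (c : {ffun 'I_r -> box l}) x : merge b b' c x != b -> merge b b' c x = c x.
  by rewrite ffunE; case: ifP => // _; rewrite eqxx.
apply/rho_glueP/rho_glueP => -[Hb Hg Hx]; last first.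
  split=> [x y /mark_inj E|x y /mark_inj E|x y c /mark_inl[uc xc] /mark_inl[_ yc]].
  - by apply: Hb; rewrite !ffunE E.
  - by apply: Hg; rewrite !ffunE E.
  apply: (Hx x y (if c == b' then b else c)); apply/mark_inl; rewrite ffunE ?xc ?yc.
    by case: ifP => // _; rewrite -xc.
  by case: ifP => // _; rewrite -xc.
have bg : bcompat beta g by apply/bcompatP => x y E; apply: Hb; rewrite E.
have gg : g x0 = g y0 by have := acompat_eq R bg xy.
have gb x : merge b b' beta x = b -> g x = g x0.
  by case/mergeb => [|xb]; [move/(bcompatP _ _ bg) | rewrite gg; exact: (bcompatP _ _ bg)].
have hb y : merge b b' gamma y = b -> h y = g x0.
  case/mergeb => yb; apply/esym.
    by apply: (Hx x0 y b); apply/mark_inl; rewrite ?yb.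
  by rewrite gg; apply: (Hx y0 y b'); apply/mark_inl; rewrite ?yb.
split=> [x y /mark_inj|x y /mark_inj|x y c /mark_inl[uc xc] /mark_inl[_ yc]].
- have [xb|xb] := eqVneq (merge b b' beta x) b => E; first by rewrite !gb -?E.
  by apply: (bcompatP _ _ bg); rewrite -mergen // E mergen // -E.
- have [xb|xb] := eqVneq (merge b b' gamma x) b => E; first by rewrite !hb -?E.
  by apply: Hg; congr mark; rewrite -mergen // E mergen // -E.
have [cb|cb] := eqVneq c b; first by rewrite gb ?hb ?xc ?yc.
have bx : beta x = c by rewrite -mergen xc.
rewrite xc in uc.
have gy : gamma y = c by rewrite -mergen yc.
by apply: (Hx x y c); apply/mark_inl; rewrite ?bx ?gy.
Qed.

(** The first row has at least r boxes, and at most r - 1 of them are used because [y0] lies above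
    it. *)
Lemma free_first_row_box gamma b y0 : up b -> gamma y0 = b ->
  exists2 c, ~~ up c & forall y, gamma y != c.
Proof.
move=> ub y0b; case: (pickP [pred c | ~~ up c & [forall y, gamma y != c]]) => [c /andP[uc /forallP H]|no].
  by exists c.
have sub : [set c | ~~ up c] \subset gamma @: [set~ y0].
  apply/subsetP => c; rewrite inE => uc.
  have := no c; rewrite /= uc /= => /negbT/forallPn[y /negPn/eqP yc].
  apply/imsetP; exists y; rewrite // !inE; apply: contraNneq uc => yy.
  by rewrite -yc yy y0b.
have := leq_trans (subset_leq_card sub) (leq_imset_card _ _).
have := cardC [pred c : box l | up c]; rewrite (card_box ln).
rewrite cardsC1 card_ord cardsE -[#|[pred c : box l | up c]|]/(num_upper l) => E.
have -> : #|[pred c : box l | ~~ up c]| = (n - num_upper l)%N.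
  by rewrite -E addKn; apply: eq_card.
by have := le_mr; move: le2rn r_gt0; lia.
Qed.

(** The letter at [b] is free under the sum. Among the n cyclic shifts of the alphabet exactly one
    satisfies the constraint at [y0], so n times the product is the product with this constraint
    dropped, that is, with the class of [y0] unmarked. *)
Lemma diag_glue_reset (w : 'I_n) p beta gamma b y0 : onto beta -> up b -> gamma y0 = b ->
  (forall s (f : {ffun 'I_r -> 'I_n}) (Z : {ffun box l -> 'I_n} -> F),
     vsum w p beta f Z = vsum w p beta f (Z \o updv b s)) ->
  exists2 gamma' : {ffun 'I_r -> box l}, (forall y, gamma' y != b) &
    n%:R *: (dia p ** dia (box_glue beta gamma)) = dia p ** dia (box_glue beta gamma').
Proof.
move=> ob ub y0b inv; have [c uc cf] := free_first_row_box ub y0b.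
have cb : c != b by apply: contraNneq uc => ->.
pose gamma' : {ffun 'I_r -> box l} := [ffun y => if gamma y == b then c else gamma y].
exists gamma'; first by move=> y; rewrite ffunE; case: ifP => [_|/negbT].
apply: (partalg_ext le2rn) => f h.
transitivity (n%:R * rhoM f h (dia p ** dia (box_glue beta gamma))); first exact: linearZ.
rewrite [X in _ * X](rhoM_diag_glue w p gamma f h ob) [RHS](rhoM_diag_glue w p gamma' f h ob).
have n0 : (0 < n)%N by exact: leq_ltn_trans (leq0n _) (ltn_ord w).
have shI u : injective (fun v : 'I_n => Ordinal (ltn_pmod (u + v) n0)).
  move=> v v' /(congr1 val) /= /eqP; rewrite eqn_modDl !modn_small // => /eqP.
  exact: val_inj.
pose sh u := perm (@shI u).
transitivity (\sum_(u < n) vsum w p beta f (fun phi => (zval gamma h phi)%:R : F)).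
  by rewrite sumr_const card_ord mulr_natl.
rewrite (eq_bigr (fun u : 'I_n => vsum w p beta f
   ((fun phi => (zval gamma h phi)%:R : F) \o updv b (sh (val u))))) => [|u _]; last exact: inv.
rewrite exchange_big; apply: eq_bigr => g _ /=; rewrite -mulr_sumr; congr (_ * _).
move: (upval _ _ _) => phi.
have bc : bcompat gamma' h = bcompat gamma h.
  have gE x y : gamma' x = gamma' y <-> gamma x = gamma y.
    rewrite !ffunE; split=> [|->//].
    case: ifP => [/eqP->|_]; case: ifP => [/eqP->|_] // E.
      by case/eqP: (cf y).
    by case/eqP: (cf x).
  by apply/bcompatP/bcompatP => H x y /gE; apply: H.
have zE s : zval gamma h (updv b s phi) = zval gamma' h phi && (s (phi b) == h y0).
  rewrite /zval bc -andbA; case B : (bcompat gamma h) => //=.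
  apply/forallP/andP => [H|[/forallP H1 /eqP H2] y].
    split; last by have := H y0; rewrite y0b ub /= ffunE eqxx.
    apply/forallP => y; rewrite ffunE; have [_|yb] := eqVneq (gamma y) b.
      by rewrite (negPf uc).
    by have := H y; rewrite ffunE (negPf yb).
  rewrite ffunE; have [yb|yb] := eqVneq (gamma y) b.
    by rewrite yb ub /= H2; apply/eqP/(bcompatP _ _ B); rewrite yb.
  by have := H1 y; rewrite ffunE (negPf yb).
rewrite (eq_bigr (fun u : 'I_n => (zval gamma' h phi)%:R * (sh (val u) (phi b) == h y0)%:R)).
  rewrite -mulr_sumr; case: (zval gamma' h phi); rewrite ?mul0r // mul1r.
  have addI : injective (fun u : 'I_n => sh (val u) (phi b)).
    move=> u v; rewrite !permE => /(congr1 val) /= /eqP.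
    by rewrite eqn_modDr !modn_small // => /eqP/val_inj.
  have [u0 Eu0] : exists u0 : 'I_n, sh (val u0) (phi b) = h y0.
    by have [t _ tK] := injF_bij addI; exists (t (h y0)); apply: tK.
  rewrite (bigD1 u0) //= Eu0 eqxx big1 ?addr0 // => u uu.
  case: eqP => // E; case/eqP: uu; apply: addI; rewrite E -Eu0 //.
by move=> u _; rewrite zE -mulnb natrM.
Qed.

(** In both ways of vanishing, a nonzero multiple of the product can be rewritten with a glued
    diagram one of whose marks no longer propagates. *)
Lemma diag_glue_zero p beta gamma : onto beta -> onto gamma -> ~~ act_nonzero p (tab beta) ->
  exists (c : F) b (beta' gamma' : {ffun 'I_r -> box l}),
    [/\ c != 0, up b, (forall x y, beta' x = gamma' y -> beta' x != b) &
    c *: (dia p ** dia (box_glue beta gamma)) = dia p ** dia (box_glue beta' gamma')].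
Proof.
move=> ob og nz; have n0 : (0 < n)%N by move: le2rn r_gt0; lia.
have [[x [y [ux uy nxy xy]]]|[x [ux inv]]] := vsum_zero (Ordinal n0) F nz.
  exists 1, (beta y), (merge (beta x) (beta y) beta), (merge (beta x) (beta y) gamma).
  split; [exact: oner_neq0 | exact: uy | | by rewrite scale1r; apply: diag_glue_merge].
  move=> z _ _; rewrite ffunE; case: ifP => [_|/negbT zy]; [exact: nxy | exact: zy].
have [y yx] := (ontoP _ og) _ ux.
have [gamma' gb E] := diag_glue_reset ob ux yx inv.
exists n%:R, (beta x), beta, gamma'; split; [|exact: ux| |exact: E].
  by rewrite -(prednK n0) char0.
by move=> z t ->; apply: gb.
Qed.

End DiagramProducts.

(** * Completeness *)

Section MPRepresentation.
Variables (F : numClosedFieldType) (r k n : nat).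
Hypotheses (r_gt0 : (0 < r)%N) (le2rn : (2 * r <= n)%N).
Local Notation A := (MP F r k n).
Local Notation "x ** y" := (partalg_mul n x y) (at level 40, left associativity).
Local Notation "'s_ a" := (young_idem F a) (at level 8, a at level 2).
Local Notation dia p := (diag_elt F (val p)).
Variable N : module A.
Hypothesis repN : is_representation N.
Local Notation NS := (mod_space N).
Implicit Types (a b c : weight r k) (x y : partalg r F) (u v : mod_ambient N).

Let idemK a : 's_a ** 's_a = 's_a := young_idemK r_gt0 le2rn (@char0F F) a.
Let mulA x y z : x ** (y ** z) = x ** y ** z := pmulA r_gt0 le2rn x y z.
Let cmem a b x : (corner n a b x : alg_ambient A) \in alg_space A := corner_mem r_gt0 le2rn a b x.

Definition Phi b a x u : mod_ambient N := mod_act (corner n b a x : alg_ambient A) u.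

Lemma mod_act0r (X : alg_ambient A) : X \in alg_space A -> mod_act (m := N) X 0 = 0.
Proof.
case: repN => _ _ lin _ _ XA; have := lin (-1) X XA 0 0 (mem0v _) (mem0v _).
by rewrite scaler0 addr0 scaleN1r addNr.
Qed.

Lemma mod_act_sumr (X : alg_ambient A) (I : Type) (e : seq I) (G : I -> mod_ambient N) :
  X \in alg_space A -> (forall i, G i \in NS) ->
  mod_act X (\sum_(i <- e) G i) = \sum_(i <- e) mod_act X (G i).
Proof.
case: repN => _ _ lin _ _ XA GN; elim: e => [|i e IH]; first by rewrite !big_nil mod_act0r.
rewrite !big_cons -IH; have := lin 1 X XA (G i) (\sum_(j <- e) G j) (GN i).
by rewrite !scale1r; apply; apply: memv_suml.
Qed.

Lemma mod_act0l u : u \in NS -> mod_act (0 : alg_ambient A) u = 0.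
Proof.
case: repN => _ lin _ _ _ uN; have := lin (-1) 0 0 (mem0v _) (mem0v _) u uN.
by rewrite scaler0 addr0 scaleN1r addNr.
Qed.

Lemma mod_act_suml (I : Type) (e : seq I) (G : I -> alg_ambient A) u :
  (forall i, G i \in alg_space A) -> u \in NS ->
  mod_act (\sum_(i <- e) G i) u = \sum_(i <- e) mod_act (G i) u.
Proof.
case: repN => _ lin _ _ _ GA uN; elim: e => [|i e IH]; first by rewrite !big_nil mod_act0l.
have SA : \sum_(j <- e) G j \in alg_space A by apply: memv_suml.
by rewrite !big_cons -IH; have := lin 1 (G i) _ (GA i) SA u uN; rewrite !scale1r.
Qed.

Lemma Phi_mem b a x u : u \in NS -> Phi b a x u \in NS.
Proof. by case: repN => st _ _ _ _ uN; apply: st => //; apply: cmem. Qed.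

Lemma Phi_linl b a (c : F) x y u : u \in NS ->
  Phi b a (c *: x + y) u = c *: Phi b a x u + Phi b a y u.
Proof.
case: repN => _ lin _ _ _ uN; rewrite /Phi (corner_linear r_gt0 le2rn).
by apply: lin => //; apply: cmem.
Qed.

Lemma Phi0l b a u : u \in NS -> Phi b a 0 u = 0.
Proof. by move=> uN; have := Phi_linl b a (-1) 0 0 uN; rewrite scaler0 addr0 scaleN1r addNr. Qed.

Lemma PhiZl b a (c : F) x u : u \in NS -> Phi b a (c *: x) u = c *: Phi b a x u.
Proof. by move=> uN; have := Phi_linl b a c x 0 uN; rewrite Phi0l // !addr0. Qed.

Lemma Phi_suml b a (I : Type) (e : seq I) (P : pred I) (G : I -> partalg r F) u : u \in NS ->
  Phi b a (\sum_(i <- e | P i) G i) u = \sum_(i <- e | P i) Phi b a (G i) u.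
Proof.
move=> uN; apply: (big_morph (fun x => Phi b a x u)) => [x y|]; last exact: Phi0l.
by have := Phi_linl b a 1 x y uN; rewrite !scale1r.
Qed.

Lemma Phi_mul c b b' a y x u : u \in NS ->
  Phi c b y (Phi b' a x u) = if b == b' then Phi c a (y ** 's_b ** x) u else 0.
Proof.
case: repN => _ _ _ _ mul uN; rewrite /Phi -mul ?cmem //.
have -> : alg_mul (corner n c b y : alg_ambient A) (corner n b' a x) =
   if b == b' then corner n c a (y ** 's_b ** x) else 0.
  exact: (corner_mul r_gt0 le2rn).
by case: ifP => // _; rewrite mod_act0l.
Qed.

Lemma Phi_perm b a s x u : s \in young_subgroup b ->
  Phi b a (perm_elt F s ** x) u = Phi b a x u.
Proof.
move=> sb; rewrite /Phi; congr (mod_act _ u); apply/ffunP => -[c d].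
by rewrite !cornerE mulA (young_idem_perm F r_gt0 le2rn sb).
Qed.

Lemma Phi_one u : u \in NS -> u = \sum_a Phi a a (perm_elt F 1%g) u.
Proof.
case: repN => _ _ _ one _ uN; rewrite -[LHS]one //.
rewrite [alg_one A](one_corner F k r_gt0 le2rn) mod_act_suml // => a; exact: cmem.
Qed.

Lemma mod_act_Phi (X : {ffun weight r k * weight r k -> partalg r F}) u :
  (X : alg_ambient A) \in alg_space A -> u \in NS ->
  mod_act (X : alg_ambient A) u = \sum_(ab : weight r k * weight r k) Phi ab.1 ab.2 (X ab) u.
Proof.
move=> XA uN; rewrite {1}[X](corner_sum r_gt0 le2rn XA) mod_act_suml // => ab; exact: cmem.
Qed.

(* These elements form a left ideal, in general not a right ideal. *)
Definition killed x : Prop := forall b a y u, u \in NS -> Phi b a (y ** x) u = 0.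

Lemma killed_Phi x b a u : killed x -> u \in NS -> Phi b a x u = 0.
Proof. by move=> kx uN; rewrite -(perm_elt1_mul r_gt0 le2rn x) kx. Qed.

Lemma killed_mul x y : killed x -> killed (y ** x).
Proof. by move=> kx b a z u uN; rewrite mulA kx. Qed.

Lemma killed_sum (I : Type) (e : seq I) (P : pred I) (G : I -> partalg r F) :
  (forall i, killed (G i)) -> killed (\sum_(i <- e | P i) G i).
Proof.
move=> kG b a y u uN; rewrite (pmul_sumr r_gt0 le2rn) Phi_suml // big1 // => i _; exact: kG.
Qed.

Lemma killedZ (c : F) x : killed x -> killed (c *: x).
Proof. by move=> kx b a y u uN; rewrite (pmulZr r_gt0 le2rn) PhiZl // kx // scaler0. Qed.

Lemma killed_scaled (c : F) x : c != 0 -> killed (c *: x) -> killed x.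
Proof. by move=> c0 /(killedZ c^-1); rewrite scalerA mulVf // scale1r. Qed.

Lemma not_killed_one : NS <> 0%VS -> ~ killed (perm_elt F 1%g).
Proof.
move=> N0 k1; apply: N0; apply/eqP; rewrite -subv0; apply/subvP => u uN.
by rewrite memv0 [u]Phi_one // big1 // => a _; apply: killed_Phi.
Qed.

Lemma box_glue_one (l : seq nat) (beta : {ffun 'I_r -> box l}) : injective beta ->
  (forall i, up (beta i)) -> dia (box_glue beta beta) = perm_elt F 1%g.
Proof.
move=> bI bu; apply: (partalg_ext le2rn) => f g.
rewrite (rhoM_diag F f g (valP (box_glue beta beta))) rhoM_perm; congr (_%:R : F); congr nat_of_bool.
have -> : [ffun i => f ((1%g : 'S_r) i)] = f by apply/ffunP => i; rewrite ffunE perm1.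
apply/rho_glueP/eqP => [[_ _ H]|->].
  by apply/ffunP => i; apply/esym; apply: (H i i (beta i)); apply/mark_inl; rewrite bu.
split=> [x y /mark_inj/bI->|x y /mark_inj/bI->|x y b /mark_inl[_ <-] /mark_inl[_ /bI->]] //.
Qed.

(** Glued diagrams over a shape with m upper boxes have at most m propagating blocks; some such
    diagram acts nontrivially, possibly after multiplication on the left. *)
Definition marked m : Prop := exists l, [/\ partition_of n l, num_upper l = m, (m <= r)%N &
  exists beta gamma : {ffun 'I_r -> box l}, ~ killed (dia (box_glue beta gamma))].

Lemma marked_r : NS <> 0%VS -> marked r.
Proof.
move=> N0; have rn : (r < n)%N by move: r_gt0 le2rn; lia.
have ph := hook_partition rn; have hr := hook_num_upper r_gt0 le2rn (leqnn r).
exists (hook n r); split=> //.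
have sE : #|[pred b : box (hook n r) | up b]| = r by exact: hr.
pose beta : {ffun 'I_r -> box (hook n r)} := [ffun x => enum_val (cast_ord (esym sE) x)].
have bI : injective beta by move=> x y; rewrite !ffunE => /enum_val_inj/cast_ord_inj.
have bu i : up (beta i) by rewrite ffunE; have := enum_valP (cast_ord (esym sE) i).
by exists beta, beta; rewrite box_glue_one //; apply: not_killed_one.
Qed.

End MPRepresentation.

(** * Families of vectors of N indexed by half-diagrams *)

Section DiagramFamilies.
Variables (F : numClosedFieldType) (r k n : nat).
Hypotheses (r_gt0 : (0 < r)%N) (le2rn : (2 * r <= n)%N).
Local Notation A := (MP F r k n).
Local Notation "x ** y" := (partalg_mul n x y) (at level 40, left associativity).
Local Notation "'s_ a" := (young_idem F a) (at level 8, a at level 2).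
Local Notation dia p := (diag_elt F (val p)).
Variable N : module A.
Hypothesis repN : is_representation N.
Local Notation NS := (mod_space N).
Implicit Types (a b : weight r k) (u v : mod_ambient N).
Variable m : nat.
Hypothesis le_mr : (m <= r)%N.
Hypothesis miss_killed : forall (l : seq nat) (beta gamma : {ffun 'I_r -> box l}) (b : box l),
  partition_of n l -> num_upper l = m -> up b ->
  (forall x y, beta x = gamma y -> beta x != b) -> killed N (dia (box_glue beta gamma)).
Variables (a0 : weight r k) (u0 : mod_ambient N).
Hypothesis u0N : u0 \in NS.

(** The bottom halves are frozen into the coefficients [C], so that diagrams act on the top half
    [beta] as they act on labellings. *)
Definition half_sum (l : seq nat) (C : {ffun 'I_r -> box l} -> F) (beta : {ffun 'I_r -> box l}) :
  partalg r F := \sum_gamma C gamma *: dia (box_glue beta gamma).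

(* These vectors of N are to become the images of the polytabloids of shape [l]. *)
Definition vfam l C b (beta : {ffun 'I_r -> box l}) : mod_ambient N :=
  Phi b a0 (half_sum C beta) u0.

Lemma vfam_mem l (C : {ffun 'I_r -> box l} -> F) b beta : vfam C b beta \in NS.
Proof. exact: Phi_mem. Qed.

Lemma vfam_sum l (C : {ffun 'I_r -> box l} -> F) b beta :
  vfam C b beta = \sum_gamma C gamma *: Phi b a0 (dia (box_glue beta gamma)) u0.
Proof.
rewrite /vfam Phi_suml //; apply: eq_bigr => gamma _; exact: PhiZl.
Qed.

Lemma vfam_reindex l l' (e : box l -> box l') (e' : box l' -> box l)
    (C : {ffun 'I_r -> box l'} -> F) b (beta : {ffun 'I_r -> box l}) :
  cancel e e' -> cancel e' e -> (forall c, up (e c) = up c) ->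
  vfam C b [ffun x => e (beta x)] =
  vfam (fun gamma : {ffun 'I_r -> box l} => C [ffun x => e (gamma x)]) b beta.
Proof.
move=> eK e'K eu; rewrite /vfam; congr (Phi _ _ _ _); rewrite /half_sum.
pose h (gamma : {ffun 'I_r -> box l}) : {ffun 'I_r -> box l'} := [ffun x => e (gamma x)].
pose h' (gamma : {ffun 'I_r -> box l'}) : {ffun 'I_r -> box l} := [ffun x => e' (gamma x)].
have hB : bijective h.
  by exists h' => gamma; apply/ffunP => x; rewrite !ffunE ?eK ?e'K.
rewrite (reindex h); last exact: onW_bij.
apply: eq_bigr => gamma _.
by rewrite /h (box_glue_relabel (can_inj eK) (fun x y _ => eu (beta x))).
Qed.

Lemma vfam_row0 l (C : {ffun 'I_r -> box l} -> F) b (s : {perm box l}) (beta : {ffun 'I_r -> box l}) :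
  (forall c, up c -> s c = c) -> vfam C b [ffun x => s (beta x)] = vfam C b beta.
Proof.
move=> su; suff E : half_sum C [ffun x => s (beta x)] = half_sum C beta by rewrite /vfam E.
apply: eq_bigr => gamma _.
have us c : up (s c) -> s c = c by move=> /su/perm_inj.
suff -> : box_glue [ffun x => s (beta x)] gamma = box_glue beta gamma by [].
apply: glue_eq => x y; rewrite ?ffunE.
- by split=> [/mark_inj/perm_inj->|/mark_inj->].
- by [].
split=> -[d /mark_inl[ud <-] yd]; exists (beta x).
- by apply/mark_inl; rewrite -(us _ ud).
- by rewrite yd us.
- by apply/mark_inl; rewrite su.
exact: yd.
Qed.

(** Permutations of the top vertices inside the intervals of [b] are absorbed by s_b; the family at
    [b] thus only depends on the coloring. *)
Lemma vfam_young l (C : {ffun 'I_r -> box l} -> F) b s (beta : {ffun 'I_r -> box l}) :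
  s \in young_subgroup b -> vfam C b [ffun x => beta (s^-1 x)%g] = vfam C b beta.
Proof.
move=> sb; suff E : perm_elt F s ** half_sum C beta = half_sum C [ffun x => beta (s^-1 x)%g].
  by rewrite /vfam -E (Phi_perm r_gt0 le2rn a0 _ u0 sb).
rewrite /half_sum (pmul_sumr r_gt0 le2rn); apply: eq_bigr => gamma _.
rewrite (pmulZr r_gt0 le2rn).
suff -> : perm_elt F s ** dia (box_glue beta gamma) =
  dia (box_glue [ffun x => beta (s^-1 x)%g] gamma) by [].
apply: (partalg_ext le2rn) => f h.
rewrite (rhoM_perm_mul r_gt0 le2rn).
rewrite (rhoM_diag F _ h (valP (box_glue beta gamma))).
rewrite (rhoM_diag F f h (valP (box_glue [ffun x => beta (s^-1 x)%g] gamma))); congr (_%:R : F); congr nat_of_bool.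
apply/rho_glueP/rho_glueP => -[H1 H2 H3]; split=> //.
- by move=> x y; rewrite !ffunE => E; have := H1 _ _ E; rewrite !ffunE !permKV.
- by move=> x y c; rewrite ffunE => E1 E2; have := H3 _ _ _ E1 E2; rewrite ffunE permKV.
- by move=> x y E; rewrite !ffunE; apply: H1; rewrite !ffunE !permK.
by move=> x y c E1 E2; rewrite ffunE; apply: (H3 _ _ c) => //; rewrite ffunE permK.
Qed.

Section FixedShape.
Variable l : seq nat.
Hypotheses (ln : partition_of n l) (lm : num_upper l = m).
Variable C : {ffun 'I_r -> box l} -> F.
Implicit Types (beta gamma : {ffun 'I_r -> box l}) (p : diagram r).

Let l_le : (num_upper l <= r)%N. Proof. by rewrite lm. Qed.

Lemma not_onto_killed beta gamma : ~~ onto beta || ~~ onto gamma ->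
  killed N (dia (box_glue beta gamma)).
Proof.
have mis (eta : {ffun 'I_r -> box l}) : ~~ onto eta -> exists2 c, up c & forall x, eta x != c.
  move=> no; case: (pickP [pred c | up c & [forall x, eta x != c]]) => [c /andP[uc /forallP H]|H].
    by exists c.
  case/negP: no; apply/ontoP => c uc; have := H c; rewrite /= uc /=.
  by move=> /negbT/forallPn[x /negPn/eqP xc]; exists x.
case/orP=> /mis[c uc cN]; apply: (miss_killed (b := c)) => // x y E; last by rewrite E.
Qed.

Lemma vfam_onto b beta : ~~ onto beta -> vfam C b beta = 0.
Proof.
move=> no; apply: killed_Phi => //; apply: killed_sum => // gamma; apply: killedZ => //.
by apply: not_onto_killed; rewrite no.
Qed.

Lemma half_sum_nonzero p beta beta' : onto beta -> onto beta' -> act_spec p beta beta' ->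
  dia p ** half_sum C beta = n%:R ^+ act_exponent p (tab beta) *: half_sum C beta'.
Proof.
move=> ob ob' s; rewrite /half_sum (pmul_sumr r_gt0 le2rn) scaler_sumr; apply: eq_bigr => gamma _.
rewrite (pmulZr r_gt0 le2rn).
rewrite (diag_glue_nonzero F r_gt0 le2rn gamma ob ob' s) !scalerA.
by congr (_ *: _); rewrite mulrC.
Qed.

(** Minimality of m enters here: up to a nonzero factor each term is a product with a diagram that
    misses a mark, and N kills it. *)
Lemma half_sum_zero p beta : onto beta -> ~~ act_nonzero p (tab beta) ->
  killed N (dia p ** half_sum C beta).
Proof.
move=> ob nz; rewrite /half_sum (pmul_sumr r_gt0 le2rn); apply: killed_sum => // gamma.
rewrite (pmulZr r_gt0 le2rn); apply: killedZ => //.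
have [og|nog] := boolP (onto gamma); last first.
  by apply: killed_mul => //; apply: not_onto_killed; rewrite nog orbT.
have [e [c [beta' [gamma' [e0 uc mis E]]]]] :=
  diag_glue_zero r_gt0 le2rn ln l_le (@char0F F) ob og nz.
apply: (@killed_scaled F r k n r_gt0 le2rn N repN e _ e0); rewrite E.
by apply: killed_mul => //; apply: (miss_killed (b := c)).
Qed.

Lemma Phi_vfam c b y beta : Phi c b y (vfam C b beta) =
  \sum_p (y ** 's_b) p *: Phi c a0 (dia p ** half_sum C beta) u0.
Proof.
rewrite /vfam Phi_mul // eqxx {1}[y ** 's_b]diag_decomposition.
rewrite (pmul_suml r_gt0 le2rn) Phi_suml //; apply: eq_bigr => p _.
by rewrite (pmulZl r_gt0 le2rn) PhiZl.
Qed.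

End FixedShape.

End DiagramFamilies.

(** * Alternating families and their enlargement *)

Section AlternatingFamilies.
Variables (F : numClosedFieldType) (r k n : nat).
Hypotheses (r_gt0 : (0 < r)%N) (le2rn : (2 * r <= n)%N).
Variable N : module (MP F r k n).
Hypothesis repN : is_representation N.
Variables (a0 : weight r k) (u0 : mod_ambient N).
Hypothesis u0N : u0 \in mod_space N.
Local Notation vf := (vfam a0 u0).
Local Notation half l := {ffun 'I_r -> box l}.

Definition alternates l (C : half l -> F) (X : {set box l}) : Prop :=
  forall x y, x \in X -> y \in X -> x != y -> forall b (beta : half l),
    vf C b [ffun i => tperm x y (beta i)] = - vf C b beta.

Definition admissible l (CC : {set {set box l}}) (C : half l -> F) : Prop :=
  [/\ trivIset CC, set0 \notin CC, forall X x, X \in CC -> x \in X -> up x,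
      exists b beta, vf C b beta != 0 & forall X, X \in CC -> alternates C X].

(* The base 3 makes enlarging a member X by one element at the expense of a
   second, not larger, member profitable. *)
Definition family_size l (CC : {set {set box l}}) : nat := (\sum_(X in CC) 3 ^ #|X|)%N.

Lemma alternates_transport l l' (e : box l -> box l') (e' : box l' -> box l)
    (C : half l' -> F) (X : {set box l}) :
  cancel e e' -> cancel e' e -> (forall c, up (e c) = up c) -> alternates C (e @: X) ->
  alternates (fun gamma : half l => C [ffun i => e (gamma i)]) X.
Proof.
move=> eK e'K eu aC x y xX yX xy b beta.
rewrite -!(vfam_reindex a0 u0 C b _ eK e'K eu).
have -> : [ffun i => e ([ffun i => tperm x y (beta i)] i)] =
    [ffun i => tperm (e x) (e y) ([ffun i => e (beta i)] i)] :> half l'.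
  by apply/ffunP => i; rewrite !ffunE inj_tperm //; apply: can_inj eK.
by apply: aC; rewrite ?imset_f // (inj_eq (can_inj eK)).
Qed.

Lemma admissible_transport l l' (e : box l -> box l') (e' : box l' -> box l)
    (C : half l' -> F) (CC : {set {set box l}}) :
  cancel e e' -> cancel e' e -> (forall c, up (e c) = up c) ->
  admissible [set e @: (X : {set box l}) | X in CC] C ->
  admissible CC (fun gamma : half l => C [ffun i => e (gamma i)]).
Proof.
move=> eK e'K eu [tC C0 Cu [b [beta nz]] aC]; have eI := can_inj eK; split.
- apply/trivIsetP => X Y XC YC XY.
  have /trivIsetP/(_ (e @: X) (e @: Y)) := tC; rewrite !imset_f // (inj_eq (imset_inj eI)).
  move=> /(_ isT isT XY); rewrite -!setI_eq0 -imsetI; last by move=> ? ? _ _ /eI.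
  by rewrite imset_eq0.
- by apply: contra C0 => C0; apply/imsetP; exists set0; rewrite ?imset0.
- by move=> X x XC xX; rewrite -eu; apply: (Cu (e @: X)); apply: imset_f.
- exists b, [ffun i => e' (beta i)]; rewrite -(vfam_reindex a0 u0 C b _ eK e'K eu).
  by rewrite (_ : [ffun i => _] = beta) //; apply/ffunP => i; rewrite !ffunE e'K.
by move=> X XC; apply: alternates_transport eK e'K eu _; apply: aC; apply: imset_f.
Qed.

Lemma family_size_transport l l' (e : box l -> box l') (CC : {set {set box l}}) :
  injective e -> family_size [set e @: (X : {set box l}) | X in CC] = family_size CC.
Proof.
move=> eI; rewrite /family_size big_imset /=; last by move=> X Y _ _ /(imset_inj eI).
by apply: eq_bigr => X _; rewrite card_imset.
Qed.

Section Improvement.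
Variable l : seq nat.
Implicit Types (C : half l -> F) (CC : {set {set box l}}) (beta : half l).

Lemma vfam_lincomb (I : finType) (P : pred I) (d : I -> F) (G : I -> half l -> F) b beta :
  vf (fun gamma => \sum_(i | P i) d i * G i gamma) b beta =
  \sum_(i | P i) d i *: vf (G i) b beta.
Proof.
rewrite (vfam_sum r_gt0 le2rn repN a0 u0N).
under [RHS]eq_bigr => i _ do rewrite (vfam_sum r_gt0 le2rn repN a0 u0N) scaler_sumr.
rewrite exchange_big /=; apply: eq_bigr => gamma _; rewrite scaler_suml.
by apply: eq_bigr => i _; rewrite scalerA.
Qed.

Lemma vfam_perm C (s : {perm box l}) b beta : (forall c, up (s c) = up c) ->
  vf C b [ffun i => s (beta i)] = vf (fun gamma : half l => C [ffun i => s (gamma i)]) b beta.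
Proof.
exact: (vfam_reindex a0 u0 C b beta (permK s) (permKV s)).
Qed.

(** Alternation on a singleton is vacuous, so an uncovered mark can always be added; a maximal
    system covers all marks. *)
Lemma admissible_cover CC C c : admissible CC C -> up c -> c \notin cover CC ->
  admissible ([set c] |: CC) C /\ (family_size CC < family_size ([set c] |: CC))%N.
Proof.
move=> [tC C0 Cu nz aC] uc cN.
have [|t1 nC] := @trivIsetU1 _ [set c] CC _ tC C0.
  move=> X XC; rewrite disjoints1; apply: contra cN => cX.
  by apply/bigcupP; exists X.
split; last first.
  by rewrite /family_size big_setU1 //= cards1 -[X in (X < _)%N]add0n ltn_add2r.
split=> //.
- rewrite in_setU1 negb_or C0 andbT; apply/eqP => /setP/(_ c).
  by rewrite !inE eqxx.
- by move=> X x /setU1P[->|]; [rewrite inE => /eqP-> | exact: Cu].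
move=> X /setU1P[->|]; last exact: aC.
by move=> x y /set1P-> /set1P->; rewrite eqxx.
Qed.

(** The nonzero sum is itself a value of a family that alternates on [A] by construction, and still
    on the other members since they are disjoint from [A]. Replacing X and Y by A pays, as 3^|A| >=
    3 * 3^|X| > 3^|X| + 3^|Y|. *)
Lemma admissible_garnir CC C (X Y A : {set box l}) b beta : admissible CC C ->
  X \in CC -> Y \in CC -> X != Y -> (#|Y| <= #|X|)%N -> A \subset X :|: Y -> (#|X| < #|A|)%N ->
  \sum_(s | perm_on A s) (-1) ^+ s *: vf C b [ffun i => s (beta i)] != 0 ->
  exists CC' C', admissible CC' C' /\ (family_size CC < family_size CC')%N.
Proof.
move=> [tC C0 Cu _ aC] XC YC XY YX AXY XA nz.
have Au x : x \in A -> up x.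
  by move/(subsetP AXY)/setUP => [|]; [exact: Cu XC | exact: Cu YC].
have su (s : {perm box l}) : perm_on A s -> forall c, up (s c) = up c.
  move=> sA c; have [cA|cA] := boolP (c \in A); last by rewrite (out_perm sA).
  by rewrite !Au // (perm_closed c sA).
(* By [vfam_perm] a permutation of the marks of the top half can be moved into the coefficients of
   the bottom halves. *)
pose C' gamma := \sum_(s : {perm box l} | perm_on A s) (-1) ^+ s * C [ffun i => s (gamma i)].
have C'E b' beta' : vf C' b' beta' = \sum_(s : {perm box l} | perm_on A s) (-1) ^+ s *: vf C b' [ffun i => s (beta' i)].
  rewrite /C' vfam_lincomb; apply: eq_bigr => s sA.
  by rewrite (vfam_perm C b' beta' (su s sA)).
pose CC0 := CC :\ X :\ Y.
have C0P Z : Z \in CC0 -> [/\ Z \in CC, [disjoint A & Z] & Z != set0].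
  rewrite !inE => /and3P[ZY ZX ZC]; split=> //; last by apply: contraNneq C0 => <-.
  apply: disjointWl AXY _; rewrite -setI_eq0 setIUl setU_eq0 !setI_eq0.
  by rewrite !(trivIsetP tC) // eq_sym.
exists (A |: CC0), C'; have [|||tC' AN] := @trivIsetU1 _ A CC0.
- by move=> Z /C0P[].
- by apply: trivIsetS tC; apply/subsetP => Z /C0P[].
- by apply/negP => /C0P[_ _]; rewrite eqxx.
split; last first.
  rewrite /family_size big_setU1 //= (big_setD1 X XC) /= (big_setD1 Y) /=; last first.
    by rewrite !inE eq_sym XY.
  rewrite addnA ltn_add2r; apply: leq_trans (_ : 3 ^ #|X|.+1 <= _)%N; last by rewrite leq_exp2l.
  have lt3 z w : (w <= z -> 0 < z -> z + w < 3 * z)%N by clear; lia.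
  by rewrite expnS; apply: lt3; rewrite ?leq_exp2l // expn_gt0.
split=> //.
- rewrite in_setU1 negb_or; apply/andP; split; last by apply/negP => /C0P[_ _]; rewrite eqxx.
  by rewrite eq_sym -card_gt0; apply: leq_ltn_trans XA.
- by move=> Z x /setU1P[->|/C0P[ZC _ _]]; [exact: Au | exact: Cu].
- by exists b, beta; rewrite C'E.
move=> Z /setU1P[->|/C0P[ZC AZ _]] x y xZ yZ xy b' beta'; rewrite !C'E.
  have tA : perm_on A (tperm x y).
    by apply/subsetP => z; rewrite inE; case: tpermP => [->|->|_ _]; rewrite ?eqxx.
  rewrite [LHS](reindex_inj (mulgI (tperm x y))).
  rewrite -[RHS]sumrN.
  apply: eq_big => s.
    by apply/idP/idP => [|sA]; [move/(perm_onM tA); rewrite mulgA tperm2 mul1g | exact: perm_onM].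
  move=> sA; rewrite odd_mul_tperm xy signrN scaleNr; congr (- (_ *: vf C b' _)).
  by apply/ffunP => i; rewrite !ffunE permM tpermK.
rewrite -[RHS]sumrN.
apply: eq_bigr => s sA.
have tZ : perm_on Z (tperm x y).
  by apply/subsetP => z; rewrite inE; case: tpermP => [->|->|_ _]; rewrite ?eqxx.
have st : commute s (tperm x y) := perm_onC sA tZ AZ.
rewrite -scalerN -(aC Z ZC x y xZ yZ xy); congr (_ *: vf C b' _).
by apply/ffunP => i; rewrite !ffunE -!permM st.
Qed.

End Improvement.

End AlternatingFamilies.

(** * Conjugate partitions and shapes with prescribed columns *)

Lemma count_sorted_nth (s : seq nat) i j : sorted geq s ->
  (j < count (fun c => (i < c)%N) s)%N = (i < nth 0%N s j)%N.
Proof.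
elim: s j => [|c s IH] j /=; first by rewrite nth_nil !ltn0.
move=> pcs; have ss := path_sorted pcs.
have cmax : all (geq c) s := order_path_min (rev_trans leq_trans) pcs.
case: (ltnP i c) => ic; first by case: j => [|j] //=; rewrite -IH.
rewrite add0n (_ : count _ s = 0%N); last first.
  apply/eqP; rewrite -leqn0 leqNgt -has_count; apply/hasP => -[d ds].
  by rewrite ltnNge (leq_trans (allP cmax d ds) ic).
case: j => [|j] /=; first by rewrite ltn0 ltnNge ic.
rewrite ltn0; apply/esym/negbTE; rewrite -leqNgt; apply: leq_trans ic.
have [js|js] := ltnP j (size s); last by rewrite nth_default.
exact: (allP cmax _ (mem_nth 0%N js)).
Qed.

(** Above a first row taking up the remaining boxes stands the conjugate of the partition [s], so
    that [s] lists the column lengths there. *)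
Definition column_shape (n : nat) (s : seq nat) : seq nat :=
  (n - sumn s)%N :: [seq count (fun c => (i < c)%N) s | i <- iota 0 (head 0%N s)].

Section ColumnShape.
Variables (n : nat) (s : seq nat).
Hypotheses (s_sorted : sorted geq s) (s_pos : 0%N \notin s) (le_sn : (sumn s + sumn s <= n)%N)
  (n_gt0 : (0 < n)%N).

Lemma nth_column_shape i : nth 0%N (column_shape n s) i.+1 = count (fun c => (i < c)%N) s.
Proof.
rewrite /=; have [ih|ih] := ltnP i (head 0%N s).
  by rewrite (nth_map 0%N) ?size_iota // nth_iota.
rewrite nth_default ?size_map ?size_iota //; apply/esym/eqP; rewrite -leqn0 leqNgt.
by rewrite count_sorted_nth // nth0 -leqNgt.
Qed.

Lemma column_shape_partition : partition_of n (column_shape n s).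
Proof.
have ssum : sumn [seq count (fun c => (i < c)%N) s | i <- iota 0 (head 0%N s)] = sumn s.
  rewrite !sumnE big_map; under eq_bigr => i _ do rewrite -sum1_count big_mkcond.
  rewrite exchange_big /=; apply: eq_big_seq => c cs.
  have ch : (c <= head 0%N s)%N.
    case: s s_sorted cs => //= c0 s' pcs; rewrite inE => /orP[/eqP->//|cs'].
    exact: (allP (order_path_min (rev_trans leq_trans) pcs)).
  rewrite -big_mkcond sum1_count -(subnKC ch) iotaD count_cat add0n.
  rewrite (@eq_in_count _ _ predT) ?count_predT ?size_iota; last by move=> i; rewrite mem_iota.
  rewrite (@eq_in_count _ _ pred0) ?count_pred0 ?addn0 // => i.
  by rewrite mem_iota => /andP[ci _] /=; rewrite ltnNge ci.
apply/and3P; split.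
- rewrite /= (path_sortedE (rev_trans leq_trans)); apply/andP; split.
    apply/allP => _ /mapP[i _ ->] /=; rewrite /geq /= leq_subRL; last first.
      by apply: leq_trans le_sn; apply: leq_addr.
    apply: leq_trans le_sn; rewrite leq_add2l; apply: leq_trans (count_size _ _) _.
    by elim: s s_pos => //= c s' IH; rewrite inE negb_or eq_sym -lt0n => /andP[c0 /IH] /=; rewrite -add1n; apply: leq_add.
  apply: (homo_sorted (e := ltn)); last exact: iota_ltn_sorted.
  by move=> i j /= ij; apply: sub_count => c; apply: ltn_trans.
- rewrite inE negb_or; apply/andP; split.
    by rewrite eq_sym subn_eq0 -ltnNge; move: le_sn n_gt0; case: (sumn s) => // t; clear; lia.
  have pos : all (ltn 0) [seq count (fun c => (i < c)%N) s | i <- iota 0 (head 0%N s)].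
    apply/allP => _ /mapP[i ih ->] /=; rewrite count_sorted_nth // nth0.
    by move: ih; rewrite mem_iota.
  by apply: contraTN pos => m0; apply/allPn; exists 0%N.
by rewrite /= ssum subnK //; apply: leq_trans le_sn; apply: leq_addr.
Qed.

End ColumnShape.

(** * A maximal family yields columns and Garnir relations *)

Section MaximalFamily.
Variables (F : numClosedFieldType) (r k n : nat).
Hypotheses (r_gt0 : (0 < r)%N) (le2rn : (2 * r <= n)%N).
Variable N : module (MP F r k n).
Hypothesis repN : is_representation N.
Variables (a0 : weight r k) (u0 : mod_ambient N).
Hypothesis u0N : u0 \in mod_space N.
Local Notation vf := (vfam a0 u0).
Local Notation half l := {ffun 'I_r -> box l}.
Variables (l0 : seq nat) (C0 : half l0 -> F).
Hypotheses (ln0 : partition_of n l0) (le_mr : (num_upper l0 <= r)%N).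
Hypothesis C0_neq0 : exists b beta, vf C0 b beta != 0.

(** The maximum is taken over the set systems alone, which are finitely many; the coefficients stay
    existentially quantified. *)
Lemma maximal_family : exists CC C, @admissible F r k n N a0 u0 l0 CC C /\
  forall CC' C', @admissible F r k n N a0 u0 l0 CC' C' -> (family_size CC' <= family_size CC)%N.
Proof.
pose P CC := boolp.asbool (exists C, @admissible F r k n N a0 u0 l0 CC C).
have P0 : P set0.
  apply/boolp.asboolP; exists C0; split=> //; rewrite ?inE //.
  - by apply/trivIsetP => X Y; rewrite inE.
  - by move=> X x; rewrite inE.
  by move=> X; rewrite inE.
case: (@arg_maxnP _ set0 P (@family_size l0) P0) => CC /boolp.asboolP[C aC] CCmax.
exists CC, C; split=> // CC' C' a'; apply: CCmax; apply/boolp.asboolP; by exists C'.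
Qed.

(** The marks are moved to a shape whose upper columns have the sizes of the members in decreasing
    order, so that the members become the columns. For j < j' the second column is then not longer,
    and a nonzero Garnir sum would contradict maximality. *)
Lemma column_family : exists l, exists C : half l -> F,
  [/\ partition_of n l /\ num_upper l = num_upper l0,
      exists b beta, vf C b beta != 0,
      forall x y, up x -> up y -> box_col x = box_col y -> x != y -> forall b (beta : half l),
        vf C b [ffun i => tperm x y (beta i)] = - vf C b beta
    & forall (j j' : nat) (A : {set box l}), (j < j')%N ->
        (forall b, b \in A -> up b /\ (box_col b = j \/ box_col b = j')) ->
        (#|[set b : box l | up b & box_col b == j]| < #|A|)%N -> forall b (beta : half l),
        \sum_(s | perm_on A s) (-1) ^+ s *: vf C b [ffun i => s (beta i)] = 0].
Proof.
have [CC0 [C1 [a1 max1]]] := maximal_family; have [tC C0N Cu nz alt1] := a1.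
have mr := le_mr; set m := num_upper l0 in mr *.
have cov x : up x -> x \in cover CC0.
  move=> ux; apply: contraT => xN; have [a2] := admissible_cover a1 ux xN.
  by rewrite ltnNge (max1 _ _ a2).
pose cs := sort (fun X Y : {set box l0} => (#|Y| <= #|X|)%N) (enum CC0).
have cs_mem X : (X \in cs) = (X \in CC0) by rewrite mem_sort mem_enum.
have cs_uniq : uniq cs by rewrite sort_uniq enum_uniq.
pose s := [seq #|X| | X : {set box l0} <- cs].
have s_sorted : sorted geq s.
  rewrite sorted_map; apply: (sort_sorted_in (P := predT)) => //; last by apply/allP.
  by move=> X Y _ _; apply: leq_total.
have s_pos : 0%N \notin s.
  apply/negP => /mapP[X]; rewrite cs_mem => XC /esym/eqP; rewrite cards_eq0 => /eqP X0.
  by move: C0N; rewrite -X0 XC.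
have sum_s : sumn s = m.
  rewrite sumnE big_map (perm_big _ (permEl (perm_sort _ _))) big_enum /=.
  rewrite /m /num_upper -[RHS]cardsE; rewrite (_ : [set x | _] = cover CC0).
    by move/eqP: tC => <-.
  apply/setP => x; rewrite inE; apply/idP/idP => [/cov //|/bigcupP[X XC xX]].
  exact: Cu XC xX.
have n_gt0 : (0 < n)%N by apply: leq_trans le2rn; rewrite muln_gt0.
have le_sn : (sumn s + sumn s <= n)%N.
  by rewrite sum_s addnn -mul2n; apply: leq_trans le2rn; rewrite leq_mul2l.
have ln := column_shape_partition s_sorted s_pos le_sn n_gt0.
pose l := column_shape n s; rewrite -/l in ln.
have lm : num_upper l = m.
  have := card_first_row r_gt0 le2rn ln; rewrite [nth _ _ _]/= sum_s.
  have : (m <= n)%N by rewrite -sum_s; apply: leq_trans le_sn; apply: leq_addr.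
  by clear; lia.
pose X_ j := nth set0 cs j.
have X_mem j : (j < size cs)%N -> X_ j \in CC0 by move=> js; rewrite -cs_mem mem_nth.
have box_lt (b : box l) : up b -> ((box_row b).-1 < #|X_ (box_col b)|)%N /\ (box_col b < size cs)%N.
  move=> ub; have : (box_col b < nth 0%N l (box_row b))%N := ltn_ord (tagged b).
  rewrite -(prednK ub) (nth_column_shape n s_sorted).
  rewrite count_sorted_nth // => lt.
  have js : (box_col b < size cs)%N.
    by rewrite -(size_map (fun X : {set box l0} => #|X|)); apply: contraTltn lt => js; rewrite nth_default.
  by split=> //; move: lt; rewrite (nth_map set0).
have XY : #|box l| = #|box l0| by rewrite (card_box ln) (card_box ln0).
have [b0 _] : exists b : box l0, true.
  have : (0 < #|box l0|)%N by rewrite (card_box ln0).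
  by case/card_gt0P=> b _; exists b.
(* Row i of column j receives the element of index i - 1 of the member [X_ j], because rows above
   the first start at 1. *)
pose g (b : box l) := nth b0 (enum (X_ (box_col b))) (box_row b).-1.
have gX (b : box l) : up b -> g b \in X_ (box_col b).
  by move=> ub; have [lt _] := box_lt b ub; rewrite -mem_enum mem_nth // -cardE.
have X_inj i j x : (i < size cs)%N -> (j < size cs)%N -> x \in X_ i -> x \in X_ j -> i = j.
  move=> ic jc xi xj; apply/eqP; rewrite -(nth_uniq set0 ic jc cs_uniq).
  apply: contraT => /(trivIsetP tC _ _ (X_mem i ic) (X_mem j jc)) /pred0P/(_ x).
  by rewrite /= xi xj.
have [b c ub uc E|b ub||e [eI eg eu]] := @extend_injection _ _ (fun b : box l => up b) (fun b : box l0 => up b) g _ _ _ XY.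
- have [ltb bs] := box_lt b ub; have [ltc cs'] := box_lt c uc.
  have cE : box_col b = box_col c by apply: (X_inj _ _ (g b)); rewrite ?gX // E gX.
  apply: box_eq => //; apply: val_inj; apply: succn_inj => /=.
  move: E; rewrite /g cE => /eqP; rewrite nth_uniq ?enum_uniq -?cardE -?cE // ?cE //.
  by move=> /eqP E; congr _.+1; rewrite -(prednK ub) E prednK.
- by apply: (Cu (X_ (box_col b))); [apply: X_mem; have [] := box_lt b ub | apply: gX].
- exact: lm.
have [e' eK e'K] : bijective e by apply: (inj_card_bij eI); rewrite XY.
pose col j := [set b : box l | up b & box_col b == j].
have e_col j : (j < size cs)%N -> e @: col j = X_ j.
  move=> js; apply/setP => y; apply/imsetP/idP => [[b]|yX].
    by rewrite inE => /andP[ub /eqP <-] ->; rewrite eg // gX.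
  have uy : up (e' y) by rewrite -eu e'K; apply: Cu (X_mem j js) yX.
  exists (e' y); rewrite ?e'K // inE uy /=; apply/eqP.
  have [_ cs'] := box_lt _ uy.
  by apply: (X_inj _ _ y) => //; rewrite -{1}(e'K y) eg // gX.
pose CC : {set {set box l}} := [set e' @: (X : {set box l0}) | X in CC0].
have eCC : [set e @: (X : {set box l}) | X in CC] = CC0.
  rewrite -imset_comp (eq_imset (g := id)) ?imset_id // => X /=.
  by rewrite -imset_comp (eq_imset _ e'K) imset_id.
have colCC j : (j < size cs)%N -> col j \in CC.
  move=> js; apply/imsetP; exists (X_ j); first exact: X_mem.
  by rewrite -e_col // -imset_comp (eq_imset _ eK) imset_id.
have card_col j : (j < size cs)%N -> #|col j| = #|X_ j| by move=> js; rewrite -e_col // card_imset.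
rewrite -eCC in a1; have a2 := admissible_transport eK e'K eu a1.
pose C := fun gamma : half l => C1 [ffun i => e (gamma i)]; rewrite -/C in a2.
have max2 CC' C' : @admissible F r k n N a0 u0 l CC' C' -> (family_size CC' <= family_size CC)%N.
  move=> a'; rewrite -(family_size_transport CC eI) eCC.
  have E : [set e' @: (X : {set box l0}) | X in [set e @: (X : {set box l}) | X in CC']] = CC'.
    rewrite -imset_comp (eq_imset (g := id)) ?imset_id // => X /=.
    by rewrite -imset_comp (eq_imset _ eK) imset_id.
  rewrite -(family_size_transport CC' eI).
  have eu' c : up (e' c) = up c by rewrite -eu e'K.
  rewrite -E in a'; exact: max1 _ _ (admissible_transport e'K eK eu' a').
have [tCC CC0N CCu nz2 alt2] := a2.
exists l, C; split=> //.
- move=> x y ux uy cxy xy b beta; have [_ xs] := box_lt x ux.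
  by apply: (alt2 _ (colCC _ xs)); rewrite ?inE ?ux ?uy ?cxy ?eqxx.
move=> j j' A jj HA cA b beta; apply/eqP; apply: contraT => nz3.
have Aj : A \subset col j :|: col j'.
  by apply/subsetP => c /HA[uc [cj|cj]]; rewrite !inE uc cj eqxx ?orbT.
(* [A] is larger than column j, so it has a box in column j', which is therefore one of the
   members. *)
have js' : (j' < size cs)%N.
  have [x xA xj] : exists2 x, x \in A & x \notin col j.
    by apply/subsetPn; apply: contraTN cA => /subset_leq_card; rewrite -leqNgt.
  have [ux [xc|xc]] := HA x xA; first by move: xj; rewrite inE ux xc eqxx.
  by have [_] := box_lt x ux; rewrite xc.
have js : (j < size cs)%N := ltn_trans jj js'.
have ncol : col j != col j'.
  apply: contraTneq jj => E; rewrite -leqNgt.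
  have /card_gt0P[y yX] : (0 < #|X_ j'|)%N.
    by rewrite card_gt0; apply: contraNneq C0N => <-; apply: X_mem.
  by rewrite (X_inj j j' y) // -e_col // E e_col.
have le_col : (#|col j'| <= #|col j|)%N.
  rewrite !card_col //; have := sorted_ltn_nth (rev_trans leq_trans) 0%N s_sorted.
  move=> /(_ j j'); rewrite !inE size_map => /(_ js js' jj).
  by rewrite !(nth_map set0).
have [CC' [C' [a' lt]]] := admissible_garnir r_gt0 le2rn repN u0N a2 (colCC j js) (colCC j' js') ncol le_col Aj cA nz3.
by move: lt; rewrite ltnNge (max2 _ _ a').
Qed.

End MaximalFamily.

(** * Schur's lemma for modules carried by subspaces *)

Section SchurLemma.
Variables (F : fieldType) (A : algebra F) (M N : module A).
Hypotheses (irrM : irreducible_representation M) (irrN : irreducible_representation N).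
Local Notation MS := (mod_space M).
Local Notation NS := (mod_space N).

Lemma schur (f : 'Hom(mod_ambient M, mod_ambient N)) :
  (forall u, u \in MS -> f u \in NS) ->
  (forall x u, x \in alg_space A -> u \in MS -> f (mod_act x u) = mod_act x (f u)) ->
  (exists2 u, u \in MS & f u != 0) -> isomorphic_modules N M.
Proof.
move=> fN fA [u1 u1M fu1].
have [[stM _ _ _ _] _ subM] := irrM; have [[stN _ linN _ _] _ subN] := irrN.
have act0 x : x \in alg_space A -> mod_act x 0 = 0 :> mod_ambient N.
  move=> xA; have := linN (-1) x xA 0 0 (mem0v _) (mem0v _).
  by rewrite scaler0 addr0 scaleN1r addNr.
have kerf : (MS :&: lker f)%VS = 0%VS.
  have [|//|E] := subM (MS :&: lker f)%VS.
    split; first exact: capvSl.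
    move=> x u xA /memv_capP[uM]; rewrite memv_ker => /eqP fu.
    by apply/memv_capP; split; [exact: stM | rewrite memv_ker fA // fu act0].
  by case/eqP: fu1; apply/eqP; rewrite -memv_ker; move: u1M; rewrite -E => /memv_capP[].
have fI : {in MS &, injective f}.
  move=> u v uM vM E; apply/eqP; rewrite -subr_eq0 -memv0 -kerf memv_cap.
  by rewrite memvB //= memv_ker linearB /= E subrr.
have imf : (f @: MS)%VS = NS.
  have [|E|//] := subN (f @: MS)%VS.
    split; first by apply/subvP => _ /memv_imgP[u uM ->]; apply: fN.
    by move=> x _ xA /memv_imgP[u uM ->]; rewrite -fA //; apply/memv_img/stM.
  by case/eqP: fu1; apply/eqP; rewrite -memv0 -E memv_img.
(* Nothing is known about [f] outside [MS]; composing with the projection gives a map with image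
   exactly [NS], whose section is then projected back into [MS]. *)
pose h := (f \o projv MS)%VF.
have limgh : limg h = NS by rewrite limg_comp limg_proj imf.
pose g := (projv MS \o h^-1)%VF.
have gM w : g w \in MS by rewrite lfunE /= memv_proj.
have gK w : w \in NS -> f (g w) = w.
  by move=> wN; have := @limg_lfunVK _ _ _ h w; rewrite limgh => /(_ wN); rewrite !lfunE.
exists g; split.
- by move=> w w' wN wN' E; rewrite -(gK w wN) -(gK w' wN') E.
- apply/eqP; rewrite eqEsubv; apply/andP; split.
    by apply/subvP => _ /memv_imgP[w _ ->]; apply: gM.
  apply/subvP => u uM; have -> : u = g (f u) by apply: fI; rewrite ?gK ?fN.
  by rewrite memv_img ?fN.
move=> x w xA wN; apply: fI; rewrite ?gM ?stM // fA // !gK //; exact: stN.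
Qed.

End SchurLemma.

Section BasisMap.
Variables (F : fieldType) (V W : vectType F) (d : nat) (X : d.-tuple V) (Y : 'I_d -> W).

Definition basis_map (u : V) : W := \sum_i coord X i u *: Y i.

Lemma basis_map_is_linear : linear basis_map.
Proof.
move=> c u v; rewrite /basis_map scaler_sumr -big_split; apply: eq_bigr => i _.
by rewrite linearP scalerDl scalerA.
Qed.

HB.instance Definition _ := GRing.isLinear.Build F V W _ basis_map basis_map_is_linear.

Lemma basis_map_free (i : 'I_d) : free X -> basis_map X`_i = Y i.
Proof.
move=> Xf; rewrite /basis_map (bigD1 i) //= coord_free // eqxx scale1r.
by rewrite big1 ?addr0 // => j ji; rewrite coord_free // eq_sym (negPf ji) scale0r.
Qed.

End BasisMap.

(* The column group is generated by transpositions within columns. *)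
Lemma column_group_sign (F : fieldType) (V : lmodType F) (l : seq nat) (r : nat)
    (h : {ffun 'I_r -> box l} -> V) :
  (forall x y, up x -> up y -> box_col x = box_col y -> x != y -> forall beta : {ffun 'I_r -> box l},
     h [ffun i => tperm x y (beta i)] = - h beta) ->
  forall (s : {perm box l}) (beta : {ffun 'I_r -> box l}), s \in column_group l ->
    h [ffun i => s (beta i)] = (-1) ^+ s *: h beta.
Proof.
move=> alt s; have [d] := ubnP #|[set x | s x != x]|.
elim: d => // d IH in s *; rewrite ltnS => sd beta sC.
case: (pickP [pred x | s x != x]) => [x /= sx|s1]; last first.
  have -> : s = 1%g by apply/permP => x; rewrite perm1; apply/eqP; have := s1 x => /= /negbFE.
  rewrite odd_perm1 scale1r; congr h; apply/ffunP => i; by rewrite ffunE perm1.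
have /column_groupP/(_ x)[cx fx] := sC.
have ux : up x by apply: contraNT sx => /fx/eqP.
have usx : up (s x) by rewrite column_group_up.
pose t := tperm x (s x); have tC : t \in column_group l by apply: column_group_tperm.
pose s' := (s * t)%g.
have sE : s = (s' * t)%g by rewrite -mulgA tperm2 mulg1.
have s'd : (#|[set y | s' y != y]| < d)%N.
  apply: leq_trans sd; apply: proper_card; apply/properP; split.
    apply/subsetP => y; rewrite !inE; apply: contra => /eqP sy.
    have yx : y != x by apply: contraNneq sx => <-; rewrite sy.
    rewrite permM sy tpermD // eq_sym //.
    by apply: contraNneq yx => E; apply/eqP/(@perm_inj _ s); rewrite sy E.
  by exists x; rewrite !inE // permM tpermR eqxx.
have -> : [ffun i => s (beta i)] = [ffun i => t ([ffun i => s' (beta i)] i)] :> {ffun 'I_r -> box l}.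
  by apply/ffunP => i; rewrite !ffunE [in LHS]sE permM.
rewrite alt // ?cx // 1?eq_sym // IH //; last exact: column_groupM.
by rewrite odd_permM odd_tperm eq_sym sx addbT signrN scaleNr opprK.
Qed.

Lemma fib_inj l r : injective (@fib l r).
Proof.
move=> beta gamma E; apply/ffunP => x; apply/eqP.
by rewrite eq_sym -fibE -E fibE.
Qed.

(** * From a family obeying the Specht relations to a morphism *)

Section FamilyMorphism.
Variables (F : numClosedFieldType) (r k n : nat).
Hypotheses (r_gt0 : (0 < r)%N) (le2rn : (2 * r <= n)%N).
Local Notation A := (MP F r k n).
Local Notation "x ** y" := (partalg_mul n x y) (at level 40, left associativity).
Local Notation "'s_ a" := (young_idem F a) (at level 8, a at level 2).
Local Notation dia p := (diag_elt F (val p)).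
Variable N : module A.
Hypothesis repN : is_representation N.
Local Notation NS := (mod_space N).
Variable l : seq nat.
Hypotheses (ln : partition_of n l) (le_mr : (num_upper l <= r)%N).
Hypothesis miss_killed : forall (l' : seq nat) (beta gamma : {ffun 'I_r -> box l'}) (b : box l'),
  partition_of n l' -> num_upper l' = num_upper l -> up b ->
  (forall x y, beta x = gamma y -> beta x != b) -> killed N (dia (box_glue beta gamma)).
Variables (a0 : weight r k) (u0 : mod_ambient N).
Hypothesis u0N : u0 \in NS.
Variable C : {ffun 'I_r -> box l} -> F.
Local Notation vf := (vfam a0 u0 C).
Implicit Types (a b : weight r k) (beta gamma : {ffun 'I_r -> box l}) (T : mset_filling l r k).
Hypothesis vf_col : forall x y, up x -> up y -> box_col x = box_col y -> x != y ->
  forall b beta, vf b [ffun i => tperm x y (beta i)] = - vf b beta.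
Hypothesis vf_garnir : forall (j j' : nat) (X : {set box l}), (j < j')%N ->
  (forall b : box l, b \in X -> up b /\ (box_col b = j \/ box_col b = j')) ->
  (#|[set b : box l | up b & box_col b == j]| < #|X|)%N -> forall b beta,
  \sum_(s | perm_on X s) (-1) ^+ s *: vf b [ffun i => s (beta i)] = 0.

Definition on_filling a (T : set_filling l r) : mod_ambient N :=
  if [pick beta | onto beta && (fib beta == T)] is Some beta then vf a beta else 0.

Lemma on_filling_fib a beta : onto beta -> on_filling a (fib beta) = vf a beta.
Proof.
move=> ob; rewrite /on_filling; case: pickP => [gamma /andP[_ /eqP/fib_inj->]//|/(_ beta)].
by rewrite ob eqxx.
Qed.

(** The choice is harmless: labellings with the same coloring differ by the Young subgroup, which
    does not change [vf a]. *)
Definition on_mset a T : mod_ambient N :=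
  if [pick beta | onto beta && (coloring a (fib beta) == T)] is Some beta then vf a beta else 0.

Lemma on_mset_coloring a beta : onto beta -> on_mset a (coloring a (fib beta)) = vf a beta.
Proof.
move=> ob; rewrite /on_mset; case: pickP => [gamma /andP[_ /eqP E]|/(_ beta)]; last first.
  by rewrite ob eqxx.
have [s sa ->] := coloring_transitive E.
exact/esym/vfam_young.
Qed.

Definition w_image T : mod_ambient N := \sum_(a | has_weight a T) on_mset a T.

Definition w_tuple := in_tuple [seq w_vector F n T | T in SSMPT l r k].

Let empty_filling : mset_filling l r k := [ffun=> [ffun=> ord0]].

Definition family_map : 'Hom(mod_ambient (MPmod F r k n l), mod_ambient N) :=
  linfun (basis_map w_tuple (fun i => w_image (nth empty_filling (enum (SSMPT l r k)) i))).

Definition lift_map a (v : tabspace F r l) : mod_ambient N :=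
  family_map (inject a (yact n a v)).

Lemma lift_map_is_linear a : linear (lift_map a).
Proof.
by move=> c u v; rewrite /lift_map /yact act_linr [inject a _]linearP linearP.
Qed.

HB.instance Definition _ a := GRing.isLinear.Build F (tabspace F r l) (mod_ambient N) _
  (lift_map a) (lift_map_is_linear a).

Lemma w_imageE a T : has_weight a T -> w_image T = on_mset a T.
Proof.
move=> Ta; rewrite /w_image (big_pred1 a) // => b; apply/idP/eqP => [Tb|-> //].
exact: has_weight_inj Tb Ta.
Qed.

Lemma family_map_w T : T \in SSMPT l r k -> family_map (w_vector F n T) = w_image T.
Proof.
move=> TS; rewrite /family_map lfunE /=.
set e := enum (SSMPT l r k); set T0 := empty_filling.
have Te : T \in e by rewrite mem_enum.
have ie : (index T e < size w_tuple)%N by rewrite size_map index_mem.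
have := @basis_map_free _ _ _ _ w_tuple (fun i => w_image (nth T0 e i)) (Ordinal ie)
   (@w_vector_free F r k n l).
by rewrite /= nth_index // (nth_map T0) ?index_mem // nth_index.
Qed.

Lemma w_image_mem T : w_image T \in NS.
Proof.
apply: memv_suml => a _; rewrite /on_mset; case: pickP => [beta _|_]; last exact: mem0v.
exact: vfam_mem.
Qed.

Lemma family_map_mem u : family_map u \in NS.
Proof.
rewrite /family_map lfunE /=; apply: memv_suml => i _; apply: memvZ; exact: w_image_mem.
Qed.

(** The difference of the two candidate formulas, lifted to set tableaux, inherits the row, sign and
    Garnir relations and vanishes on semistandard tableaux. Straightening into the zero subspace
    shows that it vanishes everywhere. *)
Lemma family_map_wsum a T : T \in MPT l r k -> has_weight a T ->
  family_map (inject a (wsum F a T)) = on_mset a T.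
Proof.
move=> TM Ta; apply/eqP; rewrite -subr_eq0 -memv0; move: T TM Ta.
pose u (T : set_filling l r) := lift_map a (polytabloid F T) - on_filling a T.
have uE beta : onto beta -> u (fib beta) = lift_map a (tvec F beta) - vf a beta.
  by move=> ob; rewrite /u on_filling_fib.
have ofE (s : {perm box l}) beta : onto beta -> (forall b : box l, up (s b) = up b) ->
    on_filling a (refill (fib beta) s) = vf a [ffun x => (s^-1)%g (beta x)].
  move=> ob su; rewrite /refill fib_perm on_filling_fib //; apply/ontoP => b ub.
  have [x xb] := (ontoP _ ob) (s b) (etrans (su b) ub).
  by exists x; rewrite ffunE xb permK.
apply: (mset_straightening r_gt0 le2rn ln (u := u)).
- move=> T s /SPT_fib[beta ob ->] su; rewrite /u polytabloid_row0 //; congr (_ - _).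
  have su' (b : box l) : up (s b) = up b := congr1 (fun i : 'I_(size l) => (0 < i)%N) (row0_perm_row su b).
  rewrite (ofE s beta ob su') (on_filling_fib a ob); apply: vfam_row0 => c uc.
  by apply: (@perm_inj _ s); rewrite permKV su.
- move=> T s /SPT_fib[beta ob ->] sC; rewrite /u polytabloid_col // scalerBr.
  rewrite [lift_map a _]linearZ /=; congr (_ - _).
  rewrite (ofE s beta ob (fun c => column_group_up c sC)) (on_filling_fib a ob).
  have sVC : (s^-1)%g \in column_group l by rewrite column_groupV.
  have := @column_group_sign F _ l r (vf a) (fun x y ux uy cxy xy => vf_col ux uy cxy xy a) _ beta sVC.
  by rewrite odd_permV => ->.
- move=> T j j' X /SPT_fib[beta ob ->] jj HX cX.
  have su (s : {perm box l}) : perm_on X s -> forall b : box l, up (s b) = up b.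
    move=> sX b; have [bX|bX] := boolP (b \in X); last by rewrite (out_perm sX).
    have [-> _] := HX b bX; have sbX : s b \in X by rewrite (perm_closed b sX).
    by have [-> _] := HX _ sbX.
  transitivity (lift_map a (\sum_(s | perm_on X s) (-1) ^+ s *: polytabloid F (refill (fib beta) s)) -
     \sum_(s | perm_on X s) (-1) ^+ s *: vf a [ffun x => (s^-1)%g (beta x)]).
    rewrite [lift_map a _]linear_sum -sumrB; apply: eq_bigr => s sX.
    by rewrite /u scalerBr (ofE s beta ob (su s sX)) [in RHS]linearZ.
  rewrite (polytabloid_garnir (@char0F F) _ jj HX cX) [lift_map a _]linear0 sub0r; apply/eqP.
  rewrite oppr_eq0; apply/eqP; rewrite -[RHS](vf_garnir jj HX cX a beta).
  rewrite [LHS](reindex_inj invg_inj); apply: eq_big => s.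
    by apply/idP/idP => /perm_onV; rewrite ?invgK.
  by rewrite odd_permV invgK.
- move=> T /SPT_fib[beta ob ->]; rewrite (uE beta ob) (on_mset_coloring a ob).
  by rewrite (wsum_tvec F r_gt0 le2rn ln le_mr a ob).
move=> T TS Ta; rewrite -(w_vector_inject F n Ta) family_map_w // (w_imageE Ta).
by rewrite subrr mem0v.
Qed.

Lemma lift_map_tvec a beta : onto beta -> lift_map a (tvec F beta) = vf a beta.
Proof.
move=> ob; rewrite /lift_map -(wsum_tvec F r_gt0 le2rn ln le_mr a ob) family_map_wsum.
- exact: on_mset_coloring.
- exact: coloring_MPT.
exact: coloring_weight.
Qed.

(** Diagram by diagram both sides follow one rule: zero when the diagram kills the labelling,
    otherwise the same power of n and the same new labelling. *)
Lemma lift_map_act_tvec c a y beta : onto beta ->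
  lift_map c (partalg_act n y (yact n a (tvec F beta))) = Phi c a y (vf a beta).
Proof.
move=> ob; have tP := tvec_Pmod F r_gt0 le2rn ln ob.
rewrite (Phi_vfam r_gt0 le2rn repN a0 u0N).
rewrite /yact -(Pmod_act_mul r_gt0 le2rn ln le_mr y 's_a tP).
rewrite act_diag [lift_map c _]linear_sum; apply: eq_bigr => p _.
rewrite [LHS]linearZ; congr (_ *: _); rewrite -[LHS]/(lift_map c _).
have [[-> nz]|[beta' [ob' spec] ->]] := diag_act_tvec F r_gt0 le2rn ln le_mr p ob.
  rewrite [lift_map c _]linear0.
  have kil := half_sum_zero r_gt0 le2rn repN le_mr miss_killed ln erefl C ob nz.
  by rewrite (killed_Phi r_gt0 le2rn c a0 kil u0N).
rewrite (half_sum_nonzero r_gt0 le2rn C ob ob' spec) (PhiZl r_gt0 le2rn repN c a0 _ _ u0N).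
by rewrite [lift_map c _]linearZ /= lift_map_tvec.
Qed.

Lemma lift_map_act c a y v : v \in Pmod F r l ->
  lift_map c (partalg_act n y (yact n a v)) = Phi c a y (lift_map a v).
Proof.
have Phi_lin d (w w' : mod_ambient N) : w \in NS -> w' \in NS ->
    Phi c a y (d *: w + w') = d *: Phi c a y w + Phi c a y w' :> mod_ambient N.
  by case: repN => _ _ lin _ _; apply: lin; apply: (corner_mem r_gt0 le2rn).
move: v; apply: Pmod_ind => [d v w Ev Ew||beta ob].
- rewrite [lift_map a _]linearP Phi_lin ?family_map_mem // -Ev -Ew.
  by rewrite /yact !act_linr [lift_map c _]linearP.
- rewrite [lift_map a _]linear0 /yact !act0r [lift_map c _]linear0 /Phi (mod_act0r repN) //.
  exact: (corner_mem r_gt0 le2rn).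
by rewrite lift_map_tvec // lift_map_act_tvec.
Qed.

Lemma family_map_equivariant (x : alg_ambient A) u :
  x \in alg_space A -> u \in mod_space (MPmod F r k n l) ->
  family_map (mod_act x u) = mod_act x (family_map u).
Proof.
move=> xA uM; have repM := MPmod_representation F k r_gt0 le2rn ln le_mr.
have uP := mem_MPmod r_gt0 le2rn ln le_mr _ uM.
pose ua a := (u : {ffun weight r k -> tabspace F r l}) a.
have uaP a : ua a \in Pmod F r l by have [] := uP a.
have yua a : yact n a (ua a) = ua a by have [] := uP a.
have fu a : family_map (inject a (ua a)) = lift_map a (ua a) by rewrite /lift_map yua.
(* Values of [lift_map b] are fixed by the corner of s_b, so corners starting at another weight
   annihilate them. *)
have orth c a b y : a != b -> Phi c a y (lift_map b (ua b)) = 0 :> mod_ambient N.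
  move=> ab; have <- : Phi b b 's_b (lift_map b (ua b)) = lift_map b (ua b) :> mod_ambient N.
    by rewrite -lift_map_act // -/(yact n b _) !yua.
  by rewrite (Phi_mul r_gt0 le2rn repN) ?family_map_mem // (negPf ab).
rewrite (mod_act_Phi r_gt0 le2rn repM xA uM) [LHS]linear_sum.
rewrite (mod_act_Phi r_gt0 le2rn repN xA (family_map_mem u)).
apply: eq_bigr => -[c a] _ /=.
rewrite {1}/Phi /= (corner_act r_gt0 le2rn ln le_mr c a _ uM) -/(ua a) -{1}(yua a).
rewrite -/(lift_map c _) lift_map_act // [in RHS](inject_sum u) [family_map _]linear_sum.
rewrite [RHS](mod_act_sumr repN); [| exact: (corner_mem r_gt0 le2rn) | by move=> b; exact: family_map_mem].
rewrite (bigD1 a) //= big1 ?addr0 => [|b ba]; first by rewrite fu.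
by rewrite fu; apply: orth; rewrite eq_sym.
Qed.

End FamilyMorphism.

(** * Every irreducible module is of the listed form *)

Section Completeness.
Variables (F : numClosedFieldType) (r k n : nat).
Hypotheses (r_gt0 : (0 < r)%N) (le2rn : (2 * r <= n)%N).
Variable N : module (MP F r k n).
Hypothesis irrN : irreducible_representation N.
Local Notation NS := (mod_space N).
Local Notation dia p := (diag_elt F (val p)).

Let repN : is_representation N. Proof. by case: irrN. Qed.

(** The identity diagram, with all r vertices marked, guarantees a least m. A diagram missing a mark
    is also glued over a shape with m - 1 upper boxes, so minimality forces it to be killed. *)
Lemma minimal_marking : exists m, [/\ marked N m, (m <= r)%N &
  forall (l : seq nat) (beta gamma : {ffun 'I_r -> box l}) (b : box l),
    partition_of n l -> num_upper l = m -> up b ->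
    (forall x y, beta x = gamma y -> beta x != b) -> killed N (dia (box_glue beta gamma))].
Proof.
have N0 : NS <> 0%VS by case: irrN.
have ex : exists m, boolp.asbool (marked N m).
  by exists r; apply/boolp.asboolP; apply: (marked_r r_gt0 le2rn repN N0).
case: (ex_minnP ex) => m /boolp.asboolP Mm mmin; exists m.
have mr : (m <= r)%N by apply: mmin; apply/boolp.asboolP; apply: (marked_r r_gt0 le2rn repN N0).
split=> // l beta gamma b ln lm ub mis; apply: boolp.contrapT => nk.
have l_le : (num_upper l <= r)%N by rewrite lm.
have := box_glue_miss r_gt0 le2rn ln l_le ub mis; rewrite lm => -[beta' [gamma' E]].
have m0 : (0 < m)%N by rewrite -lm; apply/card_gt0P; exists b.
have mn : (m.-1 < n)%N by move: le2rn m0 mr; clear; lia.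
have mr1 : (m.-1 <= r)%N by move: mr; clear; lia.
suff /mmin : boolp.asbool (marked N m.-1) by move: m0; clear; lia.
apply/boolp.asboolP; exists (hook n m.-1); split=> //.
- exact: hook_partition.
- exact: (hook_num_upper r_gt0 le2rn).
by exists beta', gamma'; rewrite -E.
Qed.

Lemma MPmod_complete : exists2 l, Lambda_MP r k n l & isomorphic_modules N (MPmod F r k n l).
Proof.
have [m [[l0 [ln0 lm0 _ [beta0 [gamma0 nk]]]] mr mis]] := minimal_marking.
have l0r : (num_upper l0 <= r)%N by rewrite lm0.
pose C0 (gamma : {ffun 'I_r -> box l0}) : F := (gamma == gamma0)%:R.
have hs beta : half_sum C0 beta = dia (box_glue beta gamma0).
  rewrite /half_sum (bigD1 gamma0) //= /C0 eqxx scale1r big1 ?addr0 // => gamma /negPf->.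
  by rewrite scale0r.
have ob : onto beta0.
  apply: boolp.contrapT => /negP nob; apply: nk; apply: (not_onto_killed mis ln0 lm0).
  by rewrite nob.
(* [killed] allows a multiplication on the left, so nonvanishing is only witnessed after some
   diagram [p]; the family will be nonzero at the labelling to which [p] sends [beta0]. *)
have [b [a [p [u [uN nz]]]]] : exists (b a : weight r k) (p : diagram r) (u : mod_ambient N), u \in NS /\
    Phi b a (partalg_mul n (dia p) (half_sum C0 beta0)) u != 0 :> mod_ambient N.
  apply: boolp.contrapT => H; apply: nk => b a y u uN; rewrite [y]diag_decomposition.
  rewrite (pmul_suml r_gt0 le2rn) (Phi_suml r_gt0 le2rn repN) // big1 // => p _.
  rewrite (pmulZl r_gt0 le2rn) (PhiZl r_gt0 le2rn repN) // -hs.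
  apply/eqP; rewrite scaler_eq0; apply/orP; right; apply: contraT => nz.
  by case: H; exists b, a, p, u.
have nzp : act_nonzero p (tab beta0).
  apply: contraT => np; case/eqP: nz; apply: killed_Phi => //.
  exact: (half_sum_zero r_gt0 le2rn repN mr mis ln0 lm0 C0 ob np).
have [beta' ob' spec] := act_spec_exists (shape_size_gt0 r_gt0 le2rn ln0)
  (first_row_ge r_gt0 le2rn ln0 l0r) ob nzp.
have nz0 : exists b beta, vfam a u C0 b beta != 0.
  exists b, beta'; move: nz; rewrite (half_sum_nonzero r_gt0 le2rn C0 ob ob' spec).
  by rewrite (PhiZl r_gt0 le2rn repN) // scaler_eq0 negb_or => /andP[].
have [l [C [[ln lm] [c [beta nzc]] alt gar]]] :=
  column_family r_gt0 le2rn repN uN ln0 l0r nz0.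
have l_le : (num_upper l <= r)%N by rewrite lm.
rewrite -lm0 -lm in mis.
have obeta : onto beta.
  apply: contraT => nob; case/eqP: nzc.
  exact: (vfam_onto r_gt0 le2rn repN mis a uN ln erefl C c nob).
have fmem := @family_map_mem F r k n r_gt0 le2rn N repN l a u uN C.
pose w := inject c (yact n c (tvec F beta)) : mod_ambient (MPmod F r k n l).
have wM : w \in mod_space (MPmod F r k n l).
  by apply: (inject_mem r_gt0 le2rn ln l_le); apply: (tvec_Pmod F r_gt0 le2rn ln obeta).
have fw : family_map a u C w = vfam a u C c beta.
  exact: (lift_map_tvec r_gt0 le2rn ln l_le alt gar c obeta).
(* Without semistandard tableaux the module would be zero, whereas its vector [w] has a nonzero
   image. *)
have Ll : Lambda_MP r k n l.
  rewrite /Lambda_MP ln /=; apply/negP => /eqP S0; case/eqP: nzc; rewrite -fw.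
  have : (mod_space (MPmod F r k n l) <= 0)%VS.
    by apply: (MPmod_span r_gt0 le2rn ln l_le) => T; rewrite S0 inE.
  by move/subvP/(_ w wM); rewrite memv0 => /eqP->; rewrite linear0.
exists l => //; apply: (schur (MPmod_irreducible F r_gt0 le2rn Ll) irrN (f := family_map a u C)).
- by move=> v _; apply: fmem.
- move=> x v xA vM; exact: (family_map_equivariant r_gt0 le2rn repN ln l_le mis uN alt gar).
by exists w; rewrite // fw.
Qed.

End Completeness.

Theorem theorem6p2 (R : realType) (r k n : nat) :
  (0 < r)%N -> (0 < k)%N -> (2 * r <= n)%N ->
  complete_set_of_irreps (Lambda_MP r k n) (MPmod R[i] r k n) /\
  (forall l : seq nat, Lambda_MP r k n l ->
     basis_of (mod_space (MPmod R[i] r k n l))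
       [seq w_vector R[i] n T | T in SSMPT l r k]).
Proof.
move=> r_gt0 _ le2rn; split; last first.
  by move=> l /Lambda_MPP[ln le_mr _]; apply: (w_vector_basis R[i] k r_gt0 le2rn ln le_mr).
split=> [l|la mu|N].
- exact: (MPmod_irreducible R[i] r_gt0 le2rn).
- exact: (MPmod_not_isomorphic r_gt0 le2rn).
exact: (MPmod_complete r_gt0 le2rn).
Qed.
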